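(* Let $W$ be a real random variable with $W\ge 0$, $\mathbb{E}W=1$, $\mathbb{E}[W\log_2^+W]<\infty$ and $\mathbb{E}[W\log_2 W]<1$. Let $\mu$ be the canonical scalar dyadic Mandelbrot cascade on $[0,1]$ generated by $W$, and let $\gamma:[0,1]\to\mathbb{R}^2$ be a fixed (deterministic) nondegenerate $C^2$ embedded arc. Then, almost surely on the event $\{\mu([0,1])>0\}$, $$\widehat{\gamma_\#\mu}(\xi)\longrightarrow 0\qquad(|\xi|\to\infty,\ \xi\in\mathbb{R}^2).$$
   Context: Conventions: $\log_2^+x=\max\{\log_2 x,0\}$ and $0\log_2 0=0$. Dyadic tree. For a word $u=(u_1,\dots,u_n)\in\{0,1\}^n$ write $|u|=n$, $u|k=(u_1,\dots,u_k)$, and $a_u=\sum_{j=1}^n u_j2^{-j}$. Let $I_\varnothing=[0,1]$ and, for $n\ge1$, $I_u=[a_u,a_u+2^{-n})$ unless $u=(1,\dots,1)$, in which case $I_u=[a_u,1]$. Cascade. Attach i.i.d. copies $W_u$ of $W$ to all nonempty finite words $u$. Set $A_\varnothing=1$ and $A_u=2^{-n}\prod_{k=1}^nW_{u|k}$ for $|u|=n$, and let $\mu_n$ be the measure on $[0,1]$ with density $\sum_{|u|=n}2^nA_u\mathbf 1_{I_u}(t)$ with respect to Lebesgue measure. Under the stated assumptions on $W$, almost surely $\mu_n$ converges weakly to a finite Borel measure $\mu$ on $[0,1]$; this $\mu$ is the canonical scalar dyadic Mandelbrot cascade generated by $W$. A fixed nondegenerate $C^2$ embedded arc is a $C^2$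 embedding $\gamma:[0,1]\to\mathbb{R}^2$ such that $\inf_{t\in[0,1]}|\gamma'(t)|>0$ and $\inf_{t\in[0,1]}|\det(\gamma'(t),\gamma''(t))|>0$. The curve is chosen before the cascade is sampled; the exceptional null set may depend on $\gamma$. $\gamma_\#\mu$ is the pushforward measure on $\mathbb{R}^2$. Fourier transform: for a finite Borel measure $\nu$ on $\mathbb{R}^d$, $\widehat\nu(\xi)=\int_{\mathbb{R}^d}e^{-2\pi i\xi\cdot x}\,d\nu(x)$. *)

(* Defs.v *)
From HB Require Import structures.
From mathcomp Require Import all_boot all_order all_algebra.
From mathcomp Require Import complex.
From mathcomp Require Import all_classical all_reals all_analysis.

Set Implicit Arguments.
Unset Strict Implicit.
Unset Printing Implicit Defensive.

Import Order.TTheory GRing.Theory Num.Theory.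
Import numFieldNormedType.Exports.

Local Open Scope classical_set_scope.
Local Open Scope ring_scope.

Definition log2 {R : realType} (x : R) : R := ln x / ln 2.

(* [ln 0 = 0] in the library, hence [x * log2 x = 0] and
   [x * log2p x = 0] at [x = 0]. *)
Definition log2p {R : realType} (x : R) : R := Num.max (log2 x) 0.

Definition word_left {R : realType} (u : seq bool) : R :=
  \sum_(j < size u) (nth false u j)%:R * 2 ^- j.+1.

(* [all id [::]] holds, so the empty word gives [0, 1]. *)
Definition word_itv {R : realType} (u : seq bool) : set R :=
  if all id u then [set` `[word_left u, 1]]
  else [set` `[word_left u, word_left u + 2 ^- size u[].

Definition independent_on d (T : measurableType d) (R : realType)
    (P : probability T R) (I : choiceType) (J : set I)
    (X : I -> {RV P >-> R}) : Prop :=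
  forall (s : seq I) (B : I -> set R),
    uniq s -> [set` s] `<=` J -> (forall i, measurable (B i)) ->
    P (\bigcap_(i in [set` s]) (X i @^-1` B i)) =
    (\prod_(i <- s) P (X i @^-1` B i))%E.

(* The index [::] carries no factor of the cascade: the family is left
   unconstrained there. *)
Definition iid_copies d (T : measurableType d) d' (T' : measurableType d')
    (R : realType) (P : probability T R) (Q : probability T' R)
    (W : {RV Q >-> R}) (X : seq bool -> {RV P >-> R}) : Prop :=
  independent_on [set u | u != [::]] X /\
  forall u, u != [::] -> forall A : set R, measurable A ->
    distribution P (X u) A = distribution Q W A.

Definition cascade_weight {R : realType} (w : seq bool -> R) (u : seq bool) : R :=
  2 ^- size u * \prod_(1 <= k < (size u).+1) w (take k u).

Definition cascade_density {R : realType} (w : seq bool -> R) (n : nat) (t : R) : R :=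
  \sum_(u : n.-tuple bool) 2 ^+ n * cascade_weight w u * \1_(word_itv u) t.

(* The library integral is defined for arbitrary set functions, so the measure
   with this density is given by its values only. *)
Definition cascade_approx {R : realType} (w : seq bool -> R) (n : nat)
    (A : set R) : \bar R :=
  (\int[lebesgue_measure]_(t in A `&` `[0%R, 1%R]) (cascade_density w n t)%:E)%E.

(** Measures on [0, 1] are measures on the line that do not charge the
    complement of [0, 1]. *)

Definition weak_cvg01 {R : realType} (nu_ : nat -> set R -> \bar R)
    (nu : set R -> \bar R) : Prop :=
  forall f : R -> R, {within `[0, 1], continuous f} ->
    ((\int[nu_ n]_(t in `[0%R, 1%R]) (f t)%:E)%E @[n --> \oo] -->
     (\int[nu]_(t in `[0%R, 1%R]) (f t)%:E)%E).

Definition is_cascade d (T : measurableType d) (R : realType)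
    (P : probability T R) (X : seq bool -> {RV P >-> R})
    (mu : T -> {finite_measure set R -> \bar R}) : Prop :=
  {ae P, forall w, mu w (~` `[0, 1]) = 0%E /\
    weak_cvg01 (cascade_approx (fun u => X u w)) (mu w)}.

Definition dot2 {R : realType} (x y : R * R) : R := x.1 * y.1 + x.2 * y.2.
Definition norm2 {R : realType} (x : R * R) : R := Num.sqrt (dot2 x x).
Definition det2 {R : realType} (x y : R * R) : R := x.1 * y.2 - x.2 * y.1.

Definition at_infty2 {R : realType} : set_system (R * R) :=
  [set A | exists M : R, forall x, M < norm2 x -> A x].

(** Curves are functions on the line of which only the restriction to [0, 1]
    is considered; derivatives at the endpoints are one-sided. *)

Section derive01.
Context {R : realType}.

Definition diffq (f : R -> R) (t s : R) : R := (f s - f t) / (s - t).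

Definition derivable01 (f : R -> R) : Prop :=
  forall t, t \in `[0, 1] -> cvg (diffq f t s @[s --> within `[0, 1] t^']).

Definition derive01 (f : R -> R) (t : R) : R :=
  lim (diffq f t s @[s --> within `[0, 1] t^']).

Definition C2_01 (f : R -> R) : Prop :=
  [/\ derivable01 f, derivable01 (derive01 f) &
      {within `[0, 1], continuous (derive01 (derive01 f))}].

Definition velocity (g : R -> R * R) (t : R) : R * R :=
  (derive01 (fst \o g) t, derive01 (snd \o g) t).

Definition acceleration (g : R -> R * R) : R -> R * R := velocity (velocity g).

(* By compactness, an injective immersion of [0, 1] is an embedding. *)
Definition nondegenerate_C2_arc (g : R -> R * R) : Prop :=
  [/\ C2_01 (fst \o g) /\ C2_01 (snd \o g),
      {in `[0, 1] &, injective g},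
      0 < inf [set norm2 (velocity g t) | t in `[0, 1]] &
      0 < inf [set `|det2 (velocity g t) (acceleration g t)|
              | t in `[0, 1]]].

End derive01.

(* The intersection makes this independent of [g] outside [0, 1], where [g]
   need not be measurable. *)
Definition pushforward01 {R : realType} (mu : set R -> \bar R)
    (g : R -> R * R) : set (R * R) -> \bar R :=
  fun A => mu (g @^-1` A `&` `[0, 1]).

Definition expi {R : realType} (x : R) : R[i] := (cos x +i* sin x)%C.

Definition integralC d (T : measurableType d) (R : realType)
    (nu : set T -> \bar R) (f : T -> R[i]) : R[i] :=
  (fine (\int[nu]_x (complex.Re (f x))%:E)%E +i*
   fine (\int[nu]_x (complex.Im (f x))%:E)%E)%C.

Definition fourier {R : realType} (nu : set (R * R) -> \bar R) (xi : R * R) : R[i] :=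
  integralC nu (fun x => expi (- (2 * pi * dot2 xi x))).

(* Main.v *)
Require Import Defs.
From HB Require Import structures.
From mathcomp Require Import all_boot all_order all_algebra.
From mathcomp Require Import complex ring lra zify.
From mathcomp Require Import all_classical all_reals all_analysis measurable_realfun.

Set Implicit Arguments.
Unset Strict Implicit.
Unset Printing Implicit Defensive.

Import Order.TTheory GRing.Theory Num.Theory.
Import numFieldNormedType.Exports.

Local Open Scope classical_set_scope.
Local Open Scope ring_scope.

(** Integrating a trigonometric function of [xi . g] against the [n]-th approximation
    of the cascade gives the sum over words [u] of length [n] of the weight [A_u]
    times the mean [c_u] of that function over [I_u].

    The entropy condition yields [rho < 1] such that, up to an arbitrarily small
    mass, all ancestors of generation [k >= K] have weight at most [rho ^ (4 k)].
    Under the tilted law of the factors along a path this concerns sums of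
    independent terms [ln W] with mean below [ln 2]: large values are handled by
    Garsia's maximal inequality, which needs no moment beyond [W log W], and the
    rest by Chernoff's bound.

    Keep only those words. Given generation [n], the centred change of the
    restricted sum from generation [n] to [n + 1] has a Gaussian tail, because
    each of its terms is at most [rho ^ (4 n)]. The union bound over a net of
    exponentially many frequencies makes this change [O(rho ^ n)] uniformly in
    [|xi| <= 2 ^ (6 n)], almost surely, while the non-centred part is bounded by
    the mass lost through the restriction. The sum over all [n >= m], where
    [|xi|] is about [2 ^ (6 m)], is thus small, and the sum at generation [m]
    itself is small since van der Corput's lemma gives [|c_u| <= C 2 ^ (- m)]. *)

(** * Oscillatory integrals *)

(** The moment assumption stops at [W log W], so no L^p bound with [p > 1] is available to be summed
    over frequencies. Truncation makes the increments bounded; the price is the lost mass, which the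
    entropy gap makes small in mean, with a rate [rho] fixed before the loss. The exponents fit
    together as follows. With weights at most [rho ^ (4 k)], [k = n + 1], the exponential parameter
    [rho ^ (- 2 k) / 2] has a square whose product with the largest weight is 1/4, so exponential
    moments are governed by the total mass alone. The logarithm of the net size is linear in [n] and
    costs one of the two powers [rho ^ k] gained in this way. The scale [2 ^ (6 m)] comes from a
    crude decay of order |xi|^(-1/3) of integrals over subintervals: it gives [4 ^ (- m)], of which
    division by the length of [I_u] leaves [2 ^ (- m)]; [rho >= 1/2] makes this at most [rho ^ m].
    Neither conditional expectations nor the tilted law are constructed: the former are replaced by
    resampling one factor, the latter by integrals against the product of the factors. *)

Section within_continuity.
Context {R : realType}.
Implicit Types (A : set R) (f h : R -> R).

Lemma within_continuousM A f h : {within A, continuous f} ->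
  {within A, continuous h} -> {within A, continuous (fun t => f t * h t)}.
Proof.
move=> /subspace_continuousP cf /subspace_continuousP ch.
by apply/subspace_continuousP => x Ax; apply: cvgM; [exact: cf|exact: ch].
Qed.

Lemma within_continuous_add A f h : {within A, continuous f} ->
  {within A, continuous h} -> {within A, continuous (fun t => f t + h t)}.
Proof.
move=> /subspace_continuousP cf /subspace_continuousP ch.
by apply/subspace_continuousP => x Ax; apply: cvgD; [exact: cf|exact: ch].
Qed.

Lemma within_continuousN A f : {within A, continuous f} ->
  {within A, continuous (fun t => - f t)}.
Proof.
move=> /subspace_continuousP cf.
by apply/subspace_continuousP => x Ax; apply: cvgN; exact: cf.
Qed.

Lemma within_continuousV A f : {within A, continuous f} ->
  (forall t, A t -> f t != 0) -> {within A, continuous (fun t => (f t)^-1)}.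
Proof.
move=> /subspace_continuousP cf f0.
by apply/subspace_continuousP => x Ax; apply: cvgV; [exact: f0|exact: cf].
Qed.

Lemma within_continuous_postcomp A f h : continuous h ->
  {within A, continuous f} -> {within A, continuous (fun t => h (f t))}.
Proof.
move=> ch cf x; apply: (@continuous_comp (subspace A) _ _ f h x).
  exact: cf.
exact: ch.
Qed.

Lemma within_continuous_cst A (c : R) : {within A, continuous (fun=> c)}.
Proof. by apply/subspace_continuousP => x Ax; exact: cvg_cst. Qed.

Lemma within_continuous_integrable (a b : R) f : {within `[a, b], continuous f} ->
  (@lebesgue_measure R).-integrable `[a, b] (EFin \o f).
Proof. by apply: continuous_compact_integrable; exact: segment_compact. Qed.

Lemma Rintegral_point (a : R) f : (\int[lebesgue_measure]_(t in `[a, a]) f t)%R = 0.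
Proof. by rewrite set_itv1 Rintegral_set1. Qed.

Lemma Rintegral_split (a b c : R) f : {within `[a, c], continuous f} ->
  a <= b -> b <= c ->
  (\int[lebesgue_measure]_(t in `[a, c]) f t)%R =
  (\int[lebesgue_measure]_(t in `[a, b]) f t)%R +
  (\int[lebesgue_measure]_(t in `[b, c]) f t)%R.
Proof.
move=> cf ab bc.
have := @Rintegral_itvB R f (BLeft a) (BRight c) b (within_continuous_integrable cf).
rewrite !bnd_simp => /(_ ab bc) h.
rewrite -[LHS](subrK (\int[lebesgue_measure]_(t in `[a, b]) f t)%R) h addrC.
congr (_ + _); rewrite Rintegral_itv_obnd_cbnd//.
apply: integrableS (within_continuous_integrable cf) => //.
by apply: subset_itvr; rewrite bnd_simp.
Qed.

Lemma Rintegral_norm_le (a b M : R) f : {within `[a, b], continuous f} -> a <= b ->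
  (forall t, t \in `[a, b] -> `|f t| <= M) ->
  `|(\int[lebesgue_measure]_(t in `[a, b]) f t)%R| <= M * (b - a).
Proof.
move=> cf ab fM.
apply: (le_trans (le_normr_Rintegral _ _)) => //; first exact: within_continuous_integrable.
apply: (@le_trans _ _ (\int[lebesgue_measure]_(t in `[a, b]) M)%R).
  apply: le_Rintegral => //.
  - apply: within_continuous_integrable; apply: within_continuous_postcomp cf.
    exact: norm_continuous.
  - by apply: within_continuous_integrable; exact: within_continuous_cst.
rewrite Rintegral_cst//= lebesgue_measure_itv/= lte_fin.
by move: ab; rewrite le_eqVlt => /predU1P[->|->//]; rewrite ltxx subrr.
Qed.

End within_continuity.

Section oscillatory_integrals.
Context {R : realType}.

(** Derivatives are asked for in the open interval only, since a curve on [0, 1] has one-sided ones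
    at 0 and 1. With continuity up to the endpoints this is enough for the fundamental theorem of
    calculus and the mean value theorem. *)
Definition phase (a b : R) (f f1 f2 : R -> R) : Prop :=
  [/\ {within `[a, b], continuous f}, {within `[a, b], continuous f1},
      {within `[a, b], continuous f2},
      forall t, t \in `]a, b[ -> is_derive t 1 f (f1 t) &
      forall t, t \in `]a, b[ -> is_derive t 1 f1 (f2 t)].

Lemma phase_sub a b c d' f f1 f2 : a <= c -> d' <= b ->
  phase a b f f1 f2 -> phase c d' f f1 f2.
Proof.
move=> ac db [h0 h1 h2 d1 d2].
have s : `[c, d'] `<=` `[a, b].
  move=> x /=; rewrite !in_itv/= => /andP[cx xd].
  by rewrite (le_trans ac cx) (le_trans xd db).
have o t : t \in `]c, d'[ -> t \in `]a, b[.
  rewrite !in_itv/= => /andP[cx xd].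
  by rewrite (le_lt_trans ac cx) (lt_le_trans xd db).
split; [exact: continuous_subspaceW h0|exact: continuous_subspaceW h1|
  exact: continuous_subspaceW h2|by move=> t /o; exact: d1|by move=> t /o; exact: d2].
Qed.

Lemma cos_phase_continuous a b f f1 f2 : phase a b f f1 f2 ->
  {within `[a, b], continuous (fun t => cos (f t))}.
Proof. by move=> [h _ _ _ _]; apply: within_continuous_postcomp h; exact: continuous_cos. Qed.

(* Integrate by parts: [(sin f / f1)' = cos f - sin f * f2 / f1 ^ 2]. *)
Lemma nonstationary_phase a b f f1 f2 (lam Lam : R) : a <= b -> b - a <= 1 ->
  phase a b f f1 f2 -> 0 < lam -> 0 <= Lam ->
  (forall t, t \in `[a, b] -> lam <= `|f1 t|) ->
  (forall t, t \in `[a, b] -> `|f2 t| <= Lam) ->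
  `|(\int[lebesgue_measure]_(t in `[a, b]) cos (f t))%R| <= 2 / lam + Lam / lam ^+ 2.
Proof.
move=> ab ba1 ph l0 L0 fl fL.
have B0 : 0 <= 2 / lam + Lam / lam ^+ 2.
  by rewrite addr_ge0// divr_ge0// ?exprn_ge0// ltW.
move: ab; rewrite le_eqVlt => /predU1P[->|ab]; first by rewrite Rintegral_point normr0.
have [h0 h1 h2 d1 d2] := ph.
have nz t : t \in `[a, b] -> f1 t != 0.
  by move=> /fl h; rewrite -normr_gt0 (lt_le_trans l0).
have nz' t : `[a, b]%classic t -> f1 t != 0 by move=> h; apply: nz.
pose F t := sin (f t) * (f1 t)^-1.
pose r t := sin (f t) * (f2 t * (f1 t)^-1 * (f1 t)^-1).
have cV : {within `[a, b], continuous (fun t => (f1 t)^-1)} by exact: within_continuousV.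
have cS : {within `[a, b], continuous (fun t => sin (f t))}.
  by apply: within_continuous_postcomp h0; exact: continuous_sin.
have cC := cos_phase_continuous ph.
have cF : {within `[a, b], continuous F} by exact: within_continuousM.
have cr : {within `[a, b], continuous r}.
  by apply: within_continuousM => //; do 2 (apply: within_continuousM => //).
pose F' t := cos (f t) - r t.
have cF' : {within `[a, b], continuous F'}.
  by apply: within_continuous_add => //; exact: within_continuousN.
have dF t : t \in `]a, b[ -> is_derive t 1 F (F' t).
  move=> tab; have tab' : t \in `[a, b] by apply: subset_itv_oo_cc.
  have D1 := d1 t tab; have D2 := d2 t tab.
  have Ds : is_derive t 1 (fun t => sin (f t)) (cos (f t) * f1 t).
    have := @is_derive1_comp R (@sin R) f t (cos (f t)) (f1 t) _ D1.
    exact.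
  have Dv := is_deriveV (nz t tab') D2.
  have D := is_deriveM Ds Dv.
  apply: (is_derive_eq D); rewrite /F' /r /GRing.scale/=.
  by field; exact: nz.
have FTC : (\int[lebesgue_measure]_(t in `[a, b]) F' t)%R = F b - F a.
  rewrite /Rintegral (@continuous_FTC2 R F' F a b)//.
  - have [cF1 cF2 cF3] := (continuous_within_itvP F ab).1 cF.
    by split => // t tab; have [] := dF t tab.
  - by move=> t tab; have D := dF t tab; rewrite derive1E derive_val.
have E : (\int[lebesgue_measure]_(t in `[a, b]) cos (f t))%R =
    F b - F a + (\int[lebesgue_measure]_(t in `[a, b]) r t)%R.
  rewrite -FTC -RintegralD//; [|exact: within_continuous_integrable..].
  by apply: eq_Rintegral => t _; rewrite /F' subrK.
have Fb t : t \in `[a, b] -> `|F t| <= lam^-1.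
  move=> tab; rewrite normrM normfV -[leRHS]mul1r ler_pM ?invr_ge0//.
    by rewrite ler_norml sin_geN1 sin_le1.
  by rewrite lef_pV2 ?posrE ?normr_gt0 ?nz// fl.
have rb t : t \in `[a, b] -> `|r t| <= Lam / lam ^+ 2.
  move=> tab; rewrite /r !normrM !normfV.
  have i1 : `|f1 t|^-1 <= lam^-1 by rewrite lef_pV2 ?posrE ?normr_gt0 ?nz// fl.
  rewrite -[leRHS]mul1r ler_pM ?mulr_ge0 ?invr_ge0//.
    by rewrite ler_norml sin_geN1 sin_le1.
  rewrite expr2 invfM mulrA.
  by rewrite ler_pM ?mulr_ge0 ?invr_ge0// ler_pM ?invr_ge0// fL.
rewrite E (le_trans (ler_normD _ _))// lerD//.
  rewrite (le_trans (ler_normB _ _))// [2 / lam](_ : _ = lam^-1 + lam^-1); last by field; rewrite gt_eqF.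
  by rewrite lerD// Fb// in_itv/= ?lexx ltW.
rewrite (le_trans (Rintegral_norm_le cr (ltW ab) rb))//.
by rewrite ler_piMr// divr_ge0// exprn_ge0// ltW.
Qed.

(* Where [f1] is small, [f2] is not, so the set of such points has small
   diameter by the mean value theorem. *)
Lemma van_der_corput_short a b f f1 f2 (lam Lam H : R) : a <= b -> b - a <= 1 ->
  phase a b f f1 f2 -> 0 < lam -> 0 <= Lam -> 0 < H ->
  (forall t, t \in `[a, b] -> H <= `|f1 t| + `|f2 t|) ->
  (forall t, t \in `[a, b] -> `|f2 t| <= Lam) ->
  Lam * (b - a) <= H / 4 -> lam <= H / 4 ->
  `|(\int[lebesgue_measure]_(t in `[a, b]) cos (f t))%R| <=
  2 * (2 / lam + Lam / lam ^+ 2) + 16 * lam / H.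
Proof.
move=> ab ba1 ph l0 L0 H0 fH fL short lH.
have [h0 h1 h2 d1 d2] := ph.
pose B := 2 / lam + Lam / lam ^+ 2; rewrite -/B.
have B0 : 0 <= B by rewrite addr_ge0// divr_ge0// ?exprn_ge0// ltW.
have q0 : 0 <= 16 * lam / H by rewrite divr_ge0 ?mulr_ge0// ltW.
have mvt s t : s \in `[a, b] -> t \in `[a, b] -> s < t ->
    exists2 c, c \in `[a, b] & f1 t - f1 s = f2 c * (t - s).
  rewrite !in_itv/= => /andP[a_s sb] /andP[a_t tb] st.
  have [_ h1' _ _ d2'] := phase_sub a_s tb ph.
  have [c] := MVT st d2' h1'.
  rewrite in_itv/= => /andP[sc ct] e; exists c => //.
  by rewrite in_itv/= (le_trans a_s (ltW sc)) (le_trans (ltW ct) tb).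
have lip s t : s \in `[a, b] -> t \in `[a, b] -> `|f1 t - f1 s| <= H / 4.
  wlog st : s t / s < t => [hw|sab tab].
    move=> sab tab; have [st|ts|->] := ltgtP s t; first exact: hw.
      by rewrite distrC; exact: hw.
    by rewrite subrr normr0 divr_ge0// ltW.
  have [c cab ->] := mvt s t sab tab st.
  rewrite normrM (le_trans _ short)// ler_pM// ?fL//.
  move: sab tab; rewrite !in_itv/= => /andP[a_s _] /andP[_ tb].
  by rewrite ger0_norm ?subr_ge0 ?(ltW st)// lerB.
(* On so short an interval [f1] varies by at most [H / 4]. If [|f1|] reaches [H / 2] once, it stays
   above [H / 4 >= lam]; otherwise [|f2|] is at least [H / 2] throughout. *)
have [[t0 t0ab big]|small] := pselect (exists2 t0, t0 \in `[a, b] & H / 2 <= `|f1 t0|).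
  apply: (@le_trans _ _ B); last by rewrite mulr_natl mulr2n -addrA lerDl addr_ge0.
  apply: (nonstationary_phase ab ba1 ph) => // t tab.
  have h := lip t0 t t0ab tab.
  have := ler_normD (f1 t) (f1 t0 - f1 t); rewrite addrC subrK distrC => h'.
  by lra.
have f2big t : t \in `[a, b] -> H / 2 <= `|f2 t|.
  move=> tab; have := fH t tab.
  have : `|f1 t| < H / 2 by rewrite ltNge; apply/negP => ?; apply: small; exists t.
  by lra.
have [[s sab ssmall]|nos] := pselect (exists2 s, s \in `[a, b] & `|f1 s| < lam); last first.
  apply: (@le_trans _ _ B); last by rewrite mulr_natl mulr2n -addrA lerDl addr_ge0.
  apply: (nonstationary_phase ab ba1 ph) => // t tab.
  by rewrite leNgt; apply/negP => ?; apply: nos; exists t.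
(* As [|f2| >= H / 2], moving a distance [l] away from [s] changes [f1] by at least [4 * lam], while
   [|f1 s| < lam]. The part left out, between [s - l] and [s + l], has length at most
   [2 * l = 16 * lam / H]. *)
pose l := 8 * lam / H.
have l_gt0 : 0 < l by rewrite divr_gt0// mulr_gt0.
have far t : t \in `[a, b] -> l <= `|t - s| -> lam <= `|f1 t|.
  move=> tab lts; rewrite leNgt; apply/negP => tsmall.
  have : (H / 2) * `|t - s| <= `|f1 t - f1 s|.
    have [st|ts|e] := ltgtP s t.
    - have [c cab ->] := mvt s t sab tab st.
      by rewrite normrM ler_wpM2r// f2big.
    - have [c cab e] := mvt t s tab sab ts.
      by rewrite distrC [leRHS]distrC e normrM ler_wpM2r// f2big.
    - by rewrite e !subrr !normr0 mulr0.
  have : (H / 2) * l <= (H / 2) * `|t - s| by rewrite ler_wpM2l// divr_ge0// ltW.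
  have -> : H / 2 * l = 4 * lam by rewrite /l; field; rewrite gt_eqF.
  by have := ler_normB (f1 t) (f1 s); lra.
have {}sab := sab; have /andP[a_s sb] : a <= s <= b by move: sab; rewrite in_itv.
pose c := Num.max a (s - l); pose e := Num.min b (s + l).
have ac : a <= c by rewrite le_max lexx.
have cs : c <= s by rewrite ge_max a_s gerBl ltW.
have se : s <= e by rewrite le_min sb lerDl ltW.
have eb : e <= b by rewrite ge_min lexx.
have ce := le_trans cs se; have cb := le_trans ce eb.
have cc := cos_phase_continuous ph.
rewrite (Rintegral_split cc ac cb).
have cc' := cos_phase_continuous (phase_sub ac (lexx b) ph).
rewrite (Rintegral_split cc' ce eb).
have I1 : `|(\int[lebesgue_measure]_(t in `[a, c]) cos (f t))%R| <= B.
  move: (ac); rewrite {1}/c le_max lexx /= => _.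
  have [sla|als] := leP (s - l) a.
    by rewrite /c (max_l sla) Rintegral_point normr0.
  have cE : c = s - l by rewrite /c max_r// ltW.
  apply: nonstationary_phase (phase_sub (lexx a) cb ph) _ _ _ _ => //.
  - by rewrite (le_trans _ ba1)// lerD2r.
  - move=> t; rewrite in_itv/= => /andP[a_t tc]; apply: far.
      by rewrite in_itv/= a_t (le_trans tc cb).
    by rewrite distrC ger0_norm; move: tc; rewrite cE; lra.
  - move=> t; rewrite in_itv/= => /andP[a_t tc]; apply: fL.
    by rewrite in_itv/= a_t (le_trans tc cb).
have I3 : `|(\int[lebesgue_measure]_(t in `[e, b]) cos (f t))%R| <= B.
  have [bsl|slb] := leP b (s + l).
    by rewrite /e (min_l bsl) Rintegral_point normr0.
  have eE : e = s + l by rewrite /e min_r// ltW.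
  apply: nonstationary_phase (phase_sub (le_trans ac ce) (lexx b) ph) _ _ _ _ => //.
  - by rewrite (le_trans _ ba1)// lerB// (le_trans ac ce).
  - move=> t; rewrite in_itv/= => /andP[et tb]; apply: far.
      by rewrite in_itv/= tb (le_trans (le_trans ac ce) et).
    by rewrite ger0_norm; move: et; rewrite eE; lra.
  - move=> t; rewrite in_itv/= => /andP[et tb]; apply: fL.
    by rewrite in_itv/= tb (le_trans (le_trans ac ce) et).
have I2 : `|(\int[lebesgue_measure]_(t in `[c, e]) cos (f t))%R| <= 16 * lam / H.
  have ph' := phase_sub ac eb ph.
  have := @Rintegral_norm_le R c e 1 _ (cos_phase_continuous ph') ce.
  move=> /(_ _)/le_trans; apply.
    by move=> t _; rewrite ler_norml cos_geN1 cos_le1.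
  rewrite mul1r (_ : 16 * lam / H = l + l); last by rewrite /l; field; rewrite gt_eqF.
  have : s - l <= c by rewrite le_max lexx orbT.
  have : e <= s + l by rewrite ge_min lexx orbT.
  by lra.
apply: (le_trans (ler_normD _ _)); rewrite mulr_natl mulr2n -addrA lerD//.
by rewrite addrC (le_trans (ler_normD _ _))// lerD.
Qed.

(** The interval is cut into pieces of length at most [1 / N], short enough for [f1] to vary by at
    most [H / 4] on each. The induction peels off the leftmost piece, so the left endpoint moves. *)
Lemma van_der_corput (N : nat) a b f f1 f2 (lam Lam H : R) :
  a <= b -> b - a <= 1 ->
  phase a b f f1 f2 -> 0 < lam -> 0 <= Lam -> 0 < H -> (0 < N)%N ->
  (forall t, t \in `[a, b] -> H <= `|f1 t| + `|f2 t|) ->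
  (forall t, t \in `[a, b] -> `|f2 t| <= Lam) ->
  Lam / N%:R <= H / 4 -> lam <= H / 4 ->
  `|(\int[lebesgue_measure]_(t in `[a, b]) cos (f t))%R| <=
  N%:R * (2 * (2 / lam + Lam / lam ^+ 2) + 16 * lam / H).
Proof.
move=> ab ba1 ph l0 L0 H0 N0 fH fL short lH.
set C := 2 * _ + _.
have C0 : 0 <= C.
  have l0' := ltW l0; have H0' := ltW H0.
  apply: addr_ge0; last by rewrite divr_ge0// mulr_ge0.
  apply: mulr_ge0 => //; apply: addr_ge0; first by rewrite divr_ge0.
  by rewrite divr_ge0// exprn_ge0.
have N0' : 0 < N%:R :> R by rewrite ltr0n.
suff H' k : forall a, a <= b -> b - a <= k%:R / N%:R -> b - a <= 1 -> phase a b f f1 f2 ->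
    (forall t, t \in `[a, b] -> H <= `|f1 t| + `|f2 t|) ->
    (forall t, t \in `[a, b] -> `|f2 t| <= Lam) ->
    `|(\int[lebesgue_measure]_(t in `[a, b]) cos (f t))%R| <= k%:R * C.
  by apply: H' => //; rewrite divff ?gt_eqF.
elim: k => [|k IH] {ab ba1 ph fH fL} {}a ab bak ba1 ph fH fL.
  have -> : b = a by apply/le_anti; rewrite ab andbT -subr_le0 (le_trans bak)// mul0r.
  by rewrite Rintegral_point normr0 mul0r.
pose m := Num.min b (a + N%:R^-1).
have am : a <= m by rewrite le_min ab lerDl invr_ge0 ltW.
have mb : m <= b by rewrite ge_min lexx.
have mN : m - a <= N%:R^-1 by rewrite lerBlDl ge_min lexx orbT.
rewrite (Rintegral_split (cos_phase_continuous ph) am mb).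
rewrite (le_trans (ler_normD _ _))// -[k.+1]add1n natrD mulrDl mul1r lerD//.
  apply: (@van_der_corput_short _ _ _ f1 f2) => //.
  - by rewrite (le_trans _ ba1)// lerD2r.
  - exact: phase_sub ph.
  - move=> t; rewrite in_itv/= => /andP[a_t tc]; apply: fH.
    by rewrite in_itv/= a_t (le_trans tc mb).
  - move=> t; rewrite in_itv/= => /andP[a_t tc]; apply: fL.
    by rewrite in_itv/= a_t (le_trans tc mb).
  - by rewrite (le_trans _ short)// ler_wpM2l.
have [bN|Nb] := leP b (a + N%:R^-1).
  by rewrite /m (min_l bN) Rintegral_point normr0 mulr_ge0.
have mE : m = a + N%:R^-1 by rewrite /m min_r// ltW.
apply: IH => //.
- by move: bak; rewrite mE -[k.+1]addn1 natrD mulrDl mul1r; lra.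
- by rewrite (le_trans _ ba1)// lerB.
- exact: phase_sub ph.
- move=> t; rewrite in_itv/= => /andP[a_t tc]; apply: fH.
  by rewrite in_itv/= tc (le_trans am a_t).
- move=> t; rewrite in_itv/= => /andP[a_t tc]; apply: fL.
  by rewrite in_itv/= tc (le_trans am a_t).
Qed.

End oscillatory_integrals.

(** * Arcs *)

Section one_sided_derivatives.
Context {R : realType}.
Implicit Types f : R -> R.

Lemma derivable01_cvg f t : derivable01 f -> t \in `[0, 1] ->
  diffq f t s @[s --> within `[0, 1] t^'] --> derive01 f t.
Proof. by move=> df t01; exact: (df t t01). Qed.

Lemma derivable01_continuous f : derivable01 f -> {within `[0, 1], continuous f}.
Proof.
move=> df; apply/subspace_continuousP => t t01.
have dt := derivable01_cvg df t01.
have idt : s @[s --> within `[0, 1] t^'] --> t.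
  by apply: cvg_trans (@cvg_id _ (nbhs t)); apply: cvg_trans (cvg_within _) _; exact: cvg_within.
have H : f s @[s --> within `[0, 1] t^'] --> f t.
  have : diffq f t s * (s - t) + f t @[s --> within `[0, 1] t^'] -->
      derive01 f t * (t - t) + f t.
    apply: cvgD; last exact: cvg_cst.
    by apply: cvgM => //; apply: cvgB => //; exact: cvg_cst.
  rewrite subrr mulr0 add0r; apply: cvg_trans; apply: near_eq_cvg.
  rewrite near_withinE near_withinE; near=> s => st s01.
  by rewrite /diffq divfK ?subr_eq0// subrK.
move=> U Ux; have := H U Ux; rewrite !near_simpl !near_withinE => h.
near=> s; have [->|st] := eqVneq s t; first by move=> _; exact: nbhs_singleton.
by move=> s01; move: st s01; near: s.
Unshelve. all: by end_near. Qed.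

Lemma derivable01_is_derive f (t : R) : derivable01 f -> t \in `]0, 1[ ->
  is_derive t 1 f (derive01 f t).
Proof.
move=> df t01; have t01' : t \in `[0, 1] by apply: subset_itv_oo_cc.
have dt := derivable01_cvg df t01'.
suff H : (h^-1 *: ((f \o shift t) (h *: 1) - f t)) @[h --> 0^'] --> derive01 f t.
  by apply: DeriveDef; [exact: (cvgP _ H)|exact: (cvg_lim _ H)].
apply/cvgrPdist_lt => e e0.
move/cvgrPdist_lt : dt => /(_ e e0); rewrite !near_withinE => h.
have [r /= r0 hr] := h.
move: t01; rewrite in_itv/= => /andP[t0 t1].
have r'0 : 0 < Num.min r (Num.min t (1 - t)) by rewrite !lt_min r0 t0 subr_gt0.
exists (Num.min r (Num.min t (1 - t))) => //= x /=.
rewrite sub0r normrN !lt_min => /andP[xr /andP[xt x1t]] x0.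
have := hr (x + t); rewrite /ball_ /= opprD addrCA subrr addr0 normrN => /(_ xr).
rewrite /diffq addrK -subr_eq0 addrK => /(_ x0).
rewrite in_itv/= /GRing.scale/= mulr1 mulrC.
have : - t <= x <= 1 - t.
  by rewrite (le_trans _ (ltW (ltr_normlW x1t)))//; move: xt; rewrite ltr_norml => /andP[/ltW -> _] //.
move=> /andP[h1 h2]; apply; apply/andP; split; lra.
Qed.

Lemma within_continuous_bounded f : {within `[0, 1], continuous f} ->
  exists2 M, 0 < M & forall t, t \in `[0, 1] -> `|f t| <= M.
Proof.
move=> cf; have cn : {within `[0, 1], continuous (fun t : R => `|f t| : R)}.
  by apply: (within_continuous_postcomp (h := fun x : R => `|x|)) cf; exact: norm_continuous.
have [c c01 hc] := EVT_max ler01 cn.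
exists (`|f c| + 1) => [|t t01]; first by rewrite ltr_pwDr.
by rewrite (le_trans (hc t t01))// lerDl.
Qed.

End one_sided_derivatives.

Section arcs.
Context {R : realType}.

(* The phases [th = 0] and [th = pi / 2] give the real and the imaginary part of
   the Fourier transform. *)
Definition arc_phase (g : R -> R * R) (xi : R * R) (th : R) (t : R) : R :=
  2 * pi * dot2 xi (g t) + th.

Lemma norm2_ge0 (x : R * R) : 0 <= norm2 x.
Proof. exact: sqrtr_ge0. Qed.

Lemma fst_le_norm2 (x : R * R) : `|x.1| <= norm2 x.
Proof.
rewrite /norm2 -sqrtr_sqr ler_wsqrtr// /dot2 expr2 lerDl -expr2.
exact: sqr_ge0.
Qed.

Lemma snd_le_norm2 (x : R * R) : `|x.2| <= norm2 x.
Proof.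
rewrite /norm2 -sqrtr_sqr ler_wsqrtr// /dot2 expr2 lerDr -expr2.
exact: sqr_ge0.
Qed.

Lemma norm2_le (x : R * R) : norm2 x <= `|x.1| + `|x.2|.
Proof.
rewrite /norm2 -[leRHS]ger0_norm ?addr_ge0// -sqrtr_sqr ler_wsqrtr// /dot2.
rewrite -!expr2 -(real_normK (num_real x.1)) -(real_normK (num_real x.2)).
by rewrite sqrrD addrAC lerDl mulrn_wge0// mulr_ge0.
Qed.

(* The gradient of [xi . g] and its derivative cannot both be small: [xi] is
   recovered from [xi . g'] and [xi . g''] by Cramer's rule. *)
Lemma cramer_bound (xi v a : R * R) (m M : R) : 0 <= M ->
  m <= `|det2 v a| -> `|v.1| <= M -> `|v.2| <= M -> `|a.1| <= M -> `|a.2| <= M ->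
  m * norm2 xi <= 2 * M * (`|dot2 xi v| + `|dot2 xi a|).
Proof.
move=> M0 md v1 v2 a1 a2.
have e1 : xi.1 * det2 v a = dot2 xi v * a.2 - dot2 xi a * v.2.
  by rewrite /det2 /dot2; ring.
have e2 : xi.2 * det2 v a = dot2 xi a * v.1 - dot2 xi v * a.1.
  by rewrite /det2 /dot2; ring.
have b1 : `|xi.1| * `|det2 v a| <= M * (`|dot2 xi v| + `|dot2 xi a|).
  rewrite -normrM e1 (le_trans (ler_normB _ _))// !normrM mulrDr lerD// mulrC.
    by rewrite ler_wpM2r.
  by rewrite ler_wpM2r.
have b2 : `|xi.2| * `|det2 v a| <= M * (`|dot2 xi v| + `|dot2 xi a|).
  rewrite -normrM e2 (le_trans (ler_normB _ _))// !normrM addrC mulrDr lerD// mulrC.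
    by rewrite ler_wpM2r.
  by rewrite ler_wpM2r.
apply: (@le_trans _ _ (`|det2 v a| * norm2 xi)).
  by rewrite ler_wpM2r ?norm2_ge0.
apply: (@le_trans _ _ (`|det2 v a| * (`|xi.1| + `|xi.2|))).
  by rewrite ler_wpM2l ?norm2_le.
by rewrite mulrDr; lra.
Qed.

(** With a threshold of order [|xi| * p] on the derivative of the phase, the boundary terms are of
    order [1 / (|xi| * p)], the remainder of order [1 / (|xi| * p ^ 2)] and the excluded set has
    length of order [p]. All are of order [p] once [|xi| * p ^ 3 >= 1]. *)
Lemma arc_oscillation (g : R -> R * R) : nondegenerate_C2_arc g ->
  exists2 C : R, 0 < C & forall (xi : R * R) (th p a b : R), 0 < p -> p <= 1 ->
    0 <= a -> a <= b -> b <= 1 -> 1 <= norm2 xi * p ^+ 3 ->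
    `|(\int[lebesgue_measure]_(t in `[a, b]) cos (arc_phase g xi th t))%R| <= C * p.
Proof.
move=> [[[f1d v1d a1c] [f2d v2d a2c]] _ _ detpos].
set f1 := fst \o g in f1d v1d a1c; set f2 := snd \o g in f2d v2d a2c.
have v1c := derivable01_continuous v1d; have v2c := derivable01_continuous v2d.
have [M1 M10 hM1] := within_continuous_bounded v1c.
have [M2 M20 hM2] := within_continuous_bounded v2c.
have [M3 M30 hM3] := within_continuous_bounded a1c.
have [M4 M40 hM4] := within_continuous_bounded a2c.
pose M := M1 + M2 + M3 + M4.
have M0 : 0 < M by rewrite !addr_gt0.
pose v t := velocity g t; pose a_ t := acceleration g t.
have bd t : t \in `[0, 1] -> [/\ `|(v t).1| <= M, `|(v t).2| <= M,
    `|(a_ t).1| <= M & `|(a_ t).2| <= M].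
  have [m1 m2 m3 m4] : [/\ M1 <= M, M2 <= M, M3 <= M & M4 <= M].
    by rewrite /M; split; lra.
  move=> t01; split; [exact: le_trans (hM1 t t01) m1|exact: le_trans (hM2 t t01) m2|
    exact: le_trans (hM3 t t01) m3|exact: le_trans (hM4 t t01) m4].
set m := inf _ in detpos.
have dm t : t \in `[0, 1] -> m <= `|det2 (v t) (a_ t)|.
  move=> t01; apply: ge_inf; last by exists t.
  by exists 0 => _ [s _ <-].
(* With [r = norm2 xi], Cramer's rule gives [kap * r] as a lower bound of [|ps1| + |ps2|], and
   [L * r] is an upper bound of [|ps2|]. Both scale with [r], so the number of pieces [N], at least
   [4 * L / kap], does not depend on [xi]. *)
pose kap := pi * m / M; pose L := 4 * pi * M.
have pi0 : 0 < pi :> R by exact: pi_gt0.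
have kap0 : 0 < kap by rewrite divr_gt0// mulr_gt0.
have L0 : 0 < L by rewrite !mulr_gt0.
have kapE : kap = pi * m / M by [].
have LE : L = 4 * pi * M by [].
clearbody kap L.
pose N := (Num.truncn (4 * L / kap)).+1.
have N0 : 0 < N%:R :> R by rewrite ltr0n.
have hN : 4 * L / kap <= N%:R by rewrite ltW// truncnS_gt.
pose C := N%:R * (2 * (8 / kap + 16 * L / kap ^+ 2) + 4).
have C0 : 0 < C.
  have [k0' L0'] := (ltW kap0, ltW L0).
  rewrite mulr_gt0// ltr_wpDl//; apply: mulr_ge0 => //; apply: addr_ge0.
    by rewrite divr_ge0.
  by apply: divr_ge0; [exact: mulr_ge0|exact: exprn_ge0].
exists C => // xi th p a b p0 p1 a0 ab b1 xip.
pose r := norm2 xi.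
have r0 : 0 < r.
  rewrite lt_neqAle norm2_ge0 andbT; apply/eqP => r0.
  by move: xip; rewrite -/r -r0 mul0r ler10.
pose ps := arc_phase g xi th.
pose ps1 t := 2 * pi * dot2 xi (v t).
pose ps2 t := 2 * pi * dot2 xi (a_ t).
have cdot (h1 h2 : R -> R) : {within `[0, 1], continuous h1} ->
    {within `[0, 1], continuous h2} ->
    {within `[0, 1], continuous (fun t => 2 * pi * (xi.1 * h1 t + xi.2 * h2 t))}.
  move=> c1 c2; apply: within_continuousM; first exact: within_continuous_cst.
  by apply: within_continuous_add; apply: within_continuousM => //; exact: within_continuous_cst.
have ddot (h1 h2 k1 k2 : R -> R) (t : R) : is_derive t 1 h1 (k1 t) -> is_derive t 1 h2 (k2 t) ->
    is_derive t 1 (fun t => 2 * pi * (xi.1 * h1 t + xi.2 * h2 t))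
      (2 * pi * (xi.1 * k1 t + xi.2 * k2 t)).
  move=> D1 D2.
  have E1 := is_deriveZ xi.1 D1; have E2 := is_deriveZ xi.2 D2.
  exact: (is_deriveZ (2 * pi) (is_deriveD E1 E2)).
have ph : phase 0 1 ps ps1 ps2.
  split.
  - apply: within_continuous_add; last exact: within_continuous_cst.
    by apply: (cdot f1 f2); exact: derivable01_continuous.
  - exact: (cdot (derive01 f1) (derive01 f2)).
  - exact: (cdot (derive01 (derive01 f1)) (derive01 (derive01 f2))).
  - move=> t t01.
    have D := ddot f1 f2 (derive01 f1) (derive01 f2) t
      (derivable01_is_derive f1d t01) (derivable01_is_derive f2d t01).
    have D' := is_deriveD D (is_derive_cst th t 1).
    by apply: (is_derive_eq D'); rewrite addr0.
  - move=> t t01.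
    exact: (ddot _ _ _ _ t (derivable01_is_derive v1d t01) (derivable01_is_derive v2d t01)).
have in01 t : t \in `[a, b] -> t \in `[0, 1].
  by rewrite !in_itv/= => /andP[h1 h2]; rewrite (le_trans a0 h1) (le_trans h2 b1).
have tp : 2 * pi != 0 :> R by rewrite mulf_neq0// gt_eqF.
have n2p (x : R) : `|2 * pi * x| = 2 * pi * `|x|.
  by rewrite normrM ger0_norm// mulr_ge0// ltW.
(* The divisor 4 ensures [lam <= H / 4] for [H = kap * r], as [p <= 1]. *)
pose lam := kap * r * p / 4.
have lam0 : 0 < lam by rewrite divr_gt0// (mulr_gt0 (mulr_gt0 kap0 r0) p0).
have key : `|(\int[lebesgue_measure]_(t in `[a, b]) cos (ps t))%R| <=
    N%:R * (2 * (2 / lam + L * r / lam ^+ 2) + 16 * lam / (kap * r)).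
  apply: (@van_der_corput R N a b ps ps1 ps2 lam _ _ ab _ _ lam0 _ _ (ltn0Sn _)).
  - by rewrite lerBlDr (le_trans b1)// lerDl.
  - exact: phase_sub ph.
  - by rewrite mulr_ge0// ltW.
  - exact: mulr_gt0.
  - move=> t /in01 t01; have [h1 h2 h3 h4] := bd t t01.
    have := cramer_bound xi (ltW M0) (dm t t01) h1 h2 h3 h4.
    rewrite -/r /ps1 /ps2 !n2p -mulrDr => h.
    rewrite kapE mulrAC ler_pdivrMr//.
    rewrite (_ : _ * M = pi * (2 * M * (`|dot2 xi (v t)| + `|dot2 xi (a_ t)|))); last by ring.
    by rewrite -(mulrA pi m r) ler_pM2l.
  - move=> t /in01 t01; have [_ _ h3 h4] := bd t t01.
    rewrite /ps2 n2p.
    rewrite (_ : L * r = 2 * pi * (r * M + r * M)); last by rewrite LE; ring.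
    rewrite ler_pM2l ?mulr_gt0// (le_trans (ler_normD _ _))// !normrM.
    by rewrite lerD// ler_pM// ?fst_le_norm2 ?snd_le_norm2.
  - rewrite ler_pdivrMr//.
    rewrite ler_pdivrMr// in hN.
    by rewrite (_ : kap * r / 4 * _ = (N%:R * kap) * r / 4); [rewrite -[leLHS]mulr1; rewrite ler_pdivlMr//; nra|ring].
  - by rewrite /lam ler_pM2r// ler_piMr// ltW// mulr_gt0.
apply: (le_trans key).
rewrite /C -(mulrA N%:R) ler_pM2l//.
have rp1 : r^-1 <= p ^+ 3 by rewrite -[leLHS]mul1r ler_pdivrMr// mulrC.
have e1 : 2 / lam <= 8 / kap * p.
  rewrite (_ : 2 / lam = 8 / kap * (r^-1 / p)); last by rewrite /lam; field; rewrite !gt_eqF.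
  apply: ler_wpM2l; first by rewrite divr_ge0// ltW.
  rewrite ler_pdivrMr// (le_trans rp1)// -expr2 exprS.
  by rewrite ler_piMl// exprn_ge0// ltW.
have e2 : L * r / lam ^+ 2 <= 16 * L / kap ^+ 2 * p.
  rewrite (_ : L * r / lam ^+ 2 = 16 * L / kap ^+ 2 * (r^-1 / p ^+ 2)); last first.
    by rewrite /lam; field; rewrite !gt_eqF.
  apply: ler_wpM2l.
    by apply: divr_ge0; [apply: mulr_ge0 => //|apply: exprn_ge0]; exact: ltW.
  by rewrite ler_pdivrMr ?exprn_gt0// (le_trans rp1)// exprS.
have e3 : 16 * lam / (kap * r) = 4 * p.
  by rewrite /lam; field; rewrite !gt_eqF.
by rewrite e3; lra.
Qed.

End arcs.

(** * Resampling *)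

Section resampling.
Context {R : realType} {d : measure_display} {T : measurableType d}
  {d' : measure_display} {T' : measurableType d'}.
Variables (P : probability T R) (Q : probability T' R).
Variables (W : {RV Q >-> R}) (X : seq bool -> {RV P >-> R}).
Hypothesis X_iid : iid_copies W X.

Definition upd (x : seq bool -> R) (v : seq bool) (a : R) : seq bool -> R :=
  fun u => if u == v then a else x u.

(* Stands in for measurability with respect to a product sigma-algebra on
   [seq bool -> R]. *)
Definition mfunctional (F : (seq bool -> R) -> \bar R) : Prop :=
  forall (d0 : measure_display) (S : measurableType d0) (Y : S -> seq bool -> R),
    (forall u, u != [::] -> measurable_fun [set: S] (Y ^~ u)) ->
    measurable_fun [set: S] (F \o Y).

Section one_index.
Variable v : seq bool.
Hypothesis v0 : v != [::].

Let cyl (s : seq (seq bool)) (B : seq bool -> set R) : set T :=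
  \bigcap_(i in [set` s]) (X i @^-1` B i).

(** A pi-system generating the sigma-algebra of all factors except [X v]; the empty word is left out
    because nothing is assumed about the variable there. *)
Let G : set (set T) := [set A | exists s B,
  [/\ uniq s, [set` s] `<=` [set u | u != [::] /\ u != v],
      (forall i, measurable (B i)) & A = cyl s B]].

Let cyl_ext s s' B : [set` s] `<=` [set` s'] ->
  cyl s B = cyl s' (fun i => if i \in s then B i else setT).
Proof.
move=> ss'; apply/seteqP; split=> [w sB i|w sB i] /=.
  by move=> _; case: ifPn => // /sB.
by move=> si; have /= := sB i (ss' _ si); rewrite si.
Qed.

Let GI : setI_closed G.
Proof.
move=> _ _ [s [B [us sv mB ->]]] [s' [B' [us' sv' mB' ->]]].
exists (undup (s ++ s')), (fun i => (if i \in s then B i else setT) `&`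
  (if i \in s' then B' i else setT)); split.
- exact: undup_uniq.
- by move=> i /=; rewrite mem_undup mem_cat => /orP[/sv|/sv'].
- by move=> i; apply: measurableI; case: ifP.
- rewrite (@cyl_ext s (undup (s ++ s'))); last first.
    by move=> i /=; rewrite mem_undup mem_cat => ->.
  rewrite (@cyl_ext s' (undup (s ++ s'))); last first.
    by move=> i /=; rewrite mem_undup mem_cat => ->; rewrite orbT.
  by rewrite /cyl -bigcapI.
Qed.

Let GT : G setT.
Proof.
exists [::], (fun=> setT); split => //.
by rewrite /cyl; apply/seteqP; split.
Qed.

Let mX u (B : set R) : measurable B -> measurable (X u @^-1` B).
Proof. by move=> mB; rewrite -[_ @^-1` _]setTI; exact: measurable_funP. Qed.

Let Gm : G `<=` measurable.
Proof.
move=> _ [s [B [us sv mB ->]]]; rewrite /cyl bigcap_seq.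
by apply: bigsetI_measurable => i _; exact: mX.
Qed.

Let sGm : <<s G >> `<=` measurable.
Proof. exact: (smallest_sub (@sigma_algebra_measurable _ T) Gm). Qed.

(** Both sides are finite measures in [A]: the restriction of [P] to the event that [X v] lies in
    [B], and a multiple of [P]. By independence they agree on the pi-system [G], hence on the
    sigma-algebra it generates. *)
Let indep_G (A : set T) (B : set R) : <<s G >> A -> measurable B ->
  P (A `&` X v @^-1` B) = (P A * distribution Q W B)%E.
Proof.
move=> sGA mB; have [Xind Xlaw] := X_iid.
rewrite -(Xlaw v)// /distribution /= /pushforward.
pose m1 : {measure set T -> \bar R} := mrestr P (mX v mB).
pose p : {nonneg R} := NngNum (fine_ge0 (measure_ge0 P (X v @^-1` B))).
have Bfin : P (X v @^-1` B) \is a fin_num.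
  by apply: fin_num_measure; exact: mX.
pose m2 : {measure set T -> \bar R} := mscale p P.
have -> : (P A * P (X v @^-1` B) = m2 A)%E.
  by rewrite /m2 /= /mscale /= fineK// muleC.
rewrite -[LHS]/(m1 A).
apply: (g_sigma_algebra_measure_unique G Gm (fun=> setT)) => //.
- by rewrite bigcup_const //; exists 0%N.
- move=> _ [s [C [us sv mC ->]]].
  rewrite /m1 /m2 /= /mrestr /mscale /= fineK//.
  have := Xind (v :: s) (fun i => if i == v then B else C i).
  have vs : v \notin s by apply/negP => /sv[_]/=; rewrite eqxx.
  rewrite /= vs us => /(_ isT); rewrite big_cons eqxx => h.
  rewrite (_ : \prod_(i <- s) _ = P (cyl s C))%E in h; last first.
    rewrite (Xind s C us)//; last by move=> i /sv[].
    by apply: eq_big_seq => i si; case: eqP => // iv; rewrite -iv si in vs.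
  rewrite -h; last 2 first.
  - by move=> i /=; rewrite inE => /orP[/eqP->//|/sv[]].
  - by move=> i; case: ifP.
  congr (P _); apply/seteqP; split => [w [sw vw] i|w vsw] /=.
    rewrite inE; case: eqVneq => [-> _ //|iv /= si]; exact: (sw i).
  split.
    move=> i si; have := vsw i; rewrite /= inE si orbT => /(_ isT).
    by case: eqP => // iv; rewrite -iv si in vs.
  by have := vsw v; rewrite /= inE eqxx => /(_ isT).
- move=> _; rewrite /m1 /= /mrestr setTI.
  exact: (le_lt_trans (probability_le1 P (mX v mB))) (ltry 1).
Qed.

(** [T] with the coarser sigma-algebra of the other factors: seen there, the sample point is
    independent of [X v], so [phi] has a product law. *)
Let U := g_sigma_algebraType G.

Let idU (w : T) : U := w.

Let midU : measurable_fun setT idU.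
Proof. by move=> _ A mA; rewrite setTI; exact: sGm. Qed.

Let phi (w : T) : U * R := (idU w, X v w).

Let mphi : measurable_fun setT phi.
Proof. by apply/measurable_fun_pair => //; exact: measurable_funP. Qed.

(** Fubini's theorem for the product law of [phi]. It replaces conditioning on all factors except
    [X v]: that factor is integrated while the others are frozen. *)
Lemma integral_resample (F : (seq bool -> R) -> \bar R) :
  mfunctional F -> (forall x, 0 <= F x)%E ->
  (\int[P]_w F (X ^~ w) = \int[P]_w \int[Q]_y F (upd (X ^~ w) v (W y)))%E.
Proof.
move=> mF F0.
pose Psi (z : U * R) : \bar R := F (upd (X ^~ (z.1 : T)) v z.2).
have mPsi : measurable_fun setT Psi.
  apply: mF => u u0; rewrite /upd; case: eqVneq => [_|uv].
    exact: measurable_snd.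
  have mXu : measurable_fun setT (fun w : U => X u w).
    move=> _ B mB; rewrite setTI; apply: sub_sigma_algebra.
    exists [:: u], (fun=> B); split => //.
      by move=> i /=; rewrite inE => /eqP ->.
    rewrite /cyl; apply/seteqP; split => [w Bw i /=|w /(_ u)].
      by rewrite inE => /eqP ->.
    by apply; rewrite /= inE.
  exact: (measurableT_comp mXu measurable_fst).
have -> : (\int[P]_w F (X ^~ w) = \int[P]_w (Psi \o phi) w)%E.
  apply: eq_integral => w _ /=; congr F; apply/funext => u.
  by rewrite /upd /=; case: eqP => // ->.
have := @ge0_integral_pushforward _ _ _ _ R phi mphi P setT Psi measurableT.
rewrite preimage_setT => <- //; last by move=> ? _; exact: F0.
pose idp : {mfun T >-> U} := HB.pack idU (isMeasurableFun.Build _ _ _ _ _ midU).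
pose phip : {mfun T >-> _} := HB.pack phi (isMeasurableFun.Build _ _ _ _ _ mphi).
pose m1 : probability U R := distribution P idp.
pose m2 : probability R R := distribution Q W.
transitivity (\int[m1 \x m2]_z Psi z)%E.
  apply: (@eq_measure_integral _ _ _ _ (m1 \x m2)%E (distribution P phip)) => A mA _.
  apply/esym/(product_measure_unique (m' := distribution P phip)) => //.
have Psi0 z : (0 <= Psi z)%E by exact: F0.
rewrite fubini_tonelli1//.
have := @ge0_integral_pushforward _ _ _ _ R idU midU P setT
  (fun x => \int[m2]_y Psi (x, y))%E measurableT.
rewrite preimage_setT /fubini_F => ->; last 2 first.
- exact: (measurable_fun_fubini_tonelli_F (m2 := m2) Psi).
- by move=> ? _; apply: integral_ge0 => ? _; exact: F0.
apply: eq_integral => w _ /=.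
have mW : measurable_fun setT W by exact: measurable_funP.
have := @ge0_integral_pushforward _ _ _ _ R W mW Q setT
  (fun y => Psi (idU w, y))%E measurableT.
rewrite preimage_setT => -> //.
apply: measurableT_comp => //.
Qed.

End one_index.

Definition mseq (h : seq R -> \bar R) : Prop :=
  forall (d0 : measure_display) (S : measurableType d0) (Y : nat -> S -> R) n,
    (forall i, measurable_fun [set: S] (Y i)) ->
    measurable_fun [set: S] (h \o (fun z => mkseq (Y ^~ z) n)).

(** The expectation of [h] over [n] independent copies of [W], as an iterated integral in which the
    head of the list is the innermost variable. *)
Fixpoint iterE (n : nat) (h : seq R -> \bar R) : \bar R :=
  if n is n'.+1 then iterE n' (fun s => \int[Q]_y h (W y :: s))%E else h [::].

Lemma mkseq_cons (A : Type) (a : A) (f : nat -> A) n :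
  a :: mkseq f n = mkseq (fun i => if i is i'.+1 then f i' else a) n.+1.
Proof. by rewrite /mkseq -add1n iotaD map_cat (iotaDl 1) -map_comp. Qed.

Lemma mseq_integral h : mseq h -> (forall s, 0 <= h s)%E ->
  mseq (fun s => \int[Q]_y h (W y :: s))%E.
Proof.
move=> mh h0 d0 S Y n mY.
pose Y' i (z : S * T') : R := if i is i'.+1 then Y i' z.1 else W z.2.
have mY' : measurable_fun setT (h \o (fun z : S * T' => mkseq (Y' ^~ z) n.+1)).
  apply: mh => -[|i] /=.
  - by apply: measurableT_comp => //; exact: measurable_snd.
  - by apply: measurableT_comp => //; exact: measurable_fst.
have := @measurable_fun_fubini_tonelli_F _ _ _ _ R Q _ mY' (fun=> h0 _).
apply: eq_measurable_fun => z _; rewrite /fubini_F /=.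
by apply: eq_integral => y _; rewrite -mkseq_cons.
Qed.

Lemma mfunctional_map (l : seq (seq bool)) h : all (fun u => u != [::]) l ->
  mseq h -> mfunctional (fun x => h (map x l)).
Proof.
move=> l0 mh d0 S Y mY.
have : measurable_fun setT (h \o (fun z => mkseq ((fun i z => Y z (nth [:: true] l i)) ^~ z) (size l))).
  apply: mh => i; apply: mY.
  case: (ltnP i (size l)) => il; first by move/allP: l0; apply; rewrite mem_nth.
  by rewrite nth_default.
apply: eq_measurable_fun => z _ /=; congr h.
apply: (@eq_from_nth _ 0); first by rewrite size_mkseq size_map.
by move=> i; rewrite size_mkseq => il; rewrite nth_mkseq// (nth_map [:: true]).
Qed.

(** Each step resamples the head of the list. The right-hand side sees only the length of [l]; the
    invariance under relabelling used by the maximal inequality is read off from this. *)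
Lemma integral_iterE (l : seq (seq bool)) h : uniq l ->
  all (fun u => u != [::]) l -> mseq h -> (forall s, 0 <= h s)%E ->
  (\int[P]_w h [seq X u w | u <- l] = iterE (size l) h)%E.
Proof.
elim: l h => [|v l IH] h /=.
  by move=> _ _ _ _; rewrite integral_cst//= probability_setT mule1.
move=> /andP[vl ul] /andP[v0 l0] mh h0.
rewrite -IH//; last 2 first.
- exact: mseq_integral.
- by move=> s; apply: integral_ge0.
rewrite (integral_resample v0 (@mfunctional_map (v :: l) h _ mh))//=; last first.
  by rewrite v0.
apply: eq_integral => w _; apply: eq_integral => y _; congr h.
rewrite /upd eqxx; congr cons; apply/eq_in_map => u ul'.
by case: eqP => // uv; rewrite -uv ul' in vl.
Qed.

End resampling.

(** * Moments of the generator *)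

(** Factors are nonnegative only almost surely; taking positive parts makes the pointwise estimates
    hold everywhere. *)
Definition pos {R : realType} (x : R) : R := Num.max x 0.
(** The logarithm is cut at height [B]. The part above is merely integrable under the tilted law and
    goes to the maximal inequality; the part below is at most [B] when [B >= 0], so it has
    exponential moments. *)
Definition lnhi {R : realType} (B x : R) : R := if expR B < x then ln x else 0.
Definition lnlo {R : realType} (B x : R) : R := if expR B < x then 0 else ln x.

Section real_inequalities.
Context {R : realType}.
Implicit Types x B : R.

Lemma pos_ge0 x : 0 <= pos x.
Proof. by rewrite /pos le_max lexx orbT. Qed.

Lemma pos_id x : 0 <= x -> pos x = x.
Proof. by move=> x0; rewrite /pos; apply/max_idPl. Qed.

Lemma ln_pos x : ln (pos x) = ln x.
Proof. by rewrite /pos; case: leP => // x0; rewrite !ln0 //. Qed.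

Lemma lnhi_lnlo B x : lnhi B x + lnlo B x = ln x.
Proof. by rewrite /lnhi /lnlo; case: ifP; rewrite ?addr0 ?add0r. Qed.

Lemma lnhi_ge0 B x : 0 <= B -> 0 <= lnhi B x.
Proof.
move=> B0; rewrite /lnhi; case: ifP => // /ltW h.
by apply: ln_ge0; rewrite (le_trans _ h)// -expR0 ler_expR.
Qed.

Lemma measurable_pos : measurable_fun [set: R] (@pos R).
Proof. exact: measurable_maxr. Qed.

Lemma measurable_lnhi B : measurable_fun [set: R] (lnhi B).
Proof.
apply: (measurable_fun_ifT (g := @ln R) (h := cst 0) (f := fun x => expR B < x)) => //.
exact: measurable_fun_ltr.
Qed.

Lemma measurable_lnlo B : measurable_fun [set: R] (lnlo B).
Proof.
rewrite /lnlo; apply: measurable_fun_ifT.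
- exact: measurable_fun_ltr.
- exact: measurable_cst.
- exact: measurable_ln.
Qed.

Lemma measurable_log2 : measurable_fun [set: R] (@log2 R).
Proof.
have : measurable_fun [set: R] (fun x : R => ln x * (ln 2)^-1) => //.
by apply: measurable_funM => //; exact: measurable_ln.
Qed.

Lemma measurable_log2p : measurable_fun [set: R] (@log2p R).
Proof. by apply: measurable_maxr => //; exact: measurable_log2. Qed.

(** The range is unbounded to the left, which matters because logarithms of small factors are
    unbounded below. The bound comes from [1 - x <= expR (- x)] by inversion. *)
Lemma expR_le_quadratic x : x <= 2^-1 -> expR x <= 1 + x + 2 * x ^+ 2.
Proof.
move=> x2; have h : 1 - x <= expR (- x) by exact: expR_ge1Dx.
have p : 0 < 1 - x by lra.
rewrite -[x in leLHS]opprK expRN.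
apply: (@le_trans _ _ (1 - x)^-1); first by rewrite lef_pV2 // posrE (lt_le_trans p).
rewrite -[leLHS]mul1r ler_pdivrMr// mulrC.
have -> : (1 - x) * (1 + x + 2 * x ^+ 2) = 1 + x ^+ 2 * (1 - 2 * x) by ring.
by rewrite lerDl mulr_ge0 ?sqr_ge0//; lra.
Qed.

Lemma x_ln_ge x : 0 <= x -> -1 <= x * ln x.
Proof.
rewrite le_eqVlt => /predU1P[<-|x0]; first by rewrite mul0r oppr_le0 ler01.
have := @ln_sublinear R x^-1; rewrite invr_gt0 => /(_ x0).
rewrite lnV ?posrE// => h.
have : x * - ln x <= x * x^-1 by rewrite ler_pM2l// ltW.
by rewrite divff ?gt_eqF// mulrN; lra.
Qed.

Lemma x_ln2_le B x : 0 <= B -> 0 < x -> x <= expR B ->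
  x * ln x ^+ 2 <= 4 + expR B * B ^+ 2.
Proof.
move=> B0 x0 xB.
have [x1|x1] := leP 1 x.
  apply: (@le_trans _ _ (expR B * B ^+ 2)); last by rewrite lerDr.
  apply: ler_pM => //; [exact: ltW|exact: sqr_ge0|].
  have lB : ln x <= B by rewrite -ler_expR lnK.
  by rewrite lerXn2r ?nnegrE// ln_ge0.
apply: (@le_trans _ _ 4); last by rewrite lerDl mulr_ge0 ?sqr_ge0 ?expR_ge0.
(* With [x = t ^+ 2] the left-hand side becomes four times the square of [t * ln t], and
   [- ln t <= t^-1]. *)
pose t := Num.sqrt x.
have t0 : 0 < t by rewrite sqrtr_gt0.
have xt : x = t ^+ 2 by rewrite sqr_sqrtr// ltW.
have := @ln_sublinear R t^-1; rewrite invr_gt0 => /(_ t0).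
rewrite lnV ?posrE// => h.
have lt0 : 0 <= - ln t.
  by rewrite oppr_ge0 ln_le0// -[leRHS]sqrtr1 ler_wsqrtr// ltW.
rewrite xt lnXn//.
have -> : t ^+ 2 * (ln t *+ 2) ^+ 2 = 4 * (t * - ln t) ^+ 2 by ring.
rewrite -[leRHS]mulr1 ler_pM2l// expr_le1//; last by rewrite mulr_ge0// ltW.
have : t * - ln t <= t * t^-1 by rewrite ler_pM2l// ltW.
by rewrite divff// gt_eqF.
Qed.

(** The linear term has the full [ln x] although the exponent has only [lnlo B x]: above [expR B]
    the left-hand side is just [x], and [ln x >= 0]. So the entropy itself appears when the bound is
    integrated. *)
Lemma chernoff_pointwise h B x : 0 <= B -> 0 <= h -> h * B <= 2^-1 -> 0 <= x ->
  x * expR (h * lnlo B x) <=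
  x + h * (x * ln x) + 2 * h ^+ 2 * (4 + expR B * B ^+ 2).
Proof.
move=> B0 h0 hB; have C0 : 0 <= 2 * h ^+ 2 * (4 + expR B * B ^+ 2).
  by rewrite !mulr_ge0 ?addr_ge0 ?mulr_ge0 ?sqr_ge0 ?expR_ge0.
rewrite le_eqVlt => /predU1P[<-|x0]; first by rewrite !mul0r mulr0 !add0r.
rewrite /lnlo; case: ltP => xB.
  rewrite mulr0 expR0 mulr1 -addrA lerDl addr_ge0// mulr_ge0// mulr_ge0//; first exact: ltW.
  by rewrite ln_ge0// (le_trans _ (ltW xB))// -expR0 ler_expR.
have lB : ln x <= B by rewrite -ler_expR lnK.
have hl : h * ln x <= 2^-1 by rewrite (le_trans _ hB)// ler_wpM2l.
have := expR_le_quadratic hl; rewrite -(ler_pM2l x0) => /le_trans; apply.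
have -> : x * (1 + h * ln x + 2 * (h * ln x) ^+ 2) =
  x + h * (x * ln x) + 2 * h ^+ 2 * (x * ln x ^+ 2) by ring.
by rewrite lerD2l ler_wpM2l ?mulr_ge0 ?sqr_ge0// x_ln2_le.
Qed.

End real_inequalities.

Section one_factor.
Context {R : realType} {d' : measure_display} {T' : measurableType d'}.
Variables (Q : probability T' R) (W : {RV Q >-> R}).
Hypotheses (W_ge0 : {ae Q, forall x, 0 <= W x})
  (W_mean : ('E_Q[W] = 1)%E)
  (W_llogl : ('E_Q[(fun x => W x * log2p (W x))%R] < +oo)%E)
  (W_entropy : ('E_Q[(fun x => W x * log2 (W x))%R] < 1)%E).

Let mW : measurable_fun setT W. Proof. exact: measurable_funP. Qed.

Let posW : {ae Q, forall x, pos (W x) = W x}.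
Proof. by apply: filterS W_ge0 => x; exact: pos_id. Qed.

Let mcW (f : R -> R) : measurable_fun setT f ->
  measurable_fun setT (EFin \o (f \o W)).
Proof. by move=> mf; apply/measurable_EFinP; exact: measurableT_comp. Qed.

Lemma integral_pos : (\int[Q]_y (pos (W y))%:E = 1)%E.
Proof.
rewrite -W_mean unlock; apply: ae_eq_integral => //.
- exact: mcW measurable_pos.
- exact/measurable_EFinP.
- by apply: filterS posW => x -> _.
Qed.

Let mlnp : measurable_fun [set: R] (fun x : R => pos x * Num.max (ln x) 0).
Proof.
apply: measurable_funM; first exact: measurable_pos.
by apply: measurable_maxr => //; exact: measurable_ln.
Qed.

Let mxln : measurable_fun [set: R] (fun x : R => pos x * ln x).
Proof. apply: measurable_funM; [exact: measurable_pos|exact: measurable_ln]. Qed.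

Let ln2_gt0 : 0 < ln (2 : R).
Proof. by rewrite ln_gt0// ltr1n. Qed.

Let int_lnp : (\int[Q]_y (pos (W y) * Num.max (ln (W y)) 0)%:E < +oo)%E.
Proof.
have -> : (\int[Q]_y (pos (W y) * Num.max (ln (W y)) 0)%:E =
  (ln 2)%:E * 'E_Q[(fun x => pos (W x) * log2p (W x))%R])%E.
  rewrite unlock -ge0_integralZl_EFin//; last 3 first.
  - move=> y _; rewrite lee_fin mulr_ge0 ?pos_ge0//.
  - apply: (mcW (f := fun x => pos x * log2p x)).
    apply: measurable_funM; first exact: measurable_pos.
    exact: measurable_log2p.
  - exact: ltW.
  apply: eq_integral => y _; rewrite -EFinM; congr EFin.
  rewrite /log2p /log2 mulrCA; congr (_ * _).
  by rewrite maxr_pMr ?ltW// mulr0 mulrCA divff ?mulr1// gt_eqF.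
rewrite lte_mul_pinfty//; first by rewrite lee_fin ltW.
rewrite (le_lt_trans _ W_llogl)// unlock le_eqVlt; apply/orP; left; apply/eqP.
have mf := @measurable_log2p R.
apply: ae_eq_integral => //.
- apply: (mcW (f := fun x => pos x * log2p x)); apply: measurable_funM => //.
  exact: measurable_pos.
- by apply: (mcW (f := fun x => x * log2p x)); apply: measurable_funM.
- by apply: filterS posW => x -> _.
Qed.

Let norm_xln (x : R) : `|pos x * ln x| <= 1 + pos x * Num.max (ln x) 0.
Proof.
have p0 := pos_ge0 x; have := x_ln_ge p0; rewrite ln_pos => h.
have h1 : pos x * ln x <= pos x * Num.max (ln x) 0.
  by rewrite ler_wpM2l// le_max lexx.
have h2 : 0 <= pos x * Num.max (ln x) 0 by rewrite mulr_ge0// le_max lexx orbT.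
by rewrite ler_norml; apply/andP; split; lra.
Qed.

Let i_xln : Q.-integrable setT (EFin \o (fun y => pos (W y) * ln (W y))).
Proof.
apply/integrableP; split; first exact: (mcW mxln).
apply: (@le_lt_trans _ _ (\int[Q]_y (1 + (pos (W y) * Num.max (ln (W y)) 0)%:E))%E).
  apply: ge0_le_integral => //.
  - by apply: measurableT_comp => //; exact: (mcW mxln).
  - by apply: emeasurable_funD => //; exact: (mcW mlnp).
  - by move=> y _; rewrite /= -EFinD lee_fin norm_xln.
rewrite ge0_integralD//; last 2 first.
- by move=> y _; rewrite lee_fin mulr_ge0 ?pos_ge0// le_max lexx orbT.
- exact: (mcW mlnp).
rewrite integral_cst//= probability_setT mule1.
by apply: lte_add_pinfty; [exact: (ltry 1)|exact: int_lnp].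
Qed.

Let ZE (k : R) : (\int[Q]_y (k%:E * (pos (W y) * ln (W y))%:E) =
  k%:E * \int[Q]_y (pos (W y) * ln (W y))%:E)%E.
Proof. exact: (integralZl measurableT i_xln). Qed.

(** One [kappa] becomes the decay rate of tame weights, one is granted to the large values [lnhi],
    and the third is shared by Chernoff's bound: half pays its quadratic error, half is its
    exponential rate. *)
Lemma entropy_gap : exists2 kappa : R, 0 < kappa &
  (\int[Q]_y (pos (W y) * ln (W y))%:E <= (ln 2 - 3 * kappa)%:E)%E.
Proof.
have fi : (\int[Q]_y (pos (W y) * ln (W y))%:E)%E \is a fin_num.
  exact: (integrable_fin_num measurableT i_xln).
pose e := fine (\int[Q]_y (pos (W y) * ln (W y))%:E)%E.
have eE : (\int[Q]_y (pos (W y) * ln (W y))%:E = e%:E)%E by rewrite fineK.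
suff e2 : e < ln 2.
  by exists ((ln 2 - e) / 3); [lra|rewrite eE lee_fin; lra].
have : (('E_Q[(fun x => W x * log2 (W x))%R]) = (e / ln 2)%:E)%E.
  rewrite unlock mulrC EFinM -eE -ZE.
  have ml := @measurable_log2 R.
  apply: ae_eq_integral => //.
  - by apply: (mcW (f := fun x => x * log2 x)); exact: measurable_funM.
  - by apply: measurable_funeM; exact: mcW mxln.
  - apply: filterS posW => y -> _; rewrite -EFinM; congr EFin.
    by rewrite /log2; ring.
by move=> h; move: W_entropy; rewrite h lte_fin ltr_pdivrMr// mul1r.
Qed.

Lemma chernoff_factor (kappa B : R) : 0 < kappa -> 0 <= B ->
  (\int[Q]_y (pos (W y) * ln (W y))%:E <= (ln 2 - 3 * kappa)%:E)%E ->
  exists2 h : R, 0 < h &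
  (\int[Q]_y (pos (W y) * expR (h * lnlo B (W y)))%:E <=
    (expR (h * (ln 2 - 5 / 2 * kappa)))%:E)%E.
Proof.
move=> k0 B0 ent; pose C := 4 + expR B * B ^+ 2.
have C0 : 0 < C by rewrite ltr_pwDl// mulr_ge0 ?expR_ge0 ?sqr_ge0.
(* The first bound gives [h * B <= 2^-1], the range of the quadratic estimate; the second makes the
   quadratic error at most [h * kappa / 2]. *)
pose h := Num.min (2 * (B + 1))^-1 (kappa / (4 * C)).
have h0 : 0 < h by rewrite lt_min invr_gt0 divr_gt0 ?mulr_gt0 ?andbT// ltr_wpDl.
have hB : h * B <= 2^-1.
  apply: (@le_trans _ _ ((2 * (B + 1))^-1 * B)).
    by rewrite ler_wpM2r// ge_min lexx.
  rewrite mulrC ler_pdivrMr ?mulr_gt0 ?ltr_wpDl//; lra.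
have hC : 2 * h ^+ 2 * C <= h * (kappa / 2).
  have : h <= kappa / (4 * C) by rewrite ge_min lexx orbT.
  rewrite ler_pdivlMr ?mulr_gt0// => hh.
  have -> : 2 * h ^+ 2 * C = h * ((h * (4 * C)) / 2) by field.
  by rewrite ler_pM2l// ler_pM2r.
exists h => //.
have mV : measurable_fun [set: T'] (EFin \o (fun y => pos (W y))).
  exact: (mcW measurable_pos).
have iV : Q.-integrable setT (EFin \o (fun y => pos (W y))).
  apply/integrableP; split => //.
  under eq_integral do rewrite /= ger0_norm ?pos_ge0//.
  by rewrite integral_pos ltry.
have ir : Q.-integrable setT (fun y => (h%:E * (pos (W y) * ln (W y))%:E)%E).
  by apply: integrableZl => //; exact: i_xln.
have ic : Q.-integrable setT (fun _ : T' => (2 * h ^+ 2 * C)%:E).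
  exact: finite_measure_integrable_cst.
have irc : Q.-integrable setT
    (fun y => (h%:E * (pos (W y) * ln (W y))%:E + (2 * h ^+ 2 * C)%:E)%E).
  exact: integrableD.
apply: (@le_trans _ _ (\int[Q]_y ((pos (W y))%:E +
    (h%:E * (pos (W y) * ln (W y))%:E + (2 * h ^+ 2 * C)%:E)))%E).
  apply: ge0_le_integral => //.
  - by move=> y _; rewrite lee_fin mulr_ge0 ?pos_ge0 ?expR_ge0.
  - apply: (mcW (f := fun x => pos x * expR (h * lnlo B x))).
    apply: measurable_funM; first exact: measurable_pos.
    apply: measurableT_comp => //; apply: measurable_funM => //.
    exact: measurable_lnlo.
  - apply: emeasurable_funD => //; exact: measurable_int irc.
  - move=> y _; rewrite -EFinM -!EFinD lee_fin.
    have := @chernoff_pointwise R h B (pos (W y)) B0 (ltW h0) hB (pos_ge0 _).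
    by rewrite /lnlo !ln_pos /pos lt_max [X in _ || X]ltNge expR_ge0 orbF addrA.
rewrite integralD//= integral_pos integralD//= integral_cst//=.
rewrite probability_setT mule1 ZE.
apply: (@le_trans _ _ (1 + (h * (ln 2 - 3 * kappa) + h * (kappa / 2))%:E)%E).
  rewrite leeD2l// EFinD leeD// ?lee_fin//.
  by rewrite EFinM lee_wpmul2l// lee_fin ltW.
rewrite -EFinD lee_fin (le_trans _ (expR_ge1Dx _))// lerD2l.
by rewrite le_eqVlt; apply/orP; left; apply/eqP; field.
Qed.

(** Dominated convergence: at each sample point [lnhi n] vanishes as soon as [expR n >= W y], and
    the positive part of [W ln W] dominates. *)
Lemma lnhi_tail (eps : R) : 0 < eps -> exists2 B : R, 0 <= B &
  (\int[Q]_y (pos (W y) * lnhi B (W y))%:E <= eps%:E)%E.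
Proof.
move=> e0.
pose f n y := (pos (W y) * lnhi n%:R (W y))%:E.
have mf n : measurable_fun setT (f n).
  apply: (mcW (f := fun x => pos x * lnhi n%:R x)).
  apply: measurable_funM; [exact: measurable_pos|exact: measurable_lnhi].
have f0 n y : (0 <= f n y)%E by rewrite lee_fin mulr_ge0 ?pos_ge0 ?lnhi_ge0.
pose g y := (pos (W y) * Num.max (ln (W y)) 0)%:E.
have ig : Q.-integrable setT g.
  apply/integrableP; split; first exact: mcW mlnp.
  under eq_integral do rewrite gee0_abs ?lee_fin ?mulr_ge0 ?pos_ge0 ?le_max ?lexx ?orbT//.
  exact: int_lnp.
have fg n y : (`|f n y| <= g y)%E.
  rewrite gee0_abs// lee_fin ler_wpM2l ?pos_ge0// /lnhi; case: ifP => _.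
    by rewrite le_max lexx.
  by rewrite le_max lexx orbT.
have ff y : f ^~ y @ \oo --> (cst 0%E : T' -> \bar R) y.
  apply: cvg_near_cst; near=> n; rewrite /f /lnhi ltNge.
  have -> : W y <= expR n%:R.
    apply: (@le_trans _ _ n%:R); first by near: n; exact: nbhs_infty_ger.
    by rewrite (le_trans _ (expR_ge1Dx _))// lerDr.
  by rewrite mulr0.
have [_ _] := @dominated_convergence _ _ _ Q setT measurableT f (cst 0%E) g mf
  (measurable_cst _) (aeW _ (fun y _ => ff y)) ig (aeW _ (fun y n _ => fg n y)).
rewrite integral0 => /fine_cvgP[h1 h2].
move/cvgr0_norm_le : h2 => /(_ _ e0) h2.
 have [n _ hn] : \forall n \near \oo, (\int[Q]_y f n y <= eps%:E)%E.
  near=> n.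
  have : `|fine (\int[Q]_y f n y)| <= eps by near: n.
  have /fineK <- : (\int[Q]_y f n y)%E \is a fin_num by near: n.
  by move=> h; rewrite lee_fin (le_trans (ler_norm _)).
by exists n%:R => //; apply: (hn n) => /=.
Unshelve. all: by end_near.
Qed.
End one_factor.

(** * Mass carried by tame paths *)

(** The density of the tilted law of the factors along a path: expectations under that law are
    written as integrals of [prodpos s * h s]. *)
Definition prodpos {R : realType} (s : seq R) : R := \prod_(x <- s) pos x.

(* The maximum over [k] of the sum of [f] over the first [k] entries of [s]. *)
Fixpoint garsia {R : realType} (f : R -> R) (s : seq R) : R :=
  if s is x :: s' then Num.max 0 (f x + garsia f s') else 0.

Section sequences_of_factors.
Context {R : realType}.
Implicit Types (s : seq R) (f : R -> R).

Lemma prodpos_ge0 s : 0 <= prodpos s.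
Proof. by apply: prodr_ge0 => x _; exact: pos_ge0. Qed.

Lemma prodpos_cons x s : prodpos (x :: s) = pos x * prodpos s.
Proof. by rewrite /prodpos big_cons. Qed.

Lemma prodpos_take_drop k s : prodpos s = prodpos (take k s) * prodpos (drop k s).
Proof. by rewrite -[in LHS](cat_take_drop k s) /prodpos big_cat. Qed.

Lemma garsia_ge0 f s : 0 <= garsia f s.
Proof. by case: s => //= x s; rewrite le_max lexx. Qed.

Lemma garsia_take f s k : garsia f (take k s) <= garsia f s.
Proof.
elim: s k => [|x s IH] [|k] //=; first by rewrite le_max lexx.
rewrite ge_max le_max lexx /=.
by rewrite le_max lerD2l IH orbT.
Qed.

Lemma garsia_partial_sum f s k : \sum_(x <- take k s) f x <= garsia f s.
Proof.
elim: s k => [|x s IH] [|k] /=; rewrite ?big_nil ?le_max ?lexx//.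
by rewrite big_cons lerD2l IH orbT.
Qed.

Definition mseqR (h : seq R -> R) : Prop :=
  forall (d0 : measure_display) (S : measurableType d0) (Y : nat -> S -> R) n,
    (forall i, measurable_fun [set: S] (Y i)) ->
    measurable_fun [set: S] (h \o (fun z => mkseq (Y ^~ z) n)).

Lemma mseqR_mseq h : mseqR h -> mseq (EFin \o h).
Proof. by move=> mh d0 S Y n mY; apply/measurable_EFinP; exact: mh. Qed.

Lemma mkseqS A (f : nat -> A) n : mkseq f n.+1 = f 0%N :: mkseq (f \o S) n.
Proof. by rewrite /mkseq -add1n iotaD map_cat /= (iotaDl 1) -map_comp. Qed.

Lemma mseqR_prod f : measurable_fun setT f -> mseqR (fun s => \prod_(x <- s) f x).
Proof.
move=> mf d0 S Y n; elim: n Y => [|n IH] Y mY.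
  by apply: (eq_measurable_fun (cst (1 : R))) => [z _|//]; rewrite /= big_nil.
apply: (eq_measurable_fun (fun z => f (Y 0%N z) *
    \prod_(x <- mkseq ((fun i => Y i.+1) ^~ z) n) f x)) => [z _|].
  by rewrite /= mkseqS big_cons.
apply: measurable_funM; first exact: (measurableT_comp mf (mY 0%N)).
by apply: (IH (fun i => Y i.+1)) => i; exact: mY.
Qed.

Lemma mseqR_sum f : measurable_fun setT f -> mseqR (fun s => \sum_(x <- s) f x).
Proof.
move=> mf d0 S Y n; elim: n Y => [|n IH] Y mY.
  by apply: (eq_measurable_fun (cst (0 : R))) => [z _|//]; rewrite /= big_nil.
apply: (eq_measurable_fun (fun z => f (Y 0%N z) +
    \sum_(x <- mkseq ((fun i => Y i.+1) ^~ z) n) f x)) => [z _|].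
  by rewrite /= mkseqS big_cons.
apply: measurable_funD; first exact: (measurableT_comp mf (mY 0%N)).
by apply: (IH (fun i => Y i.+1)) => i; exact: mY.
Qed.

Lemma mseqR_garsia f : measurable_fun setT f -> mseqR (garsia f).
Proof.
move=> mf d0 S Y n; elim: n Y => [|n IH] Y mY.
  exact: (eq_measurable_fun (cst (0 : R))).
apply: (eq_measurable_fun (fun z => Num.max 0 (f (Y 0%N z) +
    garsia f (mkseq ((fun i => Y i.+1) ^~ z) n)))) => [z _|].
  by rewrite [in RHS]/comp mkseqS.
apply: measurable_maxr => //.
apply: measurable_funD; first exact: (measurableT_comp mf (mY 0%N)).
by apply: (IH (fun i => Y i.+1)) => i; exact: mY.
Qed.

Lemma mseqR_take h k : mseqR h -> mseqR (h \o take k).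
Proof.
move=> mh d0 S Y n mY.
apply: (eq_measurable_fun (fun z => h (mkseq (Y ^~ z) (minn k n)))) => [z _|].
  by rewrite /= /mkseq -map_take take_iota.
exact: mh.
Qed.

Lemma mseqR_drop h k : mseqR h -> mseqR (h \o drop k).
Proof.
move=> mh d0 S Y n mY.
apply: (eq_measurable_fun (fun z =>
    h (mkseq ((fun i => Y (k + i)%N) ^~ z) (n - k)))) => [z _|].
  by rewrite /= /mkseq -map_drop drop_iota addnC iotaDl -map_comp.
exact: mh.
Qed.

Lemma mseqR_mul h h' : mseqR h -> mseqR h' -> mseqR (fun s => h s * h' s).
Proof.
by move=> mh mh' d0 S Y n mY; apply: measurable_funM; [exact: mh|exact: mh'].
Qed.

Lemma mseqR_add h h' : mseqR h -> mseqR h' -> mseqR (fun s => h s + h' s).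
Proof.
by move=> mh mh' d0 S Y n mY; apply: measurable_funD; [exact: mh|exact: mh'].
Qed.

Lemma mseqR_bool (b : seq R -> bool) :
  (forall (d0 : measure_display) (S : measurableType d0) (Y : nat -> S -> R) n,
    (forall i, measurable_fun [set: S] (Y i)) ->
    measurable_fun [set: S] (b \o (fun z => mkseq (Y ^~ z) n))) ->
  mseqR (fun s => (b s)%:R).
Proof.
move=> mb d0 S Y n mY.
apply: (eq_measurable_fun (fun z => if b (mkseq (Y ^~ z) n) then 1 else 0 : R)).
  by move=> z _ /=; case: (b _).
by apply: measurable_fun_ifT => //; exact: mb.
Qed.

Lemma mseqR_ltr h h' : mseqR h -> mseqR h' -> mseqR (fun s => (h s < h' s)%R%:R).
Proof.
move=> mh mh'; apply: mseqR_bool => d0 S Y n mY.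
by apply: measurable_fun_ltr; [exact: mh|exact: mh'].
Qed.

Lemma mseqR_ler h h' : mseqR h -> mseqR h' -> mseqR (fun s => (h s <= h' s)%R%:R).
Proof.
move=> mh mh'; apply: mseqR_bool => d0 S Y n mY.
by apply: measurable_fun_ler; [exact: mh|exact: mh'].
Qed.

Lemma mseqR_cst a : mseqR (fun=> a).
Proof. by move=> d0 S Y n mY; exact: measurable_cst. Qed.

Lemma mseqR_prodpos : mseqR prodpos.
Proof. by apply: mseqR_prod; exact: measurable_pos. Qed.

(* The factor [2 ^+ k] makes this a bound by [rho ^+ (4 * k)] on the weights of
   the ancestors of generation [k >= K]. *)
Definition tame (K : nat) (rho : R) s : R :=
  \prod_(K <= k < (size s).+1) (prodpos (take k s) <= 2 ^+ k * rho ^+ (4 * k))%R%:R.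

Lemma mseqR_tame K rho : mseqR (tame K rho).
Proof.
move=> d0 S Y n mY.
apply: (eq_measurable_fun (fun z => \prod_(K <= k < n.+1)
  ((prodpos \o take k) (mkseq (Y ^~ z) n) <= 2 ^+ k * rho ^+ (4 * k))%R%:R : R)).
  by move=> z _; rewrite /tame /= size_mkseq.
apply: measurable_prod => k _.
by apply: (mseqR_ler (mseqR_take k mseqR_prodpos) (mseqR_cst _)).
Qed.

Lemma tame_ge0 K rho s : 0 <= tame K rho s.
Proof. exact: prodr_ge0. Qed.

(** If tameness fails at [k] while [prodpos s > 0], the first [k] logarithms sum to more than
    [k * (ln 2 - kappa)], because [expR (- kappa) <= rho ^+ 4]. Then either their low parts exceed
    [k * (ln 2 - 2 * kappa)] or their high parts exceed [k * kappa]; in the latter case a partial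
    sum of [lnhi B x - kappa] is positive. *)
Lemma escape_dichotomy (kappa B rho : R) K s : 0 < kappa -> (0 < K)%N ->
  0 <= rho -> expR (- kappa) <= rho ^+ 4 ->
  prodpos s <= prodpos s * tame K rho s +
    prodpos s * (0 < garsia (fun x => lnhi B x - kappa) s)%R%:R +
    \sum_(K <= k < (size s).+1) prodpos s *
      (k%:R * (ln 2 - 2 * kappa) < \sum_(x <- take k s) lnlo B x)%R%:R.
Proof.
move=> k0 K0 r0 kr.
have S0 : 0 <= \sum_(K <= k < (size s).+1) prodpos s *
      (k%:R * (ln 2 - 2 * kappa) < \sum_(x <- take k s) lnlo B x)%R%:R :> R.
  by apply: sumr_ge0 => k _; rewrite mulr_ge0// prodpos_ge0.
have [s0|s0] := eqVneq (prodpos s) 0.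
  by rewrite s0 !mul0r !add0r; rewrite s0 in S0.
have p0 : 0 < prodpos s by rewrite lt_neqAle eq_sym s0 prodpos_ge0.
have spos x : x \in s -> 0 < x.
  move=> xs; rewrite ltNge; apply/negP => x0.
  move/eqP: s0; apply; apply/eqP; rewrite prodf_seq_eq0; apply/hasP.
  by exists x => //=; rewrite /pos; apply/eqP/max_idPr.
have [/allP tm|/allPn[k]] := boolP (all (fun k => prodpos (take k s) <=
    2 ^+ k * rho ^+ (4 * k)) (index_iota K (size s).+1)).
  have -> : tame K rho s = 1 by rewrite /tame big_seq big1// => k /tm ->.
  by rewrite mulr1 -addrA lerDl addr_ge0// mulr_ge0// prodpos_ge0.
rewrite mem_index_iota => /andP[Kk ks]; rewrite -ltNge => viol.
have tpos x : x \in take k s -> 0 < x by move/mem_take/spos.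
have sz : size (take k s) = k by rewrite size_takel.
have lnE : forall t : seq R, (forall x, x \in t -> 0 < x) ->
    ln (prodpos t) = \sum_(x <- t) ln x /\ 0 < prodpos t.
  elim=> [|x t IH] tp; first by rewrite /prodpos !big_nil ln1.
  have [|IH1 IH2] := IH; first by move=> y yt; apply: tp; rewrite inE yt orbT.
  have x0 : 0 < x by apply: tp; rewrite inE eqxx.
  rewrite prodpos_cons big_cons pos_id ?ltW//; split; last exact: mulr_gt0.
  by rewrite lnM ?posrE// IH1.
have [lnT T0] := lnE _ tpos.
have big : k%:R * (ln 2 - kappa) < \sum_(x <- take k s) ln x.
  rewrite -lnT -ltr_expR lnK ?posrE//; apply: le_lt_trans viol.
  rewrite expRM_natl expRD lnK ?posrE// exprMn.
  rewrite ler_pM2l ?exprn_gt0// exprM.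
  by rewrite lerXn2r ?nnegrE ?expR_ge0 ?exprn_ge0.
have split_sum : \sum_(x <- take k s) ln x =
    \sum_(x <- take k s) lnhi B x + \sum_(x <- take k s) lnlo B x.
  by rewrite -big_split; apply: eq_bigr => x _; rewrite /= lnhi_lnlo.
have [lo|lo] := ltP (k%:R * (ln 2 - 2 * kappa)) (\sum_(x <- take k s) lnlo B x).
  rewrite [X in _ <= _ + X](bigD1_seq k)/= ?iota_uniq ?mem_index_iota ?Kk//.
  rewrite lo mulr1 addrCA lerDl addr_ge0//.
    by rewrite addr_ge0// mulr_ge0// ?prodpos_ge0 ?tame_ge0.
  by apply: sumr_ge0 => j _; rewrite mulr_ge0// prodpos_ge0.
have hi : 0 < \sum_(x <- take k s) (lnhi B x - kappa).
  rewrite sumrB big_const_seq count_predT iter_addr_0 sz -mulr_natl; lra.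
rewrite (lt_le_trans hi (garsia_partial_sum _ _ _)) mulr1.
by rewrite addrAC lerDr addr_ge0// mulr_ge0// ?prodpos_ge0 ?tame_ge0.
Qed.

End sequences_of_factors.

(** * Maximal inequality and Chernoff's bound under the tilted law *)

Section tilted_paths.
Context {R : realType} {d : measure_display} {T : measurableType d}
  {d' : measure_display} {T' : measurableType d'}.
Variables (P : probability T R) (Q : probability T' R).
Variables (W : {RV Q >-> R}) (X : seq bool -> {RV P >-> R}).
Hypothesis X_iid : iid_copies W X.
Hypothesis W1 : (\int[Q]_y (pos (W y))%:E = 1)%E.

Let mW : measurable_fun setT W. Proof. exact: measurable_funP. Qed.

Let mcW (f : R -> R) : measurable_fun setT f ->
  measurable_fun setT (EFin \o (f \o W)).
Proof. by move=> mf; apply/measurable_EFinP; exact: measurableT_comp. Qed.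

Definition path_factors (l : seq (seq bool)) (w : T) : seq R := [seq X u w | u <- l].

Let E (l : seq (seq bool)) (h : seq R -> R) : \bar R :=
  (\int[P]_w (h (path_factors l w))%:E)%E.

(** Distinct words suffice: they need not lie on one branch of the tree, so the list may be
    permuted. *)
Let chain (l : seq (seq bool)) := uniq l /\ all (fun u => u != [::]) l.

Let mpath l h : all (fun u => u != [::]) l -> mseqR h ->
  measurable_fun setT (fun w => (h (path_factors l w))%:E).
Proof.
move=> l0 mh; apply: (mfunctional_map l0 (mseqR_mseq mh) (Y := fun w u => X u w)).
by move=> u _; exact: measurable_funP.
Qed.

Let E_iterE l h : chain l -> mseqR h -> (forall s, 0 <= h s) ->
  E l h = iterE W (size l) (EFin \o h).
Proof.
move=> [ul l0] mh h0.
have h0' s : (0 <= (EFin \o h) s)%E by rewrite /= lee_fin.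
by rewrite -(integral_iterE X_iid ul l0 (mseqR_mseq mh) h0').
Qed.

Let E_le l h h' : chain l -> mseqR h -> mseqR h' -> (forall s, 0 <= h s) ->
  (forall s, h s <= h' s) -> (E l h <= E l h')%E.
Proof.
move=> [_ l0] mh mh' h0 hh'; apply: ge0_le_integral => //.
- by move=> w _; rewrite lee_fin.
- exact: mpath.
- exact: mpath.
- by move=> w _; rewrite lee_fin.
Qed.

Let ED l h h' : chain l -> mseqR h -> mseqR h' -> (forall s, 0 <= h s) ->
  (forall s, 0 <= h' s) -> (E l (fun s => (h s + h' s)%R) = E l h + E l h')%E.
Proof.
move=> [_ l0] mh mh' h0 h'0; rewrite /E -ge0_integralD//.
- by move=> w _; rewrite lee_fin.
- exact: mpath.
- by move=> w _; rewrite lee_fin.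
- exact: mpath.
Qed.

Let iterE_prodpos n (a : R) : 0 <= a ->
  iterE W n (fun s => (a * prodpos s)%:E) = a%:E.
Proof.
move=> a0; elim: n => [|n IH] /=; first by rewrite /prodpos big_nil mulr1.
rewrite -[RHS]IH; congr iterE; apply/funext => s.
under eq_integral do rewrite prodpos_cons mulrCA mulrC EFinM.
rewrite ge0_integralZl_EFin// ?W1 ?mule1//.
- by move=> y _; rewrite lee_fin pos_ge0.
- exact: (mcW measurable_pos).
- by rewrite mulr_ge0// prodpos_ge0.
Qed.

(** The constant [a] collects the powers of [alpha] already integrated out, which makes the
    induction on [k] close. *)
Let iterE_take k m (a alpha : R) (f : R -> R) : 0 <= a -> 0 <= alpha ->
  (forall x, 0 <= f x) -> measurable_fun setT f ->
  (\int[Q]_y (f (W y))%:E = alpha%:E)%E ->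
  iterE W (k + m) (fun s => (a * \prod_(x <- take k s) f x * prodpos (drop k s))%:E)
  = (a * alpha ^+ k)%:E.
Proof.
move=> a0 al0 f0 mf fal; elim: k a a0 => [|k IH] a a0.
  rewrite expr0 mulr1 -[RHS](iterE_prodpos m a0); congr iterE.
  by apply/funext => s; rewrite take0 drop0 big_nil mulr1.
rewrite addSn /= exprS mulrA -(IH (a * alpha))//; last exact: mulr_ge0.
congr iterE; apply/funext => s.
under eq_integral do rewrite /= big_cons.
set b := a * \prod_(x <- take k s) f x * prodpos (drop k s).
have b0 : 0 <= b by rewrite !mulr_ge0 ?prodpos_ge0// prodr_ge0.
transitivity (\int[Q]_y (b%:E * (f (W y))%:E))%E.
  by apply: eq_integral => y _; rewrite -EFinM /b; congr EFin; ring.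
rewrite ge0_integralZl_EFin// ?fal.
- by rewrite -EFinM /b; congr EFin; ring.
- by move=> y _; rewrite lee_fin.
- exact: (mcW mf).
Qed.

Lemma integral_prodpos l : chain l -> E l prodpos = 1%E.
Proof.
move=> cl; rewrite E_iterE//; [|exact: mseqR_prodpos|exact: prodpos_ge0].
rewrite -(iterE_prodpos (size l) ler01); congr iterE.
by apply/funext => s; rewrite /= mul1r.
Qed.

Let E_take k l (alpha : R) (f : R -> R) : chain l -> (k <= size l)%N -> 0 <= alpha ->
  (forall x, 0 <= f x) -> measurable_fun setT f ->
  (\int[Q]_y (f (W y))%:E = alpha%:E)%E ->
  E l (fun s => \prod_(x <- take k s) f x * prodpos (drop k s)) = (alpha ^+ k)%:E.
Proof.
move=> cl kl al0 f0 mf fal; rewrite E_iterE//.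
- have := @iterE_take k (size l - k) 1 alpha f ler01 al0 f0 mf fal.
  rewrite subnKC// mul1r => <-.
  by congr iterE; apply/funext => s; rewrite /= mul1r.
- apply: mseqR_mul; first exact: (mseqR_take k (mseqR_prod mf)).
  exact: (mseqR_drop k mseqR_prodpos).
- by move=> s; rewrite mulr_ge0 ?prodpos_ge0// prodr_ge0.
Qed.

Section maximal_inequality.
Variables (g : R -> R) (kappa c : R).
Hypotheses (mg : measurable_fun setT g) (g0 : forall x, 0 <= g x).
Hypotheses (k0 : 0 < kappa) (c0 : 0 <= c).
Hypothesis gc : (\int[Q]_y (pos (W y) * g (W y))%:E = c%:E)%E.

Let f x := g x - kappa.
Let mf : measurable_fun setT f. Proof. exact: measurable_funB. Qed.
Let M s := garsia f s.
Let mM : mseqR (fun s => prodpos s * M s).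
Proof. by apply: mseqR_mul; [exact: mseqR_prodpos|exact: mseqR_garsia]. Qed.
Let M0 s : 0 <= prodpos s * M s.
Proof. by rewrite mulr_ge0 ?prodpos_ge0 ?garsia_ge0. Qed.

Let mMd : mseqR (fun s => prodpos s * M (drop 1 s)).
Proof.
by apply: mseqR_mul; [exact: mseqR_prodpos|exact: (mseqR_drop 1 (mseqR_garsia mf))].
Qed.
Let Md0 s : 0 <= prodpos s * M (drop 1 s).
Proof. by rewrite mulr_ge0 ?prodpos_ge0 ?garsia_ge0. Qed.

Let mG : mseqR (fun s => \prod_(x <- take 1 s) (pos x * g x) * prodpos (drop 1 s)).
Proof.
apply: mseqR_mul; last exact: (mseqR_drop 1 mseqR_prodpos).
apply: (mseqR_take 1 (mseqR_prod _)).
by apply: measurable_funM => //; exact: measurable_pos.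
Qed.
Let G0 s : 0 <= \prod_(x <- take 1 s) (pos x * g x) * prodpos (drop 1 s).
Proof.
rewrite mulr_ge0 ?prodpos_ge0// prodr_ge0// => x _.
by rewrite mulr_ge0 ?pos_ge0.
Qed.

Let E_head v l : chain (v :: l) ->
  E (v :: l) (fun s => \prod_(x <- take 1 s) (pos x * g x) * prodpos (drop 1 s)) = c%:E.
Proof.
move=> cl; rewrite (@E_take 1 (v :: l) c (fun x => pos x * g x)) ?expr1//.
- by move=> x; rewrite mulr_ge0 ?pos_ge0.
- by apply: measurable_funM => //; exact: measurable_pos.
Qed.

Let chain_behead v l : chain (v :: l) -> chain l.
Proof. by move=> [] /= /andP[_ ?] /andP[_ ?]. Qed.

Let E_drop v l : chain (v :: l) ->
  E (v :: l) (fun s => prodpos s * M (drop 1 s)) = E l (fun s => prodpos s * M s).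
Proof.
move=> cl; rewrite !E_iterE//; last exact: chain_behead cl.
rewrite /=; congr iterE; apply/funext => s.
transitivity (\int[Q]_y ((prodpos s * M s)%:E * (pos (W y))%:E))%E.
  apply: eq_integral => y _; rewrite -EFinM; congr EFin.
  by rewrite /= prodpos_cons drop0; ring.
rewrite ge0_integralZl_EFin// ?W1 ?mule1//.
- by move=> y _; rewrite lee_fin pos_ge0.
- exact: (mcW measurable_pos).
Qed.

(* [M (x :: s) <= g x + M s], with a gain of [kappa] when the left-hand side is
   positive. *)
Let M_step x s : prodpos (x :: s) * M (x :: s) +
    prodpos (x :: s) * (kappa * (0 < M (x :: s))%R%:R) <=
  \prod_(z <- take 1 (x :: s)) (pos z * g z) * prodpos (drop 1 (x :: s)) +
  prodpos (x :: s) * M (drop 1 (x :: s)).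
Proof.
rewrite /= drop0 take0 big_seq1 prodpos_cons.
have -> : pos x * g x * prodpos s = pos x * prodpos s * g x by ring.
rewrite -!mulrDr; apply: ler_wpM2l; first by rewrite mulr_ge0 ?pos_ge0 ?prodpos_ge0.
rewrite {1 2}/M /= -/(M s) /f; have := g0 x; have := @garsia_ge0 R f s; rewrite -/(M s).
have [h|h] := leP (g x - kappa + M s) 0.
  by rewrite ltxx mulr0; lra.
by rewrite h mulr1; lra.
Qed.

(** Finiteness is what allows this expectation to be cancelled from both sides in the maximal
    inequality. *)
Let E_M_fin l : chain l -> (E l (fun s => prodpos s * M s)%R < +oo)%E.
Proof.
elim: l => [|v l IH] cl.
  rewrite /E /=; under eq_integral do rewrite mulr0.
  by rewrite integral0 ltry.
apply: (@le_lt_trans _ _ (c%:E + E l (fun s => prodpos s * M s)%R)%E); last first.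
  by rewrite lte_add_pinfty ?ltry//; apply: IH; exact: chain_behead cl.
rewrite -(E_head cl) -(E_drop cl) -ED//.
have [_ l0] := cl.
apply: ge0_le_integral => //.
- by move=> w _; rewrite lee_fin.
- by apply: (mpath l0 (h := fun s => prodpos s * M s)).
- exact: (mpath l0 (mseqR_add mG mMd)).
- move=> w _; rewrite lee_fin (le_trans _ (M_step _ _))// lerDl.
  by rewrite mulr_ge0 ?prodpos_ge0// mulr_ge0// ltW.
Qed.

(* Hopf's maximal ergodic inequality, by Garsia's argument: stationarity under
   the tilted law is the invariance of the law under cyclic relabelling. *)
Lemma maximal_ergodic l : chain l ->
  (E l (fun s => prodpos s * (0 < garsia (fun x => (g x - kappa)%R) s)%R%:R)%R
   <= (c / kappa)%:E)%E.
Proof.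
case: l => [|v l] cl.
  rewrite /E /= ltxx; under eq_integral do rewrite mulr0.
  by rewrite integral0 lee_fin divr_ge0// ltW.
have [ul l0] := cl.
have shift : (E (v :: l) (fun s => prodpos s * M (drop 1 s))%R <=
    E (v :: l) (fun s => prodpos s * M s)%R)%E.
  have cl' : chain (rcons l v).
    by split; [move: ul => /=; rewrite rcons_uniq|move: l0 => /=; rewrite all_rcons].
  (* Factors along [rcons l v] have the same law as those along [v :: l]. After this rotation,
     dropping the head becomes dropping the last entry, which cannot increase the maximum of the
     partial sums. *)
  apply: (@le_trans _ _ (E (v :: l) (fun s => prodpos s * M (take (size l) s))%R)).
    have mMt : mseqR (fun s => prodpos s * M (take (size l) s)).
      apply: mseqR_mul; first exact: mseqR_prodpos.
      exact: (mseqR_take (size l) (mseqR_garsia mf)).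
    have Mt0 s : 0 <= prodpos s * M (take (size l) s).
      by rewrite mulr_ge0 ?prodpos_ge0 ?garsia_ge0.
    rewrite (E_iterE cl mMt Mt0) [size (v :: l)]/= -(size_rcons l v) -(E_iterE cl' mMt Mt0).
    rewrite le_eqVlt; apply/orP; left; apply/eqP; apply: eq_integral => w _.
    congr EFin; rewrite /path_factors map_rcons /= drop0; congr (_ * M _).
      by rewrite prodpos_cons /prodpos -cats1 big_cat /= big_seq1 mulrC.
    by rewrite -cats1 take_size_cat// size_map.
  apply: E_le => //; last by move=> s; rewrite ler_wpM2l ?prodpos_ge0 ?garsia_take.
    by apply: mseqR_mul; [exact: mseqR_prodpos|exact: (mseqR_take (size l) (mseqR_garsia mf))].
  by move=> s; rewrite mulr_ge0 ?prodpos_ge0 ?garsia_ge0.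
have mI : mseqR (fun s => prodpos s * (kappa * (0 < M s)%R%:R)).
  apply: mseqR_mul; first exact: mseqR_prodpos.
  apply: mseqR_mul; first exact: mseqR_cst.
  by apply: mseqR_ltr; [exact: mseqR_cst|exact: mseqR_garsia].
have I0 s : 0 <= prodpos s * (kappa * (0 < M s)%R%:R).
  by rewrite mulr_ge0 ?prodpos_ge0// mulr_ge0// ltW.
(* Integrate [M_step], bound the shifted term by [shift], and cancel the finite expectation of
   [M]. *)
have main : (E (v :: l) (fun s => prodpos s * (kappa * (0 < M s)%R%:R))%R <= c%:E)%E.
  rewrite -(@leeD2lE _ (E (v :: l) (fun s => prodpos s * M s)%R)); last first.
    rewrite ge0_fin_numE ?E_M_fin//; apply: integral_ge0 => w _.
    by rewrite lee_fin.
  rewrite -ED// addeC; apply: (@le_trans _ _ (c%:E + E (v :: l) (fun s => prodpos s * M (drop 1 s))%R)%E); last first.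
    by rewrite leeD2l.
  rewrite -(E_head cl) -ED//; apply: ge0_le_integral => //.
  - by move=> w _; rewrite lee_fin addr_ge0.
  - exact: (mpath l0 (mseqR_add mM mI)).
  - exact: (mpath l0 (mseqR_add mG mMd)).
  - by move=> w _; rewrite lee_fin; exact: M_step.
rewrite -(@lee_pmul2l _ kappa%:E)// -EFinM mulrC divfK ?gt_eqF// -ge0_integralZl_EFin//.
- apply: le_trans main; rewrite le_eqVlt; apply/orP; left; apply/eqP.
  by apply: eq_integral => w _; rewrite -EFinM; congr EFin; rewrite mulrCA.
- by move=> w _; rewrite lee_fin mulr_ge0 ?prodpos_ge0.
- apply: (mpath l0 (h := fun s => prodpos s * (0 < M s)%R%:R)).
  apply: mseqR_mul; first exact: mseqR_prodpos.
  by apply: mseqR_ltr; [exact: mseqR_cst|exact: mseqR_garsia].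
- exact: ltW.
Qed.

End maximal_inequality.

(** Markov's inequality for the exponential of [h] times the sum of [lnlo]: under the tilted law
    each of the first [k] factors gives the same moment and the others integrate to 1. The
    difference between [5 / 2 * kappa] and [2 * kappa] is the rate. *)
Lemma chernoff_bound l (kappa B h : R) k : chain l -> (k <= size l)%N ->
  0 < h ->
  (\int[Q]_y (pos (W y) * expR (h * lnlo B (W y)))%:E <=
    (expR (h * (ln 2 - 5 / 2 * kappa)))%:E)%E ->
  (E l (fun s => prodpos s *
     (k%:R * (ln 2 - 2 * kappa) < \sum_(x <- take k s) lnlo B x)%R%:R)%R <=
   (expR (- (h * kappa / 2)) ^+ k)%:E)%E.
Proof.
move=> cl kl h0 hyp.
pose f x : R := pos x * expR (h * lnlo B x).
have f0 x : 0 <= f x by rewrite mulr_ge0 ?pos_ge0 ?expR_ge0.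
have mf : measurable_fun setT f.
  apply: measurable_funM; first exact: measurable_pos.
  by apply: measurableT_comp => //; apply: measurable_funM => //; exact: measurable_lnlo.
pose al := fine (\int[Q]_y (f (W y))%:E)%E.
have If0 : (0 <= \int[Q]_y (f (W y))%:E)%E.
  by apply: integral_ge0 => y _; rewrite lee_fin.
have alE : (\int[Q]_y (f (W y))%:E = al%:E)%E.
  by rewrite fineK// ge0_fin_numE// (le_lt_trans hyp)// ltry.
have al0 : 0 <= al by rewrite fine_ge0.
have ale : al <= expR (h * (ln 2 - 5 / 2 * kappa)) by rewrite -lee_fin -alE.
pose t := ln 2 - 2 * kappa.
have mH : mseqR (fun s => \prod_(x <- take k s) f x * prodpos (drop k s)).
  apply: mseqR_mul; first exact: (mseqR_take k (mseqR_prod mf)).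
  exact: (mseqR_drop k mseqR_prodpos).
have H0 s : 0 <= \prod_(x <- take k s) f x * prodpos (drop k s).
  by rewrite mulr_ge0 ?prodpos_ge0// prodr_ge0.
apply: (@le_trans _ _ (E l (fun s => expR (- (h * (k%:R * t))) *
    (\prod_(x <- take k s) f x * prodpos (drop k s)))%R)).
  apply: E_le => //.
  - apply: mseqR_mul; first exact: mseqR_prodpos.
    by apply: mseqR_ltr; [exact: mseqR_cst|exact: (mseqR_take k (mseqR_sum (@measurable_lnlo R B)))].
  - by apply: mseqR_mul => //; exact: mseqR_cst.
  - by move=> s; rewrite mulr_ge0 ?prodpos_ge0.
  - move=> s; rewrite /f big_split /= -expR_sum -mulr_sumr.
    rewrite (prodpos_take_drop k s).
    case: ltP => hs; last first.
      by rewrite mulr0 !mulr_ge0 ?expR_ge0 ?prodpos_ge0.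
    rewrite mulr1 -/(prodpos (take k s)).
    rewrite [leRHS](_ : _ = prodpos (take k s) * prodpos (drop k s) *
      (expR (- (h * (k%:R * t))) * expR (h * \sum_(x <- take k s) lnlo B x))); last by ring.
    rewrite -expRD ler_peMr ?mulr_ge0 ?prodpos_ge0//.
    rewrite (le_trans _ (expR_ge1Dx _))// lerDl addrC -mulrBr.
    by rewrite mulr_ge0 ?subr_ge0// ltW.
rewrite /E; under eq_integral do rewrite EFinM.
rewrite ge0_integralZl_EFin//; last 2 first.
- by move=> w _; rewrite lee_fin.
- by have [_ l0] := cl; exact: (mpath l0 mH).
rewrite -/(E l (fun s => \prod_(x <- take k s) f x * prodpos (drop k s))) (E_take cl kl al0 f0 mf alE) -EFinM lee_fin.
rewrite -[leRHS]expRM_natl.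
apply: (@le_trans _ _ (expR (- (h * (k%:R * t))) * expR (h * (ln 2 - 5 / 2 * kappa)) ^+ k)).
  by rewrite ler_wpM2l ?expR_ge0// lerXn2r ?nnegrE ?expR_ge0.
by rewrite -expRM_natl -expRD ler_expR /t; lra.
Qed.

Lemma mass_split l (kappa B rho : R) K : chain l -> 0 < kappa -> (0 < K)%N ->
  0 <= rho -> expR (- kappa) <= rho ^+ 4 ->
  (1 <= E l (fun s => prodpos s * tame K rho s)%R +
   E l (fun s => prodpos s * (0 < garsia (fun x => (lnhi B x - kappa)%R) s)%R%:R)%R +
   \sum_(K <= k < (size l).+1) E l (fun s => prodpos s *
     (k%:R * (ln 2 - 2 * kappa) < \sum_(x <- take k s) lnlo B x)%R%:R)%R)%E.
Proof.
move=> cl k0 K0 r0 kr; have [_ l0] := cl.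
pose h1 s : R := prodpos s * tame K rho s.
pose h2 s : R := prodpos s * (0 < garsia (fun x => lnhi B x - kappa) s)%R%:R.
pose h3 k s : R := prodpos s *
     (k%:R * (ln 2 - 2 * kappa) < \sum_(x <- take k s) lnlo B x)%R%:R.
have m1 : mseqR h1 by apply: mseqR_mul; [exact: mseqR_prodpos|exact: mseqR_tame].
have m2 : mseqR h2.
  apply: mseqR_mul; first exact: mseqR_prodpos.
  apply: mseqR_ltr; first exact: mseqR_cst.
  by apply: mseqR_garsia; apply: measurable_funB => //; exact: measurable_lnhi.
have m3 k : mseqR (h3 k).
  apply: mseqR_mul; first exact: mseqR_prodpos.
  apply: mseqR_ltr; first exact: mseqR_cst.
  exact: (mseqR_take k (mseqR_sum (@measurable_lnlo R B))).
have m4 : mseqR (fun s => \sum_(K <= k < (size l).+1) h3 k s).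
  by move=> d0 S Y n mY; apply: measurable_sum => k; exact: m3.
have p1 s : 0 <= h1 s by rewrite mulr_ge0 ?prodpos_ge0 ?tame_ge0.
have p2 s : 0 <= h2 s by rewrite mulr_ge0 ?prodpos_ge0.
have p3 k s : 0 <= h3 k s by rewrite mulr_ge0 ?prodpos_ge0.
rewrite -(integral_prodpos cl) -/h1 -/h2.
apply: (@le_trans _ _ (E l (fun s => (h1 s + h2 s) +
    \sum_(K <= k < (size l).+1) h3 k s))).
  apply: ge0_le_integral => //.
  - by move=> w _; rewrite lee_fin prodpos_ge0.
  - exact: (mpath l0 mseqR_prodpos).
  - exact: (mpath l0 (mseqR_add (mseqR_add m1 m2) m4)).
  - move=> w _; rewrite lee_fin.
    have := escape_dichotomy B (path_factors l w) k0 K0 r0 kr.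
    by rewrite {5}/path_factors size_map.
rewrite ED//; last 3 first.
- exact: mseqR_add.
- by move=> s; rewrite addr_ge0.
- by move=> s; apply: sumr_ge0.
rewrite ED// leeD2l// /E.
under eq_integral do rewrite -sumEFin.
rewrite ge0_integral_sum// => [k|k w _]; first exact: (mpath l0 (m3 k)).
by rewrite lee_fin p3.
Qed.

End tilted_paths.

Lemma geometric_tail (R : realType) (r eps : R) : 0 <= r < 1 -> 0 < eps ->
  exists2 K, (0 < K)%N & forall n, \sum_(K <= k < n) r ^+ k <= eps.
Proof.
move=> /andP[r0 r1] e0.
have : geometric (1 - r)^-1 r @ \oo --> 0.
  by apply: cvg_geometric; rewrite ger0_norm.
move=> /cvgr0_norm_le /(_ _ e0)[K _ hK]; exists K.+1 => // n.
have := hK K.+1 (leqnSn K); rewrite /geometric /= => h.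
apply: le_trans (le_trans (ler_norm _) h).
have r1' : 0 < 1 - r by rewrite subr_gt0.
rewrite mulrC ler_pdivlMr//.
have [nK|Kn] := leqP n K.+1; first by rewrite big_geq// mul0r exprn_ge0.
have -> : (\sum_(K.+1 <= k < n) r ^+ k) * (1 - r) =
    \sum_(K.+1 <= k < n) ((fun i => - r ^+ i) k.+1 - (fun i => - r ^+ i) k).
  by rewrite mulr_suml; apply: eq_bigr => k _ /=; rewrite exprS; ring.
rewrite telescope_sumr ?(ltnW Kn)// opprK addrC gerBl.
exact: exprn_ge0.
Qed.

Section tame_mass.
Context {R : realType} {d : measure_display} {T : measurableType d}
  {d' : measure_display} {T' : measurableType d'}.
Variables (P : probability T R) (Q : probability T' R).
Variables (W : {RV Q >-> R}) (X : seq bool -> {RV P >-> R}).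
Hypotheses (W_ge0 : {ae Q, forall x, 0 <= W x})
  (W_mean : ('E_Q[W] = 1)%E)
  (W_llogl : ('E_Q[(fun x => W x * log2p (W x))%R] < +oo)%E)
  (W_entropy : ('E_Q[(fun x => W x * log2 (W x))%R] < 1)%E).
Hypothesis X_iid : iid_copies W X.

(** [rho] is chosen before [eps], on which only the starting generation [K] depends: the decay rate
    is kept when the truncation is refined. *)
Lemma tame_mass : exists rho : R, [/\ 2^-1 <= rho, rho < 1 &
  forall eps : R, 0 < eps -> exists2 K, (0 < K)%N &
  forall l, uniq l -> all (fun u => u != [::]) l ->
  ((1 - eps)%:E <= \int[P]_w
     (prodpos (path_factors X l w) * tame K rho (path_factors X l w))%:E)%E].
Proof.
have W1 := integral_pos W_ge0 W_mean.
have [kappa k0 ent] := entropy_gap W_ge0 W_llogl W_entropy.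
(* The second term gives [expR (- kappa) <= rho ^+ 4]. The first lets powers of [rho] dominate the
   powers of 1/2 that come from stationary phase and from the mesh of the net. *)
pose rho := Num.max (2^-1) (expR (- (kappa / 4))).
have rho0 : 0 <= rho by rewrite le_max invr_ge0 ler0n.
exists rho; split.
- by rewrite le_max lexx.
- by rewrite gt_max expR_lt1 oppr_lt0 divr_gt0// andbT; lra.
move=> eps e0; have e2 : 0 < eps / 2 by rewrite divr_gt0.
(* The maximal inequality divides this tail by [kappa], leaving [eps / 2]. *)
have [B B0 hB] := lnhi_tail W_ge0 W_llogl (mulr_gt0 e2 k0).
have [h h0 hh] := chernoff_factor W_ge0 W_mean W_llogl k0 B0 ent.
have [|K K0 hK] := @geometric_tail R (expR (- (h * kappa / 2))) (eps / 2) _ e2.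
  by rewrite expR_ge0 expR_lt1 oppr_lt0 divr_gt0// mulr_gt0.
exists K => // l ul l0.
have kr : expR (- kappa) <= rho ^+ 4.
  rewrite [- kappa](_ : _ = 4%:R * - (kappa / 4)); last by field.
  rewrite expRM_natl lerXn2r ?nnegrE ?expR_ge0//.
  by rewrite le_max lexx orbT.
have := mass_split X_iid W1 B (conj ul l0) k0 K0 rho0 kr.
set E1 := (X in (1 <= X + _ + _)%E); set E2 := (X in (1 <= _ + X + _)%E).
set E3 := (X in (1 <= _ + X)%E) => H.
have E2e : (E2 <= (eps / 2)%:E)%E.
  pose c := fine (\int[Q]_y (pos (W y) * lnhi B (W y))%:E)%E.
  have c0 : (0 <= \int[Q]_y (pos (W y) * lnhi B (W y))%:E)%E.
    by apply: integral_ge0 => y _; rewrite lee_fin mulr_ge0 ?pos_ge0 ?lnhi_ge0.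
  have cE : (\int[Q]_y (pos (W y) * lnhi B (W y))%:E = c%:E)%E.
    by rewrite fineK// ge0_fin_numE// (le_lt_trans hB)// ltry.
  apply: le_trans (maximal_ergodic X_iid W1 (@measurable_lnhi R B) (fun x => lnhi_ge0 x B0) k0 (fine_ge0 c0) cE (conj ul l0)) _.
  by rewrite lee_fin ler_pdivrMr// -lee_fin -cE.
have E3e : (E3 <= (eps / 2)%:E)%E.
  apply: le_trans (_ : (\sum_(K <= k < (size l).+1) (expR (- (h * kappa / 2)) ^+ k)%:E <= _)%E).
    rewrite /E3 big_nat [leRHS]big_nat; apply: lee_sum => k /andP[_ kl].
    exact: (chernoff_bound X_iid W1 (conj ul l0)).
  by rewrite sumEFin lee_fin.
have : (1%:E <= E1 + eps%:E)%E.
  apply: le_trans H _; rewrite -addeA leeD2l//.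
  by rewrite (le_trans (leeD E2e E3e))// -EFinD lee_fin -splitr.
by rewrite -leeBlDr// -EFinB.
Qed.
End tame_mass.

(** * Tame cascade *)

Fixpoint words (n : nat) : seq (seq bool) :=
  if n is n'.+1 then flatten [seq [:: rcons u false; rcons u true] | u <- words n']
  else [:: [::]].

Definition prefixes (u : seq bool) : seq (seq bool) :=
  [seq take k u | k <- iota 1 (size u)].

Section words.

Lemma mem_words n u : (u \in words n) = (size u == n).
Proof.
elim: n u => [|n IH] u /=; first by rewrite inE; case: u.
apply/flatten_mapP/idP => [[v vn]|].
  by rewrite !inE => /orP[] /eqP ->; rewrite size_rcons eqSS -IH.
case/lastP: u => // u b; rewrite size_rcons eqSS -IH => un.
by exists u => //; rewrite !inE; case: b; rewrite eqxx ?orbT.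
Qed.

Lemma size_words n : size (words n) = (2 ^ n)%N.
Proof.
elim: n => //= n IH; rewrite size_flatten /shape -map_comp /comp /=.
rewrite expnS -IH mulnC; elim: (words n) => //= u s ->.
by rewrite mulSn.
Qed.

Lemma big_words (R : Type) (idx : R) (op : Monoid.com_law idx) n (F : seq bool -> R) :
  \big[op/idx]_(v <- words n.+1) F v =
  \big[op/idx]_(u <- words n) op (F (rcons u false)) (F (rcons u true)).
Proof.
rewrite /= big_flatten /= big_map; apply: eq_bigr => u _.
by rewrite !big_cons big_nil Monoid.mulm1.
Qed.

Lemma uniq_words n : uniq (words n).
Proof.
elim: n => //= n IH; elim: (words n) IH => //= u s IH /andP[us /IH {}IH].
rewrite IH andbT !inE negb_or; apply/andP; split; last first.
  apply/flatten_mapP => -[v vs]; rewrite !inE => /orP[] /eqP /rcons_inj [uv] //.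
  by rewrite uv vs in us.
apply/andP; split; first by apply/eqP => /rcons_inj [].
apply/flatten_mapP => -[v vs]; rewrite !inE => /orP[] /eqP /rcons_inj [uv] //.
by rewrite uv vs in us.
Qed.

Lemma size_prefixes u : size (prefixes u) = size u.
Proof. by rewrite size_map size_iota. Qed.

Lemma prefixes_rcons u b : prefixes (rcons u b) = rcons (prefixes u) (rcons u b).
Proof.
rewrite /prefixes size_rcons -[(size u).+1]addn1 iotaD map_cat /= add1n cats1.
rewrite take_oversize ?size_rcons//; congr rcons.
apply/eq_in_map => k; rewrite mem_iota => /andP[_].
by rewrite add1n ltnS => ku; rewrite -cats1 takel_cat.
Qed.

Lemma prefixes_neq0 u : all (fun v => v != [::]) (prefixes u).
Proof.
by elim/last_ind: u => // u b IH; rewrite prefixes_rcons all_rcons IH andbT; case: u {IH}.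
Qed.

Lemma prefixes_size_le u v : v \in prefixes u -> (size v <= size u)%N.
Proof. by move=> /mapP[k _ ->]; rewrite size_take; case: ltnP => // /ltnW. Qed.

Lemma uniq_prefixes u : uniq (prefixes u).
Proof.
elim/last_ind: u => // u b IH; rewrite prefixes_rcons rcons_uniq IH andbT.
by apply/negP => /prefixes_size_le; rewrite size_rcons ltnn.
Qed.

End words.

Section tame_weights.
Context {R : realType}.
Variables (K : nat) (rho : R).
Implicit Types (x : seq bool -> R) (u : seq bool).

Definition weight x u : R := 2 ^- size u * prodpos (map x (prefixes u)).

Definition tame_weight x u : R :=
  2 ^- size u * (prodpos (map x (prefixes u)) * tame K rho (map x (prefixes u))).

(** The tame weight of a child with factor [a]. A word killed earlier has [p = 0], and otherwise [p]
    is the true weight of the parent, so the past enters through [p] alone. *)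
Definition tame_step (n : nat) (p a : R) : R :=
  p * pos a / 2 *
  ((K <= n.+1)%N ==> (p * pos a / 2 <= rho ^+ (4 * n.+1)))%R%:R.

Lemma tame01 s : tame K rho s = 0 \/ tame K rho s = 1.
Proof.
rewrite /tame; elim/big_ind: _ => [|a b [->|->] [->|->]|k _]; rewrite ?mulr0 ?mulr1 ?mul0r; auto.
by case: (_ <= _); auto.
Qed.

Lemma tame_rcons s a : tame K rho (rcons s a) = tame K rho s *
  ((K <= (size s).+1)%N ==>
    (prodpos s * pos a <= 2 ^+ (size s).+1 * rho ^+ (4 * (size s).+1)))%R%:R.
Proof.
have big_take n : (n <= (size s).+1)%N -> \prod_(K <= k < n)
    (prodpos (take k (rcons s a)) <= 2 ^+ k * rho ^+ (4 * k))%R%:R =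
  \prod_(K <= k < n) (prodpos (take k s) <= 2 ^+ k * rho ^+ (4 * k))%R%:R :> R.
  move=> ns; apply: eq_big_nat => k /andP[_ kn].
  rewrite -cats1 takel_cat//; by rewrite -ltnS (leq_trans kn).
rewrite /tame size_rcons.
case: leqP => Ks /=.
  rewrite big_nat_recr//= big_take// take_oversize ?size_rcons//.
  by rewrite -cats1 /prodpos big_cat /= big_seq1.
by rewrite !big_geq// ?mulr1// ltnW.
Qed.

Lemma tame_weight_rcons x u b :
  tame_weight x (rcons u b) = tame_step (size u) (tame_weight x u) (x (rcons u b)).
Proof.
rewrite /tame_weight /tame_step prefixes_rcons map_rcons tame_rcons size_rcons.
rewrite size_map size_prefixes; set s := map x _; set a := x _.
have -> : prodpos (rcons s a) = prodpos s * pos a.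
  by rewrite /prodpos -cats1 big_cat /= big_seq1.
have [->|->] := tame01 s; first by rewrite !(mulr0, mul0r).
have e : 2 ^- size u * (prodpos s * 1) * pos a / 2 =
    (prodpos s * pos a) / 2 ^+ (size u).+1.
  by rewrite exprS; field; rewrite expf_neq0.
rewrite e ler_pdivrMr ?exprn_gt0// [_ * 2 ^+ _]mulrC mul1r.
by rewrite mulrA; congr (_ * _); rewrite mulrC.
Qed.

Lemma tame_weight_nil x : (0 < K)%N -> tame_weight x [::] = 1.
Proof.
move=> K0; rewrite /tame_weight /prefixes /= expr0 invr1 mul1r /tame /=.
by rewrite big_geq// mulr1 /prodpos big_nil.
Qed.

Lemma tame_weight_ge0 x u : 0 <= tame_weight x u.
Proof.
by rewrite /tame_weight mulr_ge0 ?invr_ge0 ?exprn_ge0// mulr_ge0 ?prodpos_ge0 ?tame_ge0.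
Qed.

Lemma weight_ge0 x u : 0 <= weight x u.
Proof. by rewrite /weight mulr_ge0 ?invr_ge0 ?exprn_ge0// prodpos_ge0. Qed.

Lemma tame_weight_le x u : tame_weight x u <= weight x u.
Proof.
rewrite /tame_weight /weight ler_wpM2l ?invr_ge0 ?exprn_ge0//.
rewrite ler_piMr ?prodpos_ge0//.
by have [->|->] := tame01 (map x (prefixes u)).
Qed.

Lemma tame_step_ge0 n p a : 0 <= p -> 0 <= tame_step n p a.
Proof. by move=> p0; rewrite /tame_step !mulr_ge0 ?pos_ge0. Qed.

Lemma tame_step_le n p a : 0 <= p -> tame_step n p a <= p / 2 * pos a.
Proof.
move=> p0; rewrite /tame_step [p / 2 * _]mulrAC ler_piMr ?mulr_ge0 ?pos_ge0//.
by case: (_ ==> _).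
Qed.

Lemma tame_step_le_rho n p a : 0 <= p -> 0 <= rho -> (K <= n.+1)%N ->
  tame_step n p a <= rho ^+ (4 * n.+1).
Proof.
move=> p0 r0 Kn; rewrite /tame_step Kn /=.
by case: (boolP (p * pos a / 2 <= _)) => h; rewrite ?mulr1 // mulr0 exprn_ge0.
Qed.

Lemma tame_weight_indep x u v a : (size u < size v)%N ->
  tame_weight (upd x v a) u = tame_weight x u.
Proof.
move=> uv; rewrite /tame_weight.
suff -> : map (upd x v a) (prefixes u) = map x (prefixes u) by [].
apply/eq_in_map => w wu; rewrite /upd; case: eqP => // wv.
by have := leq_ltn_trans (prefixes_size_le wu) uv; rewrite wv ltnn.
Qed.

Lemma measurable_tame_step n d0 (S : measurableType d0) (f g : S -> R) :
  measurable_fun setT f -> measurable_fun setT g ->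
  measurable_fun setT (fun z => tame_step n (f z) (g z)).
Proof.
move=> mf mg.
have m : measurable_fun setT (fun z => f z * pos (g z) / 2).
  apply: measurable_funM => //; apply: measurable_funM => //.
  by apply: measurableT_comp => //; exact: measurable_pos.
rewrite /tame_step; apply: measurable_funM => //.
case: (K <= n.+1)%N => /=; last exact: measurable_cst.
apply: (eq_measurable_fun (fun z => if f z * pos (g z) / 2 <= rho ^+ (4 * n.+1) then 1 else 0 : R)).
  by move=> z _ /=; case: (_ <= _).
by apply: measurable_fun_ifT => //; exact: measurable_fun_ler.
Qed.

End tame_weights.

(** * Losses and exponential moments of the increments *)

Section martingale.
Context {R : realType} {d : measure_display} {T : measurableType d}
  {d' : measure_display} {T' : measurableType d'}.
Variables (P : probability T R) (Q : probability T' R).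
Variables (W : {RV Q >-> R}) (X : seq bool -> {RV P >-> R}).
Hypothesis X_iid : iid_copies W X.
Hypothesis W1 : (\int[Q]_y (pos (W y))%:E = 1)%E.
Variables (K : nat) (rho : R).
Hypotheses (K0 : (0 < K)%N) (rho2 : 2^-1 <= rho) (rho1 : rho < 1).

Let rho0 : 0 < rho. Proof. by rewrite (lt_le_trans _ rho2)// invr_gt0. Qed.

Let mW : measurable_fun setT W. Proof. exact: measurable_funP. Qed.

Local Notation tw := (tame_weight K rho).
Local Notation step := (tame_step K rho).

(** The conditional expectation of the tame weight of a child, as a function of the tame weight of
    its parent. *)
Definition step_mean (n : nat) (p : R) : R := fine (\int[Q]_y (step n p (W y))%:E)%E.

Let mstep n p : measurable_fun setT (fun y => step n p (W y)).
Proof. exact: measurable_tame_step. Qed.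

Let int_half_pos p : 0 <= p -> (\int[Q]_y (p / 2 * pos (W y))%:E = (p / 2)%:E)%E.
Proof.
move=> p0; under eq_integral do rewrite EFinM.
rewrite ge0_integralZl_EFin// ?W1 ?mule1//.
- by move=> y _; rewrite lee_fin pos_ge0.
- by apply/measurable_EFinP; apply: measurableT_comp => //; exact: measurable_pos.
- by rewrite divr_ge0.
Qed.

Lemma step_meanE n p : 0 <= p ->
  (\int[Q]_y (step n p (W y))%:E = (step_mean n p)%:E)%E.
Proof.
move=> p0; rewrite fineK// ge0_fin_numE; last first.
  by apply: integral_ge0 => y _; rewrite lee_fin tame_step_ge0.
apply: (@le_lt_trans _ _ (\int[Q]_y (p / 2 * pos (W y))%:E)%E); last first.
  by rewrite int_half_pos// ltry.
apply: ge0_le_integral => //.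
- by move=> y _; rewrite lee_fin tame_step_ge0.
- exact/measurable_EFinP.
- apply/measurable_EFinP; apply: measurable_funM => //.
  by apply: measurableT_comp => //; exact: measurable_pos.
- by move=> y _; rewrite lee_fin tame_step_le.
Qed.

Lemma step_mean_ge0 n p : 0 <= p -> 0 <= step_mean n p.
Proof.
move=> p0; apply: fine_ge0; apply: integral_ge0 => y _.
by rewrite lee_fin tame_step_ge0.
Qed.

Lemma step_mean_le n p : 0 <= p -> step_mean n p <= p / 2.
Proof.
move=> p0; rewrite -lee_fin -step_meanE// -int_half_pos//.
apply: ge0_le_integral => //.
- by move=> y _; rewrite lee_fin tame_step_ge0.
- exact/measurable_EFinP.
- apply/measurable_EFinP; apply: measurable_funM => //.
  by apply: measurableT_comp => //; exact: measurable_pos.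
- by move=> y _; rewrite lee_fin tame_step_le.
Qed.

Lemma step_mean_le_rho n p : 0 <= p -> (K <= n.+1)%N ->
  step_mean n p <= rho ^+ (4 * n.+1).
Proof.
move=> p0 Kn; rewrite -lee_fin -step_meanE//.
apply: (@le_trans _ _ (\int[Q]_y (rho ^+ (4 * n.+1))%:E)%E).
  apply: ge0_le_integral => //.
  - by move=> y _; rewrite lee_fin tame_step_ge0.
  - exact/measurable_EFinP.
  - by move=> y _; rewrite lee_fin tame_step_le_rho// ltW.
by rewrite integral_cst//= probability_setT mule1.
Qed.

Let ibnd (f : T' -> R) (b : R) : measurable_fun setT f ->
  (forall y, 0 <= f y <= b) -> Q.-integrable setT (EFin \o f).
Proof.
move=> mf fb; apply: (@le_integrable _ _ _ Q setT measurableT _ (EFin \o cst b)).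
- exact/measurable_EFinP.
- move=> y _ /=; rewrite lee_fin; have /andP[h1 h2] := fb y.
  by rewrite !ger0_norm// (le_trans h1).
- exact: finite_measure_integrable_cst.
Qed.

(** Each parent has two children, so the compensators [p / 2] add up over a generation to
    [tame_total]. The parameter is such that its square times the bound [rho ^+ (4 * n.+1)] on a
    step is 1/4. *)
Definition tilt (n : nat) (p c a : R) : R :=
  expR (rho ^- (2 * n.+1) / 2 * ((step n p a - step_mean n p) * c) - p / 2).

Let measurable_tilt n p c : measurable_fun setT (fun y => tilt n p c (W y)).
Proof.
apply: (measurableT_comp (@measurable_expR R)); apply: measurable_funB => //.
by do 2 apply: measurable_funM => //; exact: measurable_funB.
Qed.

(* [expR x <= 1 + x + 2 x^2] for [x <= 1/2]; the linear term is centred and the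
   quadratic one is at most [p / 2] because the increments are at most
   [rho^(4 (n+1))]. *)
Lemma tilt_le1 n p c : (K <= n.+1)%N -> 0 <= p -> `|c| <= 1 ->
  (\int[Q]_y (tilt n p c (W y))%:E <= 1)%E.
Proof.
move=> Kn p0 c1; set m := step_mean n p.
pose lam := rho ^- (2 * n.+1) / 2; pose b := rho ^+ (4 * n.+1).
have lam0 : 0 < lam by rewrite divr_gt0// invr_gt0 exprn_gt0.
have b0 : 0 < b by rewrite exprn_gt0.
have r2 : 0 < rho ^+ (2 * n.+1) by rewrite exprn_gt0.
have r21 : rho ^+ (2 * n.+1) <= 1 by rewrite exprn_ile1 ?ltW.
have bE : b = rho ^+ (2 * n.+1) ^+ 2 by rewrite -exprM mulnC mulnA.
have lb : lam * b <= 2^-1.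
  rewrite bE /lam (_ : _ * _ = rho ^+ (2 * n.+1) / 2).
    by rewrite ler_pdivrMr// mulVf.
  by field; rewrite gt_eqF.
have l2b : lam ^+ 2 * b = 4^-1.
  by rewrite bE /lam; field; rewrite gt_eqF.
have m0 : 0 <= m by exact: step_mean_ge0.
have mb : m <= b by exact: step_mean_le_rho.
have mp : m <= p / 2 by exact: step_mean_le.
have s0 y : 0 <= step n p (W y) by exact: tame_step_ge0.
have sb y : step n p (W y) <= b by rewrite tame_step_le_rho// ltW.
pose u := 1 - lam * m * c + 2 * lam ^+ 2 * b * m.
pose v := lam * c + 2 * lam ^+ 2 * b.
have cc : -1 <= c <= 1 by rewrite -ler_norml.
have pw y : tilt n p c (W y) <= expR (- (p / 2)) * (u + v * step n p (W y)).
  rewrite /tilt -/lam -/m addrC expRD ler_wpM2l ?expR_ge0//.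
  set s := step n p (W y); have := s0 y; have := sb y; rewrite -/s => h1 h2.
  have sm : `|s - m| <= b by rewrite ler_norml; apply/andP; split; lra.
  have smc : `|(s - m) * c| <= b.
    by rewrite normrM (le_trans _ sm)// ler_piMr.
  apply: (le_trans (expR_le_quadratic _)).
    rewrite (le_trans _ lb)// ler_pM2l//.
    by rewrite (le_trans (ler_norm _)).
  (* The square is bounded by an expression linear in [s], whose mean is [2 * b * m <= b * p]. *)
  have q : ((s - m) * c) ^+ 2 <= b * (s + m).
    rewrite exprMn (@le_trans _ _ ((s - m) ^+ 2))//.
      by rewrite ler_piMr ?sqr_ge0// -real_normK ?num_real// expr_le1.
    apply: (@le_trans _ _ (s * b + m * b)); last by rewrite -mulrDl mulrC.
    apply: (@le_trans _ _ (s * s + m * m)); last by rewrite lerD// ler_wpM2l.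
    rewrite -subr_ge0; have -> : s * s + m * m - (s - m) ^+ 2 = 2 * (s * m) by ring.
    by rewrite mulr_ge0// mulr_ge0.
  have q' : 2 * lam ^+ 2 * ((s - m) * c) ^+ 2 <= 2 * lam ^+ 2 * (b * (s + m)).
    by rewrite ler_wpM2l// mulr_ge0 ?sqr_ge0.
  rewrite exprMn /u /v.
  have -> : 1 - lam * m * c + 2 * lam ^+ 2 * b * m + (lam * c + 2 * lam ^+ 2 * b) * s =
    1 + lam * ((s - m) * c) + 2 * lam ^+ 2 * (b * (s + m)) by ring.
  by rewrite lerD2l mulrA.
have ist : Q.-integrable setT (EFin \o (fun y => step n p (W y))).
  by apply: (ibnd (b := b)) => // y; rewrite s0 sb.
have iv : Q.-integrable setT (fun y => v%:E * (step n p (W y))%:E)%E.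
  exact: integrableZl ist.
have iu : Q.-integrable setT (fun _ : T' => u%:E) by exact: finite_measure_integrable_cst.
have iuv : Q.-integrable setT (fun y => u%:E + v%:E * (step n p (W y))%:E)%E.
  exact: integrableD.
have ie : Q.-integrable setT (fun y => (expR (- (p / 2)))%:E * (u%:E + v%:E * (step n p (W y))%:E))%E.
  exact: integrableZl.
apply: (@le_trans _ _ (\int[Q]_y ((expR (- (p / 2)))%:E *
    (u%:E + v%:E * (step n p (W y))%:E)))%E).
  apply: ge0_le_integral => //.
  - by move=> y _; rewrite lee_fin expR_ge0.
  - by apply/measurable_EFinP; exact: measurable_tilt.
  - exact: measurable_int ie.
  - by move=> y _; have := pw y; rewrite -lee_fin EFinM EFinD EFinM.
rewrite integralZl// integralD// integral_cst//= probability_setT mule1.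
have -> : (\int[Q]_y (v%:E * (step n p (W y))%:E) = v%:E * \int[Q]_y (step n p (W y))%:E)%E.
  exact: (integralZl measurableT ist).
rewrite step_meanE// -/m -(EFinM v) -(EFinD u) -EFinM lee_fin.
have -> : u + v * m = 1 + 4 * (lam ^+ 2 * b) * m by rewrite /u /v; ring.
rewrite l2b expRN mulrC ler_pdivrMr ?expR_gt0// mul1r.
by rewrite (le_trans _ (expR_ge1Dx _))// lerD2l mulfV// mul1r.
Qed.

Lemma measurable_step_mean n d0 (S : measurableType d0) (f : S -> R) :
  (forall z, 0 <= f z) -> measurable_fun setT f ->
  measurable_fun setT (fun z => step_mean n (f z)).
Proof.
move=> f0 mf.
pose h (z : S * T') : \bar R := (step n (f z.1) (W z.2))%:E.
have mh : measurable_fun setT h.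
  apply/measurable_EFinP; apply: measurable_tame_step.
    by apply: measurableT_comp => //; exact: measurable_fst.
  by apply: measurableT_comp => //; exact: measurable_snd.
have h0 z : (0 <= h z)%E by rewrite lee_fin tame_step_ge0.
have mF := measurable_fun_fubini_tonelli_F (m2 := Q) h mh h0.
exact: (measurableT_comp (fine_measurable measurableT) mF).
Qed.

Lemma mfunctional_tame_weight u : mfunctional (fun x => (tw x u)%:E).
Proof.
have m : mseqR (fun s => 2 ^- size u * (prodpos s * tame K rho s)).
  apply: mseqR_mul; first exact: mseqR_cst.
  by apply: mseqR_mul; [exact: mseqR_prodpos|exact: mseqR_tame].
exact: (mfunctional_map (prefixes_neq0 u) (mseqR_mseq m)).
Qed.

Let mtwY d0 (S : measurableType d0) (Y : S -> seq bool -> R) u :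
  (forall u, u != [::] -> measurable_fun [set: S] (Y ^~ u)) ->
  measurable_fun setT (fun z => tw (Y z) u).
Proof. by move=> mY; apply/measurable_EFinP; exact: mfunctional_tame_weight. Qed.

Lemma measurable_tame_weight u : measurable_fun setT (fun w => tw (X ^~ w) u).
Proof. by apply: (mtwY (Y := fun w v => X v w)) => v _; exact: measurable_funP. Qed.

Definition tame_total (x : seq bool -> R) n : R := \sum_(u <- words n) tw x u.

Definition tame_sum (x : seq bool -> R) n (c : seq bool -> R) : R :=
  \sum_(u <- words n) tw x u * c u.

Definition increment (x : seq bool -> R) n (c : seq bool -> R) : R :=
  \sum_(v <- words n.+1) (tw x v - step_mean n (tw x (take n v))) * c v.

(* Each word has two children, so this is the mean tame mass that disappears
   from generation [n] to generation [n.+1]. *)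
Definition loss (x : seq bool -> R) n : R :=
  \sum_(u <- words n) (tw x u - 2 * step_mean n (tw x u)).

Lemma loss_ge0 x n : 0 <= loss x n.
Proof.
apply: sumr_ge0 => u _; have := step_mean_le n (tame_weight_ge0 K rho x u); lra.
Qed.

Lemma tame_total_ge0 x n : 0 <= tame_total x n.
Proof. by apply: sumr_ge0 => u _; exact: tame_weight_ge0. Qed.

(** Without killing, [step_mean n p] would be [p / 2] and, as [c] averages over children, the
    increment would be the whole change. The drift caused by killing is [step_mean n p - p / 2]
    times a sum of two values of [c], so it is at most the word's share of [loss]. *)
Lemma tame_sum_step x n c : (forall u, `|c u| <= 1) ->
  (forall u, c u = (c (rcons u false) + c (rcons u true)) / 2) ->
  `|tame_sum x n.+1 c - tame_sum x n c - increment x n c| <= loss x n.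
Proof.
move=> c1 cm.
have -> : tame_sum x n.+1 c - tame_sum x n c - increment x n c =
    \sum_(u <- words n) (step_mean n (tw x u) - tw x u / 2) *
      (c (rcons u false) + c (rcons u true)).
  rewrite /tame_sum /increment !big_words addrAC -sumrB -sumrB !big_seq.
  apply: eq_bigr => u; rewrite mem_words => /eqP un.
  by rewrite -!cats1 -un !take_size_cat// !cats1 [c u]cm /=; field.
apply: (le_trans (ler_norm_sum _ _ _)); rewrite /loss; apply: ler_sum => u _.
have h := step_mean_le n (tame_weight_ge0 K rho x u).
rewrite normrM ler0_norm; last by rewrite subr_le0.
have -> : tw x u - 2 * step_mean n (tw x u) =
  - (step_mean n (tw x u) - tw x u / 2) * 2 by field.
rewrite ler_wpM2l ?oppr_ge0 ?subr_le0//.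
by rewrite (le_trans (ler_normD _ _))// [leRHS](_ : _ = 1 + 1) ?lerD//; ring.
Qed.

Let mX u : measurable_fun setT (X u). Proof. exact: measurable_funP. Qed.

Lemma integral_tame_weight n v : size v = n.+1 ->
  (\int[P]_w (tw (X ^~ w) v)%:E =
   \int[P]_w (step_mean n (tw (X ^~ w) (take n v)))%:E)%E.
Proof.
move=> sv; have v0 : v != [::] by rewrite -size_eq0 sv.
rewrite (integral_resample X_iid v0 (@mfunctional_tame_weight v)); last first.
  by move=> x; rewrite lee_fin tame_weight_ge0.
apply: eq_integral => w _; rewrite -step_meanE ?tame_weight_ge0//.
apply: eq_integral => y _; congr EFin.
case/lastP: v sv v0 => // u b; rewrite size_rcons => -[un] _.
rewrite tame_weight_rcons tame_weight_indep ?size_rcons// un.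
by rewrite /upd eqxx -cats1 -un take_size_cat.
Qed.

Let E_total n : (\int[P]_w (tame_total (X ^~ w) n)%:E)%E =
  (\sum_(u <- words n) \int[P]_w (tw (X ^~ w) u)%:E)%E.
Proof.
rewrite /tame_total; under eq_integral do rewrite -sumEFin.
rewrite ge0_integral_sum// => [u|u w _].
  by apply/measurable_EFinP; exact: measurable_tame_weight.
by rewrite lee_fin tame_weight_ge0.
Qed.

Lemma measurable_tame_total n : measurable_fun setT (fun w => tame_total (X ^~ w) n).
Proof. by apply: measurable_sum => u; exact: measurable_tame_weight. Qed.

Let mstep_tw n u : measurable_fun setT (fun w => step_mean n (tw (X ^~ w) u)).
Proof.
apply: measurable_step_mean; last exact: measurable_tame_weight.
by move=> w; exact: tame_weight_ge0.
Qed.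

Lemma measurable_loss n : measurable_fun setT (fun w => loss (X ^~ w) n).
Proof.
apply: measurable_sum => u; apply: measurable_funB; first exact: measurable_tame_weight.
by apply: measurable_funM => //; exact: mstep_tw.
Qed.

Lemma integral_total_loss n :
  (\int[P]_w (tame_total (X ^~ w) n.+1)%:E + \int[P]_w (loss (X ^~ w) n)%:E =
   \int[P]_w (tame_total (X ^~ w) n)%:E)%E.
Proof.
have -> : (\int[P]_w (tame_total (X ^~ w) n.+1)%:E =
    \int[P]_w (\sum_(u <- words n) 2 * step_mean n (tw (X ^~ w) u))%:E)%E.
  rewrite E_total big_words; under [RHS]eq_integral do rewrite -sumEFin.
  rewrite [RHS]ge0_integral_sum//; last 2 first.
  - by move=> u; apply/measurable_EFinP; apply: measurable_funM => //; exact: mstep_tw.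
  - by move=> u w _; rewrite lee_fin mulr_ge0// step_mean_ge0// tame_weight_ge0.
  rewrite big_seq [RHS]big_seq; apply: eq_bigr => u; rewrite mem_words => /eqP un.
  rewrite /= !(@integral_tame_weight n) ?size_rcons ?un//.
  rewrite -!cats1 -un !take_size_cat// un -ge0_integralD//; last 4 first.
  - by move=> w _; rewrite lee_fin step_mean_ge0// tame_weight_ge0.
  - by apply/measurable_EFinP; exact: mstep_tw.
  - by move=> w _; rewrite lee_fin step_mean_ge0// tame_weight_ge0.
  - by apply/measurable_EFinP; exact: mstep_tw.
  apply: eq_integral => w _; rewrite -EFinD; congr EFin; ring.
rewrite -ge0_integralD//; last 4 first.
- move=> w _; rewrite lee_fin sumr_ge0// => u _.
  by rewrite mulr_ge0// step_mean_ge0// tame_weight_ge0.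
- apply/measurable_EFinP; apply: measurable_sum => u.
  by apply: measurable_funM => //; exact: mstep_tw.
- by move=> w _; rewrite lee_fin loss_ge0.
- by apply/measurable_EFinP; exact: measurable_loss.
apply: eq_integral => w _; rewrite -EFinD /loss /tame_total -big_split /=; congr EFin.
by apply: eq_bigr => u _; rewrite addrC subrK.
Qed.

Lemma integral_total0 : (\int[P]_w (tame_total (X ^~ w) 0)%:E = 1)%E.
Proof.
transitivity (\int[P]_w (cst 1%E w))%E.
  by apply: eq_integral => w _; rewrite /tame_total big_seq1 tame_weight_nil.
by rewrite integral_cst//= probability_setT mule1.
Qed.

(** The expected losses telescope. A lower bound [1 - eps] on the surviving mass at every generation
    therefore bounds all of them together by [eps]. *)
Lemma sum_loss_total n :
  (\sum_(i < n) \int[P]_w (loss (X ^~ w) i)%:E +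
   \int[P]_w (tame_total (X ^~ w) n)%:E = 1)%E.
Proof.
elim: n => [|n IH]; first by rewrite big_ord0 add0e integral_total0.
by rewrite big_ord_recr /= -[RHS]IH -(integral_total_loss n) -addeA; congr (_ + _)%E; exact: addeC.
Qed.

(** Induction on the list, resampling the factor of one child [v]. The other tilts involve only tame
    weights of generation [n] and factors of other words, so they come out of the inner integral,
    which [tilt_le1] bounds by 1. *)
Lemma integral_tilt_le1 n (c : seq bool -> R) (l : seq (seq bool)) :
  (K <= n.+1)%N -> (forall u, `|c u| <= 1) -> uniq l ->
  (forall v, v \in l -> size v = n.+1) ->
  (\int[P]_w (\prod_(v <- l)
     tilt n (tw (X ^~ w) (take n v)) (c v) (X v w))%:E <= 1)%E.
Proof.
move=> Kn c1; elim: l => [|v l IH] /=.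
  move=> _ _; under eq_integral do rewrite big_nil.
  by rewrite integral_cst//= probability_setT mule1.
move=> /andP[vl ul] sl.
have sv : size v = n.+1 by apply: sl; rewrite inE eqxx.
have v0 : v != [::] by rewrite -size_eq0 sv.
have slt u : u \in l -> size u = n.+1 by move=> ul'; apply: sl; rewrite inE ul' orbT.
pose G x u : R := tilt n (tw x (take n u)) (c u) (x u).
have G0 x u : 0 <= G x u by exact: expR_ge0.
have mG d0 (S : measurableType d0) (Y : S -> seq bool -> R) u : u != [::] ->
    (forall u, u != [::] -> measurable_fun [set: S] (Y ^~ u)) ->
    measurable_fun setT (fun z => G (Y z) u).
  move=> u0 mY; have mt := mtwY (take n u) mY.
  apply: measurableT_comp => //; apply: measurable_funB; last exact: measurable_funM.
  apply: measurable_funM => //; apply: measurable_funM => //; apply: measurable_funB.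
    by apply: measurable_tame_step => //; exact: mY.
  by apply: measurable_step_mean => // z; exact: tame_weight_ge0.
have mprod d0 (S : measurableType d0) (Y : S -> seq bool -> R) s :
    {subset s <= v :: l} ->
    (forall u, u != [::] -> measurable_fun [set: S] (Y ^~ u)) ->
    measurable_fun setT (fun z => \prod_(u <- s) G (Y z) u).
  move=> sub mY.
  (* The value 1 at the empty word makes every factor measurable; all words in [s] have length
     [n.+1], so the product is unchanged. *)
  rewrite (_ : (fun z => _) = (fun z => \prod_(u <- s) if u == [::] then 1 else G (Y z) u)).
    apply: measurable_prod => u _.
    case: (boolP (u == [::])) => u0; first exact: measurable_cst.
    exact: mG.
  apply/funext => z; apply: eq_big_seq => u us; case: eqVneq => // u0.
  by have := sl u (sub _ us); rewrite u0.
pose F x : \bar R := (\prod_(u <- v :: l) G x u)%:E.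
have mF : mfunctional F.
  by move=> d0 S Y mY; apply/measurable_EFinP; exact: mprod.
have F0 x : (0 <= F x)%E by rewrite lee_fin prodr_ge0.
rewrite (integral_resample X_iid v0 mF F0).
apply: le_trans (IH ul slt).
have mrest : measurable_fun setT (fun w => \prod_(u <- l) G (X ^~ w) u).
  by apply: (mprod _ _ (fun w u => X u w)) => [u us|u _]; [rewrite inE us orbT|exact: mX].
have Fupd w y : F (upd (X ^~ w) v (W y)) = ((\prod_(u <- l) G (X ^~ w) u)%:E *
    (tilt n (tw (X ^~ w) (take n v)) (c v) (W y))%:E)%E.
  rewrite /F big_cons -EFinM mulrC; congr EFin; congr (_ * _); last first.
    rewrite /G tame_weight_indep; last by rewrite size_take sv ltnSn.
    by rewrite /upd eqxx.
  apply: eq_big_seq => u us; rewrite /G tame_weight_indep; last first.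
    by rewrite size_take slt// ltnSn sv.
  by rewrite /upd; case: eqP => // uv; rewrite -uv us in vl.
have Fint w : (\int[Q]_y F (upd (X ^~ w) v (W y)) <= (\prod_(u <- l) G (X ^~ w) u)%:E)%E.
  under eq_integral do rewrite Fupd.
  rewrite ge0_integralZl_EFin//; last 3 first.
  - by move=> y _; rewrite lee_fin expR_ge0.
  - by apply/measurable_EFinP; exact: measurable_tilt.
  - exact: prodr_ge0.
  rewrite -[leRHS]mule1 lee_wpmul2l ?lee_fin ?prodr_ge0//.
  by apply: tilt_le1 => //; exact: tame_weight_ge0.
apply: ge0_le_integral => //.
- by move=> w _; apply: integral_ge0.
- pose Y (z : T * T') := upd (X ^~ z.1) v (W z.2).
  have mY u : u != [::] -> measurable_fun setT (Y ^~ u).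
    move=> _; rewrite /Y /upd; case: eqP => _.
      by apply: measurableT_comp => //; exact: measurable_snd.
    by apply: measurableT_comp => //; exact: measurable_fst.
  exact: (measurable_fun_fubini_tonelli_F (m2 := Q) _ (mF _ _ Y mY) (fun=> F0 _)).
- by apply/measurable_EFinP.
Qed.

Lemma integral_exp_increment n (c : seq bool -> R) :
  (K <= n.+1)%N -> (forall u, `|c u| <= 1) ->
  (\int[P]_w (expR (rho ^- (2 * n.+1) / 2 * increment (X ^~ w) n c -
     tame_total (X ^~ w) n))%:E <= 1)%E.
Proof.
move=> Kn c1.
have := integral_tilt_le1 Kn c1 (uniq_words n.+1).
have h v : v \in words n.+1 -> size v = n.+1 by rewrite mem_words => /eqP.
move=> /(_ h); apply: le_trans; rewrite le_eqVlt; apply/orP; left; apply/eqP.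
apply: eq_integral => w _; congr EFin; rewrite /tilt -expR_sum; congr expR.
rewrite sumrB; congr (_ - _).
  rewrite /increment mulr_sumr big_words [RHS]big_words big_seq [RHS]big_seq.
  apply: eq_bigr => u; rewrite mem_words => /eqP un.
  by rewrite !tame_weight_rcons -!cats1 -un !take_size_cat.
rewrite big_words /tame_total big_seq [RHS]big_seq.
apply: eq_bigr => u; rewrite mem_words => /eqP un.
by rewrite -!cats1 -un !take_size_cat//=; field.
Qed.

Lemma measurable_increment n c : measurable_fun setT (fun w => increment (X ^~ w) n c).
Proof.
apply: measurable_sum => v; apply: measurable_funM => //.
apply: measurable_funB; first exact: measurable_tame_weight.
exact: mstep_tw.
Qed.

End martingale.

(** * Almost sure estimates *)

Section fatou_frequently.
Local Open Scope ereal_scope.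
Context {R : realType} {d : measure_display} {T : measurableType d}.
Variable P : {measure set T -> \bar R}.

Lemma limn_einf_ltP (u : (\bar R)^nat) (a : \bar R) : limn_einf u < a ->
  forall N, exists2 n, (N <= n)%N & u n < a.
Proof.
move=> ua N; apply: contrapT => h; move: ua; rewrite ltNge => /negP; apply.
have au n : (N <= n)%N -> a <= u n.
  by move=> Nn; rewrite leNgt; apply/negP => ?; apply: h; exists n.
rewrite limn_einf_lim; apply: lime_ge; first exact: is_cvg_einfs.
near=> n; apply: le_ereal_inf_tmp => _ [k /= nk <-]; apply: au.
by rewrite (leq_trans _ nk)//; near: n; exact: nbhs_infty_ge.
Unshelve. all: by end_near. Qed.

(** [F] is the lower limit. It gives smallness at infinitely many indices only, which will do for
    the mass gap because the weighted sums are known to converge. *)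
Lemma fatou_frequently (f : nat -> T -> \bar R) (e : nat -> \bar R) (e0 : \bar R) :
  (forall n, measurable_fun setT (f n)) -> (forall n w, 0 <= f n w) ->
  (forall n, \int[P]_w f n w <= e n) -> e @ \oo --> e0 ->
  exists F : T -> \bar R, [/\ measurable_fun setT F, (forall w, 0 <= F w),
    \int[P]_w F w <= e0 &
    forall w a, F w < a -> forall N, exists2 n, (N <= n)%N & f n w < a].
Proof.
move=> mf f0 fe ee; exists (fun w => limn_einf (f ^~ w)); split.
- under eq_fun do rewrite limn_einf_lim.
  apply: (emeasurable_fun_cvg (fun n w => einfs (f ^~ w) n)).
    by move=> n; apply: measurable_fun_einfs.
  by move=> w _; exact: is_cvg_einfs.
- move=> w; rewrite limn_einf_lim; apply: lime_ge; first exact: is_cvg_einfs.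
  by near=> n; apply: le_ereal_inf_tmp => _ [k /= _ <-].
- apply: le_trans (fatou P measurableT mf (fun n w _ => f0 n w)) _.
  rewrite limn_einf_lim (_ : e0 = limn (einfs e)); last first.
    by apply/esym/cvg_lim => //; exact: cvg_einfs.
  apply: lee_lim; [exact: is_cvg_einfs|exact: is_cvg_einfs|].
  near=> n; apply: le_ereal_inf_tmp => _ [k /= nk <-].
  by apply: (le_trans _ (fe k)); apply: ereal_inf_lbound; exists k.
- by move=> w a; exact: limn_einf_ltP.
Unshelve. all: by end_near. Qed.

Lemma ae_small_of_integral_to0 (f : nat -> T -> \bar R) (e : nat -> \bar R) :
  (forall n, measurable_fun setT (f n)) -> (forall n w, 0 <= f n w) ->
  (forall n, \int[P]_w f n w <= e n) -> e @ \oo --> 0 ->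
  {ae P, forall w, forall a, 0 < a -> exists n, f n w < a}.
Proof.
move=> mf f0 fe ee; have [F [mF F0 Fe Fl]] := fatou_frequently mf f0 fe ee.
have : ae_eq P setT F (cst 0).
  apply/(ae_eq_integral_abs _ measurableT mF).
  under eq_integral do rewrite gee0_abs//.
  by apply/eqP; rewrite eq_le Fe integral_ge0.
apply: filterS => w /(_ I) Fw a a0.
have [|n _ h] := Fl w a _ 0%N; first by rewrite Fw.
by exists n.
Qed.

Lemma ae_bounded_series (f : nat -> T -> \bar R) (e : \bar R) :
  (forall n, measurable_fun setT (f n)) -> (forall n w, 0 <= f n w) ->
  (forall n, \sum_(i < n) \int[P]_w f i w <= e) ->
  \int[P]_w (\sum_(i <oo) f i w) <= e.
Proof.
move=> mf f0 fe; rewrite integral_nneseries//.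
apply: lime_le; first by apply: is_cvg_nneseries => n _ _; exact: integral_ge0.
by apply: nearW => n; rewrite big_mkord.
Qed.

End fatou_frequently.

(** * Simultaneous almost sure control of losses, mass gap and increments *)

Section good_event.
Context {R : realType} {d : measure_display} {T : measurableType d}
  {d' : measure_display} {T' : measurableType d'}.
Variables (P : probability T R) (Q : probability T' R).
Variables (W : {RV Q >-> R}) (X : seq bool -> {RV P >-> R}).
Hypothesis X_iid : iid_copies W X.
Hypothesis W1 : (\int[Q]_y (pos (W y))%:E = 1)%E.

Definition cascade_mass (x : seq bool -> R) n : R := \sum_(u <- words n) weight x u.

Lemma measurable_weight u : measurable_fun setT (fun w => weight (X ^~ w) u).
Proof.
have m : mseqR (fun s => 2 ^- size u * prodpos s : R).
  by apply: mseqR_mul; [exact: mseqR_cst|exact: mseqR_prodpos].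
have := mfunctional_map (prefixes_neq0 u) (mseqR_mseq m).
move=> /(_ _ _ (fun w v => X v w)) h; apply/measurable_EFinP; apply: h.
by move=> v _; exact: measurable_funP.
Qed.

Lemma measurable_cascade_mass n : measurable_fun setT (fun w => cascade_mass (X ^~ w) n).
Proof. by apply: measurable_sum => u; exact: measurable_weight. Qed.

Lemma integral_cascade_mass n : (\int[P]_w (cascade_mass (X ^~ w) n)%:E = 1)%E.
Proof.
rewrite /cascade_mass; under eq_integral do rewrite -sumEFin.
rewrite ge0_integral_sum//; last 2 first.
- by move=> u; apply/measurable_EFinP; exact: measurable_weight.
- by move=> u w _; rewrite lee_fin weight_ge0.
transitivity (\sum_(u <- words n) (2 ^- n : R)%:E)%E.
  rewrite big_seq [RHS]big_seq; apply: eq_bigr => u; rewrite mem_words => /eqP un.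
  rewrite /weight un; under eq_integral do rewrite EFinM.
  rewrite ge0_integralZl_EFin//; last 2 first.
  - by move=> w _; rewrite lee_fin prodpos_ge0.
  - have := mfunctional_map (prefixes_neq0 u) (mseqR_mseq (@mseqR_prodpos R)).
    move=> /(_ _ _ (fun w v => X v w)) h; apply: h.
    by move=> v _; exact: measurable_funP.
  rewrite (_ : (\int[P]_w _)%E = 1%E) ?mule1//.
  exact: (integral_prodpos X_iid W1 (conj (uniq_prefixes u) (prefixes_neq0 u))).
rewrite sumEFin big_const_seq count_predT iter_addr_0 size_words.
rewrite (_ : 2 ^- n *+ (2 ^ n)%N = 1 :> R)//.
by rewrite -[LHS]mulr_natl natrX divff ?expf_neq0.
Qed.

Lemma tame_total_le_mass K rho x n : tame_total K rho x n <= cascade_mass x n.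
Proof. by apply: ler_sum => u _; exact: tame_weight_le. Qed.

Section one_truncation.
Variables (K : nat) (rho eps : R).
Hypotheses (K0 : (0 < K)%N) (rho2 : 2^-1 <= rho) (rho1 : rho < 1).
Hypothesis mass : forall l, uniq l -> all (fun u => u != [::]) l ->
  ((1 - eps)%:E <= \int[P]_w
     (prodpos (path_factors X l w) * tame K rho (path_factors X l w))%:E)%E.

Lemma integral_tame_total_ge n :
  ((1 - eps)%:E <= \int[P]_w (tame_total K rho (X ^~ w) n)%:E)%E.
Proof.
rewrite /tame_total; under eq_integral do rewrite -sumEFin.
rewrite ge0_integral_sum//; last 2 first.
- by move=> u; apply/measurable_EFinP; exact: measurable_tame_weight.
- by move=> u w _; rewrite lee_fin tame_weight_ge0.
apply: (@le_trans _ _ (\sum_(u <- words n) (2 ^- n * (1 - eps))%:E)%E).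
  rewrite sumEFin big_const_seq count_predT iter_addr_0 size_words.
  rewrite (_ : _ *+ _ = 1 - eps)//.
  by rewrite -[LHS]mulr_natl natrX mulrA divff ?expf_neq0// mul1r.
rewrite big_seq [leRHS]big_seq; apply: lee_sum => u; rewrite mem_words => /eqP un.
rewrite /tame_weight un; under eq_integral do rewrite EFinM.
rewrite ge0_integralZl_EFin//; last 2 first.
- by move=> w _; rewrite lee_fin mulr_ge0 ?prodpos_ge0 ?tame_ge0.
- have m := mseqR_mul (@mseqR_prodpos R) (mseqR_tame K rho).
  have := mfunctional_map (prefixes_neq0 u) (mseqR_mseq m).
  move=> /(_ _ _ (fun w v => X v w)) h; apply: h.
  by move=> v _; exact: measurable_funP.
rewrite EFinM lee_wpmul2l ?lee_fin ?invr_ge0 ?exprn_ge0//.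
exact: (mass (uniq_prefixes u) (prefixes_neq0 u)).
Qed.

Lemma integral_loss_le :
  (\int[P]_w (\sum_(i <oo) (loss W K rho (X ^~ w) i)%:E) <= eps%:E)%E.
Proof.
apply: ae_bounded_series.
- by move=> n; apply/measurable_EFinP; exact: measurable_loss.
- by move=> n w; rewrite lee_fin; exact: loss_ge0.
move=> n; have := sum_loss_total X_iid W1 rho K0 n.
have := integral_tame_total_ge n.
set S := (\sum_(i < n) _)%E; set I := (\int[P]_w _)%E => h1 h2.
have I0 : I \is a fin_num.
  rewrite ge0_fin_numE; last first.
    by apply: integral_ge0 => w _; rewrite lee_fin tame_total_ge0.
  apply: (@le_lt_trans _ _ 1%E); last exact: (ltry 1).
  rewrite -h2 leeDr// /S sume_ge0// => i _; apply: integral_ge0 => w _.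
  by rewrite lee_fin; exact: loss_ge0.
have -> : S = (1 - I)%E by rewrite -h2 addeK.
rewrite leeBlDr// -(fineK I0) -EFinD lee_fin.
by move: h1; rewrite -(fineK I0) lee_fin; lra.
Qed.

Lemma integral_total_gap_le n :
  (\int[P]_w (cascade_mass (X ^~ w) n - tame_total K rho (X ^~ w) n)%:E <= eps%:E)%E.
Proof.
have mt := measurable_tame_total X K rho n; have mT := measurable_cascade_mass n.
have : (\int[P]_w (cascade_mass (X ^~ w) n - tame_total K rho (X ^~ w) n)%:E +
    \int[P]_w (tame_total K rho (X ^~ w) n)%:E = 1)%E.
  rewrite -ge0_integralD//; last 4 first.
  - by move=> w _; rewrite lee_fin subr_ge0 tame_total_le_mass.
  - by apply/measurable_EFinP; exact: measurable_funB.
  - by move=> w _; rewrite lee_fin tame_total_ge0.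
  - exact/measurable_EFinP.
  rewrite -(integral_cascade_mass n); apply: eq_integral => w _.
  by rewrite -EFinD subrK.
have := integral_tame_total_ge n.
set S := (\int[P]_w (_ - _)%:E)%E; set I := (\int[P]_w _)%E => h1 h2.
have I0 : I \is a fin_num.
  rewrite ge0_fin_numE; last first.
    by apply: integral_ge0 => w _; rewrite lee_fin tame_total_ge0.
  apply: (@le_lt_trans _ _ 1%E); last exact: (ltry 1).
  rewrite -h2 leeDr// /S; apply: integral_ge0 => w _.
  by rewrite lee_fin subr_ge0 tame_total_le_mass.
have -> : S = (1 - I)%E by rewrite -h2 addeK.
rewrite leeBlDr// -(fineK I0) -EFinD lee_fin.
by move: h1; rewrite -(fineK I0) lee_fin; lra.
Qed.

(** The union bound in summed form: averaged over [C n] and weighted by [2 ^- n], the exponentials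
    have a series with expectation at most 2. Its sum [A] is almost surely finite and dominates each
    term. *)
Lemma ae_increments (C : nat -> seq (seq bool -> R)) :
  (forall n c, c \in C n -> forall u, `|c u| <= 1) ->
  {ae P, forall w, exists2 A : R, 0 <= A & forall n c, (K <= n.+1)%N -> c \in C n ->
    expR (rho ^- (2 * n.+1) / 2 * increment W K rho (X ^~ w) n c -
      tame_total K rho (X ^~ w) n) <= A * (size (C n))%:R * 2 ^+ n}.
Proof.
move=> C1.
pose Z n c w : R := expR (rho ^- (2 * n.+1) / 2 *
  increment W K rho (X ^~ w) n c - tame_total K rho (X ^~ w) n).
have Z0 n c w : 0 <= Z n c w by exact: expR_ge0.
have mZ n c : measurable_fun setT (Z n c).
  apply: (measurableT_comp (@measurable_expR R)); apply: measurable_funB.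
    by apply: measurable_funM => //; exact: measurable_increment.
  exact: measurable_tame_total.
pose k n : R := (size (C n))%:R^-1 * 2 ^- n.
have k0 n : 0 <= k n by rewrite mulr_ge0 ?invr_ge0// exprn_ge0.
pose f n w : \bar R := (\sum_(c <- C n) (K <= n.+1)%N%:R * k n * Z n c w)%:E.
have t0 n c w : 0 <= (K <= n.+1)%N%:R * k n * Z n c w by rewrite !mulr_ge0.
have f0 n w : (0 <= f n w)%E by rewrite lee_fin sumr_ge0.
have mt n c : measurable_fun setT (fun w => (K <= n.+1)%N%:R * k n * Z n c w).
  exact: measurable_funM.
have mf n : measurable_fun setT (f n).
  by apply/measurable_EFinP; apply: measurable_sum.
have fn n : (\int[P]_w f n w <= (2 ^- n)%:E)%E.
  rewrite /f; under eq_integral do rewrite -sumEFin.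
  rewrite ge0_integral_sum//; last 2 first.
  - by move=> c; exact/measurable_EFinP.
  - by move=> c w _; rewrite lee_fin.
  apply: (@le_trans _ _ (\sum_(c <- C n) (k n)%:E)%E).
    rewrite big_seq [leRHS]big_seq; apply: lee_sum => c cC.
    under eq_integral do rewrite EFinM.
    rewrite ge0_integralZl_EFin//; last 3 first.
    - by move=> w _; rewrite lee_fin.
    - exact/measurable_EFinP.
    - exact: mulr_ge0.
    case: leqP => Kn; last by rewrite !mul0r mul0e lee_fin.
    rewrite mul1r -[leRHS]mule1 lee_wpmul2l ?lee_fin//.
    exact: (integral_exp_increment X_iid W1 rho2 rho1 Kn (C1 n c cC)).
  rewrite sumEFin big_const_seq count_predT iter_addr_0 lee_fin.
  rewrite -[leLHS]mulr_natl /k.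
  have [->|s0] := eqVneq (size (C n)) 0%N; first by rewrite mul0r invr_ge0 exprn_ge0.
  by rewrite mulrA divff ?pnatr_eq0// mul1r.
have S2 : (\int[P]_w (\sum_(i <oo) f i w) <= 2%:E)%E.
  apply: ae_bounded_series => // n.
  apply: (@le_trans _ _ (\sum_(i < n) (2 ^- i : R)%:E)%E).
    by apply: lee_sum => i _; exact: fn.
  rewrite sumEFin lee_fin.
  suff : \sum_(i < n) (2 ^- i : R) = 2 - 2 * 2 ^- n.
    by move=> ->; rewrite gerBl mulr_ge0 ?invr_ge0 ?exprn_ge0.
  elim: n => [|n IH]; first by rewrite big_ord0 expr0 invr1 mulr1 subrr.
  by rewrite big_ord_recr /= IH exprS; field; rewrite expf_neq0.
have S0 w : (0 <= \sum_(i <oo) f i w)%E by apply: nneseries_ge0.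
have iS : P.-integrable setT (fun w => \sum_(i <oo) f i w)%E.
  apply/integrableP; split.
    by apply: ge0_emeasurable_sum => //.
  under eq_integral do rewrite gee0_abs//.
  by rewrite (le_lt_trans S2)// ltry.
have := integrable_ae measurableT iS; apply: filterS => w /(_ I) Sfin.
exists (fine (\sum_(i <oo) f i w)%E); first by rewrite fine_ge0.
move=> n c Kn cC.
have : ((k n * Z n c w)%:E <= \sum_(i <oo) f i w)%E.
  apply: (@le_trans _ _ (\sum_(0 <= i < n.+1) f i w)%E); last exact: nneseries_lim_ge.
  rewrite big_nat_recr//= -[leLHS]add0e leeD ?sume_ge0// /f lee_fin Kn.
  rewrite (big_rem c)//= mul1r lerDl sumr_ge0// => c' _.
  exact: mulr_ge0.
rewrite -(fineK Sfin) lee_fin; set A := fine _ => h.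
have s0 : (size (C n))%:R != 0 :> R.
  by rewrite pnatr_eq0 size_eq0; apply/eqP => C0; rewrite C0 in cC.
have -> : expR (rho ^- (2 * n.+1) / 2 * increment W K rho (X ^~ w) n c -
      tame_total K rho (X ^~ w) n) = (k n * Z n c w) * ((size (C n))%:R * 2 ^+ n).
  by rewrite /Z /k; field; rewrite s0 expf_neq0.
have -> : fine A%:E = A by [].
by rewrite -(mulrA A) ler_wpM2r// mulr_ge0// exprn_ge0.
Qed.

End one_truncation.

Hypothesis W_ge0 : {ae Q, forall x, 0 <= W x}.
Hypothesis W_mean : ('E_Q[W] = 1)%E.
Hypothesis W_llogl : ('E_Q[(fun x => W x * log2p (W x))%R] < +oo)%E.
Hypothesis W_entropy : ('E_Q[(fun x => W x * log2 (W x))%R] < 1)%E.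

(** [eta] comes before [K]: the truncations are fixed in advance, one for each [2 ^- j], but which
    of them achieves [eta] depends on the sample, and so does [A]. *)
Definition good_environment (rho : R) (C : nat -> seq (seq bool -> R))
    (x : seq bool -> R) : Prop :=
  forall eta : R, 0 < eta -> exists K, [/\ (0 < K)%N,
    forall N, \sum_(i < N) loss W K rho x i <= eta,
    forall N, exists2 n, (N <= n)%N & cascade_mass x n - tame_total K rho x n <= eta &
    exists2 A : R, 0 <= A & forall n c, (K <= n.+1)%N -> c \in C n ->
      expR (rho ^- (2 * n.+1) / 2 * increment W K rho x n c -
        tame_total K rho x n) <= A * (size (C n))%:R * 2 ^+ n].

Lemma ae_good_environment : exists rho : R, [/\ 2^-1 <= rho, rho < 1 &
  forall C : nat -> seq (seq bool -> R),
    (forall n c, c \in C n -> forall u, `|c u| <= 1) ->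
  {ae P, forall w, good_environment rho C (X ^~ w)}].
Proof.
have [rho [rho2 rho1 H]] := tame_mass W_ge0 W_mean W_llogl W_entropy X_iid.
exists rho; split => // C C1.
have e0 j : 0 < (2 ^- j : R) by rewrite invr_gt0 exprn_gt0.
have /choice[K HK] : forall j, exists K, (0 < K)%N /\
  forall l, uniq l -> all (fun u => u != [::]) l ->
  ((1 - 2 ^- j)%:E <= \int[P]_w
     (prodpos (path_factors X l w) * tame K rho (path_factors X l w))%:E)%E.
  by move=> j; have [K K0 hK] := H _ (e0 j); exists K.
have gap j : exists F : T -> \bar R, [/\ measurable_fun setT F, (forall w, 0 <= F w)%E,
    (\int[P]_w F w <= (2 ^- j)%:E)%E &
    forall w a, (F w < a)%E -> forall N, exists2 n, (N <= n)%N &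
      ((cascade_mass (X ^~ w) n - tame_total (K j) rho (X ^~ w) n)%:E < a)%E].
  apply: (@fatou_frequently _ _ _ P (fun n w =>
     (cascade_mass (X ^~ w) n - tame_total (K j) rho (X ^~ w) n)%:E) (cst (2 ^- j)%:E)).
  - move=> n; apply/measurable_EFinP; apply: measurable_funB.
      exact: measurable_cascade_mass.
    exact: measurable_tame_total.
  - by move=> n w; rewrite lee_fin subr_ge0 tame_total_le_mass.
  - by move=> n; apply: integral_total_gap_le; have [] := HK j.
  - exact: cvg_cst.
have /choice[F HF] := gap.
pose L j w := (\sum_(i <oo) (loss W (K j) rho (X ^~ w) i)%:E)%E.
have L0 j w : (0 <= L j w)%E by apply: nneseries_ge0 => i _ _; rewrite lee_fin loss_ge0.
have mL j : measurable_fun setT (L j).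
  apply: ge0_emeasurable_sum.
    by move=> i w _ _; rewrite lee_fin loss_ge0.
  by move=> i _; apply/measurable_EFinP; exact: measurable_loss.
(* Loss and gap are added first, so that a single [j] makes both small. *)
have small : {ae P, forall w, forall a, (0 < a)%E -> exists j, (L j w + F j w < a)%E}.
  apply: (@ae_small_of_integral_to0 _ _ _ P (fun j w => L j w + F j w)%E
    (fun j => (2 * 2 ^- j)%:E)).
  - by move=> j; apply: emeasurable_funD => //; have [] := HF j.
  - by move=> j w; rewrite adde_ge0//; have [] := HF j.
  - move=> j; have [mF F0 Fj _] := HF j; have [Kj hK] := HK j.
    rewrite ge0_integralD// (_ : 2 * 2 ^- j = 2 ^- j + 2 ^- j :> R); last by ring.
    by rewrite EFinD leeD// integral_loss_le.
  - have : (geometric (2 : R) 2^-1) @ \oo --> 0.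
      by apply: cvg_geometric; rewrite ger0_norm// invf_lt1// ltr1n.
    move=> h; rewrite (_ : (fun j => _) = EFin \o geometric (2 : R) 2^-1); last first.
      by apply/funext => j; rewrite /= exprVn.
    by apply/fine_cvgP; split; [exact: nearW|exact: h].
have incs : {ae P, forall w, forall j, exists2 A : R, 0 <= A &
    forall n c, (K j <= n.+1)%N -> c \in C n ->
    expR (rho ^- (2 * n.+1) / 2 * increment W (K j) rho (X ^~ w) n c -
      tame_total (K j) rho (X ^~ w) n) <= A * (size (C n))%:R * 2 ^+ n}.
  apply/ae_foralln => j; have [Kj _] := HK j.
  exact: ae_increments.
move: small incs; apply: filterS2 => w small incs eta eta0.
have [j hj] := small eta%:E eta0.
have [Kj _] := HK j; have [_ F0 _ Fl] := HF j.
exists (K j); split => //.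
- move=> N; rewrite -lee_fin; apply: (@le_trans _ _ (L j w)); last first.
    by apply: le_trans (ltW hj); rewrite leeDl.
  rewrite -sumEFin -(big_mkord xpredT (fun i => (loss W (K j) rho (X ^~ w) i)%:E)).
  by apply: nneseries_lim_ge => i _ _; rewrite lee_fin loss_ge0.
- move=> N; have [|n Nn hn] := Fl w eta%:E _ N.
    by apply: le_lt_trans hj; rewrite leeDr.
  by exists n => //; rewrite -lee_fin ltW.
Qed.

End good_event.

(** * Cascade measures *)

Section restricted_measures.
Local Open Scope ereal_scope.
Context {R : realType} {d : measure_display} {T : measurableType d}.
Variables (mu : {measure set T -> \bar R}) (E : set T) (mE : measurable E).

Lemma ge0_integral_mrestr (D : set T) (f : T -> \bar R) : measurable D ->
  measurable_fun D f -> (forall x, D x -> 0 <= f x) ->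
  \int[mrestr mu mE]_(x in D) f x = \int[mu]_(x in D `&` E) f x.
Proof.
move=> mD mf f0.
have mDE : measurable (D `&` E) by exact: measurableI.
have mDnE : measurable (D `\` E) by exact: measurableD.
have DU : (D `&` E) `|` (D `\` E) = D by rewrite setUIDK.
rewrite -[in LHS]DU ge0_integral_setU ?DU//; last first.
  by apply/disj_setPS => x [[_ Ex] [_ nEx]].
rewrite [X in _ + X]null_set_integral ?adde0//; last 2 first.
- by apply: measurable_funS mf => // x [].
- by rewrite /= /mrestr setDE -setIA setICl setI0 measure0.
apply: eq_measure_integral => A mA AE /=.
by rewrite /mrestr setIidl// => x /AE [].
Qed.

Lemma integral_mrestr (f : T -> \bar R) : measurable_fun setT f ->
  \int[mrestr mu mE]_x f x = \int[mu]_(x in E) f x.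
Proof.
move=> mf; rewrite [LHS]integralE [RHS]integralE.
by congr (_ - _); rewrite ge0_integral_mrestr// ?setTI//;
  [exact: measurable_funepos|exact: measurable_funeneg].
Qed.

End restricted_measures.

Section dyadic_intervals.
Context {R : realType}.
Implicit Types (u : seq bool) (f h : R -> R).

Local Notation left u := (@word_left R u).

Lemma word_left_rcons u b :
  left (rcons u b) = left u + b%:R * 2 ^- (size u).+1.
Proof.
rewrite /word_left size_rcons big_ord_recr /=; congr (_ + _).
  by apply: eq_bigr => i _; rewrite nth_rcons ltn_ord.
by rewrite nth_rcons ltnn eqxx.
Qed.

Lemma half_pow n : 2 ^- n = 2 ^- n.+1 + 2 ^- n.+1 :> R.
Proof. by rewrite exprS; field; rewrite expf_neq0. Qed.

Lemma word_left_ge0 u : 0 <= left u.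
Proof. by apply: sumr_ge0 => i _; rewrite mulr_ge0// invr_ge0 exprn_ge0. Qed.

Lemma word_right_le1 u : left u + 2 ^- size u <= 1.
Proof.
elim/last_ind: u => [|u b IH].
  by rewrite /word_left big_ord0 add0r expr0 invr1.
rewrite word_left_rcons size_rcons (le_trans _ IH)// -addrA lerD2l (half_pow (size u)).
by rewrite lerD2r ler_piMl ?invr_ge0 ?exprn_ge0//; case: b.
Qed.

Lemma word_right_all u : all id u -> left u + 2 ^- size u = 1.
Proof.
elim/last_ind: u => [|u b IH]; first by rewrite /word_left big_ord0 add0r expr0 invr1.
rewrite all_rcons => /andP[/= -> h].
by rewrite word_left_rcons size_rcons mul1r -addrA -half_pow; exact: IH.
Qed.

(** The closure of [word_itv u]: closed intervals suit continuity on segments, and the added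
    endpoint has measure zero. *)
Definition word_segment u : set R := `[left u, left u + 2 ^- size u]%classic.

Lemma measurable_word_segment u : measurable (word_segment u).
Proof. exact: measurable_itv. Qed.

Lemma word_segment_sub u : word_segment u `<=` `[0, 1]%classic.
Proof.
move=> t; rewrite /word_segment /= !in_itv/= => /andP[h1 h2].
by rewrite (le_trans (word_left_ge0 u) h1) (le_trans h2 (word_right_le1 u)).
Qed.

Lemma word_left_le u : left u <= left u + 2 ^- size u.
Proof. by rewrite lerDl invr_ge0 exprn_ge0. Qed.

Lemma measurable_word_itv u : measurable (@word_itv R u).
Proof. by rewrite /word_itv; case: ifP => _; exact: measurable_itv. Qed.

Lemma word_itv_sub u : @word_itv R u `<=` word_segment u.
Proof.
rewrite /word_itv /word_segment; case: ifP => [/word_right_all ->//|_] t /=.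
by rewrite !in_itv/= => /andP[-> /ltW ->].
Qed.

Lemma integral_word_itv u (f : R -> R) : measurable_fun (word_segment u) f ->
  (\int[lebesgue_measure]_(t in word_itv u) (f t)%:E =
   \int[lebesgue_measure]_(t in word_segment u) (f t)%:E)%E.
Proof.
move=> mf; rewrite /word_itv /word_segment; case: ifP => [/word_right_all ->//|_].
apply: integral_itv_bndo_bndc; apply/measurable_EFinP.
apply: (measurable_funS (measurable_word_segment u)) mf => t /=.
by rewrite /word_segment /= !in_itv/= => /andP[-> /ltW ->].
Qed.

Definition average h u : R :=
  2 ^+ size u * (\int[lebesgue_measure]_(t in word_segment u) h t)%R.

Lemma within_segment u h : {within `[0, 1], continuous h} ->
  {within word_segment u, continuous h}.
Proof. by apply: continuous_subspaceW; exact: word_segment_sub. Qed.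

Lemma average_split h u : {within `[0, 1], continuous h} ->
  average h u = (average h (rcons u false) + average h (rcons u true)) / 2.
Proof.
move=> /(within_segment (u := u)); rewrite /average /word_segment => ch.
have p0 : 0 <= 2 ^- (size u).+1 :> R by rewrite invr_ge0 exprn_ge0.
have e : left u + 2 ^- size u = left u + 2 ^- (size u).+1 + 2 ^- (size u).+1.
  by rewrite half_pow addrA.
have h1 : left u <= left u + 2 ^- (size u).+1 by rewrite lerDl.
have h2 : left u + 2 ^- (size u).+1 <= left u + 2 ^- size u by rewrite e lerDl.
rewrite (Rintegral_split ch h1 h2) !word_left_rcons !size_rcons mul0r addr0 mul1r.
by rewrite -e exprS; field.
Qed.

Lemma average_bound h u (M : R) : {within `[0, 1], continuous h} ->
  (forall t, t \in `[0, 1] -> `|h t| <= M) -> `|average h u| <= M.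
Proof.
move=> ch hM; have cu := within_segment (u := u) ch.
rewrite /average normrM ger0_norm ?exprn_ge0// mulrC.
have := Rintegral_norm_le cu (word_left_le u) (M := M).
move=> /(_ _)/wrap[t tu|]; first exact/hM/(word_segment_sub (u := u)).
rewrite addrAC subrr add0r => h'.
by rewrite -ler_pdivlMr ?exprn_gt0.
Qed.

Lemma averageN h u : {within `[0, 1], continuous h} ->
  average (fun t => - h t) u = - average h u.
Proof.
move=> ch; rewrite /average -mulrN; congr (_ * _); rewrite -mulN1r -RintegralZl.
- by apply: eq_Rintegral => t _; rewrite mulN1r.
- exact: measurable_word_segment.
- by apply: within_continuous_integrable; exact: within_segment.
Qed.

Lemma averageD h f u : {within `[0, 1], continuous h} ->
  {within `[0, 1], continuous f} ->
  average (fun t => h t + f t) u = average h u + average f u.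
Proof.
move=> ch cf; rewrite /average RintegralD ?mulrDr//.
- exact: measurable_word_segment.
- by apply: within_continuous_integrable; exact: within_segment.
- by apply: within_continuous_integrable; exact: within_segment.
Qed.

Lemma average1 u : average (fun=> 1) u = 1.
Proof.
rewrite /average /word_segment Rintegral_cst//= lebesgue_measure_itv/= lte_fin ltrDl.
by rewrite invr_gt0 exprn_gt0// -EFinB/= addrAC subrr add0r mul1r divff// expf_neq0.
Qed.

End dyadic_intervals.

Section cascade_integrals.
Context {R : realType}.
Implicit Types (x : seq bool -> R) (f : R -> R).

Lemma cascade_weightE x u : (forall v, v != [::] -> 0 <= x v) ->
  cascade_weight x u = weight x u.
Proof.
move=> x0; rewrite /cascade_weight /weight; congr (_ * _).
rewrite /prodpos big_map /prefixes big_map /index_iota subn1 /=.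
rewrite big_seq [RHS]big_seq; apply: eq_bigr => k; rewrite mem_iota => /andP[k1 ku].
rewrite pos_id// x0// -size_eq0 size_take.
by case: ltnP => // _; [rewrite -lt0n|rewrite -lt0n (leq_trans k1)].
Qed.

Lemma big_tuple_words n (F : seq bool -> R) :
  \sum_(u : n.-tuple bool) F u = \sum_(u <- words n) F u.
Proof.
transitivity (\sum_(u <- [seq tval u | u <- index_enum (n.-tuple bool)]) F u).
  by rewrite big_map.
apply: perm_big; apply: uniq_perm; [|exact: uniq_words|].
  by rewrite map_inj_uniq ?index_enum_uniq//; exact: val_inj.
move=> u; rewrite mem_words; apply/mapP/eqP => [[v _ ->]|un]; first exact: size_tuple.
by exists (tcast un (in_tuple u)); rewrite ?mem_index_enum// val_tcast.
Qed.

(** On measurable sets [cascade_approx] is a finite sum of multiples of Lebesgue measure restricted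
    to the intervals [word_itv u], so the integral of a nonnegative function splits over words.
    Signed functions are reached later by adding a constant. *)
Lemma integral_cascade_approx x n f : (forall v, v != [::] -> 0 <= x v) ->
  {within `[0, 1], continuous f} -> (forall t, t \in `[0, 1] -> 0 <= f t) ->
  (\int[cascade_approx x n]_(t in `[0%R, 1%R]) (f t)%:E)%E =
  (\sum_(u <- words n) weight x u * average f u)%:E.
Proof.
move=> x0 cf f0.
have mf : measurable_fun (`[0, 1]%classic : set R) (fun t => (f t)%:E).
  exact: measurable_int (within_continuous_integrable cf).
have f0' (t : R) : `[0, 1]%classic t -> (0 <= (f t)%:E)%E.
  by move=> t01; rewrite lee_fin f0.
have k0 u : 0 <= 2 ^+ size u * weight x u by rewrite mulr_ge0 ?exprn_ge0 ?weight_ge0.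
pose leb : {measure set (measurableTypeR R) -> \bar R} := @lebesgue_measure R.
pose mr i : {measure set (measurableTypeR R) -> \bar R} :=
  mrestr leb (measurable_word_itv (nth [::] (words n) i)).
pose m_ i : {measure set (measurableTypeR R) -> \bar R} := mscale (NngNum (k0 (nth [::] (words n) i))) (mr i).
pose M : {measure set (measurableTypeR R) -> \bar R} := msum m_ (size (words n)).
have caE (A : set (measurableTypeR R)) : measurable A -> cascade_approx x n A = M A.
  move=> mA; rewrite /cascade_approx /cascade_density.
  have mA01 : measurable (A `&` `[0%R, 1%R]%classic) by exact: measurableI.
  transitivity (\int[lebesgue_measure]_(t in A `&` `[0%R, 1%R])
      (\sum_(u <- words n) (2 ^+ size u * weight x u)%:E * (\1_(word_itv u) t)%:E))%E.
    apply: eq_integral => t _.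
    rewrite (big_tuple_words n (fun u => 2 ^+ n * cascade_weight x u * \1_(word_itv u) t)).
    rewrite -sumEFin big_seq [RHS]big_seq; apply: eq_bigr => u.
    by rewrite mem_words => /eqP un; rewrite cascade_weightE// -EFinM un.
  rewrite ge0_integral_sum//; last 2 first.
  - move=> u; apply: measurable_funeM; apply/measurable_EFinP.
    by apply: measurable_funTS; exact: measurable_indic (@measurable_word_itv R u).
  - by move=> u t _; rewrite -EFinM lee_fin mulr_ge0// mulr_ge0 ?exprn_ge0 ?weight_ge0.
  rewrite /msum (big_nth [::]) big_mkord; apply: eq_bigr => i _.
  rewrite ge0_integralZl_EFin//; last first.
    apply/measurable_EFinP; apply: measurable_funTS.
    exact: measurable_indic (@measurable_word_itv R _).
  rewrite integral_indic//; last exact: measurable_word_itv.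
  rewrite /m_ /= /mscale /mr /= /mrestr setIC -setIA; congr (_ * leb (_ `&` _))%E.
  rewrite setIidr//; apply: subset_trans (@word_segment_sub R (nth [::] (words n) i)).
  exact: word_itv_sub.
have ca0 : cascade_approx x n set0 = 0%E by rewrite caE// measure0.
have ca_ge0 (A : set R) : (0 <= cascade_approx x n A)%E.
  apply: integral_ge0 => t _; rewrite lee_fin; apply: sumr_ge0 => u _.
  rewrite mulr_ge0// mulr_ge0 ?exprn_ge0// cascade_weightE// weight_ge0//.
have ca_sigma : semi_sigma_additive (cascade_approx x n : set R -> \bar R).
  move=> F mF tF mUF; rewrite (caE _ mUF).
  rewrite (_ : (fun k => _) = (fun k => \sum_(0 <= i < k) M (F i))%E); last first.
    by apply/funext => k; apply: eq_bigr => i _; exact: caE (mF i).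
  exact: (@measure_semi_sigma_additive _ _ _ M).
pose ca : {measure set R -> \bar R} :=
  HB.pack (cascade_approx x n : set R -> \bar R)
    (isMeasure.Build _ _ _ (cascade_approx x n : set R -> \bar R) ca0 ca_ge0 ca_sigma).
(* [R] and [measurableTypeR R] have the same measurable sets but different
   displays; the pushforward by [idfun] passes from one to the other. *)
have mid : measurable_fun setT (idfun : measurableTypeR R -> R) by exact: (@measurable_id _ _ setT).
pose idp : {mfun measurableTypeR R >-> R} :=
  HB.pack (idfun : measurableTypeR R -> R) (isMeasurableFun.Build _ _ _ _ _ mid).
pose M' : {measure set R -> \bar R} := pushforward M idp.
transitivity (\int[ca]_(t in `[0%R, 1%R]) (f t)%:E)%E; first by [].
transitivity (\int[M' mid]_(t in `[0%R, 1%R]) (f t)%:E)%E.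
  by apply: eq_measure_integral => A mA _; exact: caE.
rewrite /M' ge0_integral_pushforward//; last by move=> t; rewrite inE; exact: f0'.
transitivity (\int[M]_(t in `[0%R, 1%R]) (f t)%:E)%E; first by [].
rewrite /M ge0_integral_measure_sum// -sumEFin [RHS](big_nth [::]) big_mkord.
apply: eq_bigr => i _.
rewrite /m_ ge0_integral_mscale// ge0_integral_mrestr//.
set u := nth _ _ _.
have su : word_segment u `<=` (`[0, 1]%classic : set R) by exact: word_segment_sub.
rewrite setIidr; last by apply: subset_trans su; exact: word_itv_sub.
have mfu : measurable_fun (word_segment u) f.
  by apply: measurable_funS su _ => //; apply/measurable_EFinP.
transitivity ((2 ^+ size u * weight x u)%:E *
    \int[lebesgue_measure]_(t in word_segment u) (f t)%:E)%E.
  by congr (_ * _)%E; exact: integral_word_itv.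
have -> : weight x u * average f u = (2 ^+ size u * weight x u) *
    (\int[lebesgue_measure]_(t in word_segment u) f t)%R by rewrite /average; ring.
rewrite [RHS]EFinM; congr (_ * _)%E.
rewrite /Rintegral fineK//; apply: integrable_fin_num => //.
  exact: measurable_word_segment.
by apply: within_continuous_integrable; exact: within_segment.
Qed.

End cascade_integrals.

(** * Decay *)

Section frequency_net.
Context {R : realType}.
Implicit Types (g : R -> R * R) (xi : R * R).

Lemma cos_lipschitz (a b : R) : `|cos a - cos b| <= `|a - b|.
Proof.
wlog ab : a b / a <= b => [hw|].
  by have [/hw//|/ltW/hw] := leP a b; rewrite distrC (distrC b a).
have cc : {within `[a, b], continuous (@cos R)}.
  by apply: continuous_subspaceT => t; exact: continuous_cos.
have [c _ e] := MVT_segment ab (fun t _ => is_derive_cos t) cc.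
rewrite distrC e normrM distrC (distrC a b) ler_piMl// normrN.
by rewrite ler_norml sin_geN1 sin_le1.
Qed.

Definition arc_cos g xi th (t : R) : R := cos (arc_phase g xi th t).

Definition arc_coef g xi th : seq bool -> R := average (arc_cos g xi th).

Lemma arc_cos_le1 g xi th t : `|arc_cos g xi th t| <= 1.
Proof. by rewrite ler_norml cos_geN1 cos_le1. Qed.

Lemma arc_continuous g : nondegenerate_C2_arc g ->
  {within `[0, 1], continuous (fst \o g)} /\ {within `[0, 1], continuous (snd \o g)}.
Proof. by move=> [[[d1 _ _] [d2 _ _]] _ _ _]; split; exact: derivable01_continuous. Qed.

Lemma arc_cos_continuous g xi th : nondegenerate_C2_arc g ->
  {within `[0, 1], continuous (arc_cos g xi th)}.
Proof.
move=> /arc_continuous[c1 c2].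
apply: (within_continuous_postcomp (h := @cos R)); first exact: continuous_cos.
apply: (within_continuous_add (f := fun t => 2 * pi * (xi.1 * (fst \o g) t + xi.2 * (snd \o g) t))
  (h := fun=> th)); last exact: within_continuous_cst.
apply: within_continuousM; first exact: within_continuous_cst.
apply: (within_continuous_add (f := fun t => xi.1 * (fst \o g) t) (h := fun t => xi.2 * (snd \o g) t)).
  by apply: within_continuousM => //; exact: within_continuous_cst.
by apply: within_continuousM => //; exact: within_continuous_cst.
Qed.

Lemma arc_coef_le1 g xi th u : nondegenerate_C2_arc g -> `|arc_coef g xi th u| <= 1.
Proof.
by move=> ga; apply: average_bound => [|t _]; [exact: arc_cos_continuous|exact: arc_cos_le1].
Qed.

Lemma arc_coef_split g xi th u : nondegenerate_C2_arc g -> arc_coef g xi th u =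
  (arc_coef g xi th (rcons u false) + arc_coef g xi th (rcons u true)) / 2.
Proof. by move=> ga; apply: average_split; exact: arc_cos_continuous. Qed.

Lemma arc_coef_lipschitz g : nondegenerate_C2_arc g -> exists2 G : R, 0 < G &
  forall (xi xi' : R * R) th u, `|arc_coef g xi th u - arc_coef g xi' th u| <=
    G * (`|xi.1 - xi'.1| + `|xi.2 - xi'.2|).
Proof.
move=> ga; have [c1 c2] := arc_continuous ga.
have [M1 M10 h1] := within_continuous_bounded c1.
have [M2 M20 h2] := within_continuous_bounded c2.
have pi0 : 0 < pi :> R by exact: pi_gt0.
exists (2 * pi * (M1 + M2)); first by rewrite !mulr_gt0// addr_gt0.
move=> xi xi' th u; have cx := arc_cos_continuous (xi := xi) (th := th) ga.
have cx' := arc_cos_continuous (xi := xi') (th := th) ga.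
rewrite /arc_coef -averageN// -averageD//; last exact: within_continuousN.
apply: average_bound; first by apply: within_continuous_add => //; exact: within_continuousN.
move=> t t01; rewrite (le_trans (cos_lipschitz _ _))//.
have -> : arc_phase g xi th t - arc_phase g xi' th t =
   2 * pi * ((xi.1 - xi'.1) * (g t).1 + (xi.2 - xi'.2) * (g t).2).
  by rewrite /arc_phase /dot2; ring.
have p2 : 0 <= 2 * pi :> R by rewrite mulr_ge0// ltW.
rewrite normrM (ger0_norm p2) -[leRHS]mulrA ler_wpM2l//.
rewrite (le_trans (ler_normD _ _))// !normrM [leRHS]mulrC mulrDl lerD//.
  by rewrite ler_wpM2l// (le_trans (h1 t t01))// lerDl ltW.
by rewrite ler_wpM2l// (le_trans (h2 t t01))// lerDr ltW.
Qed.

(* The mesh is [2 ^- k]; subtracting [2 ^+ (7 * k)] reaches the negative points. *)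
Definition grid_point (k i : nat) : R := (i%:R - 2 ^+ (7 * k)) / 2 ^+ k.

Definition grid (k : nat) : seq R := [seq grid_point k i | i <- iota 0 (2 ^ (7 * k).+1).+1].

Lemma grid_approx k (a : R) : `|a| <= 2 ^+ (6 * k) ->
  exists2 b, b \in grid k & `|a - b| <= 2 ^- k.
Proof.
rewrite ler_norml => /andP[a1 a2].
have k0 : 0 < 2 ^+ k :> R by rewrite exprn_gt0.
pose y := a * 2 ^+ k + 2 ^+ (7 * k).
have e : 2 ^+ (7 * k) = 2 ^+ (6 * k) * 2 ^+ k :> R by rewrite -exprD -mulSnr.
have y0 : 0 <= y.
  by rewrite /y e -mulrDl; apply: mulr_ge0; [lra|exact: ltW].
have [t1 t2] : (Num.truncn y)%:R <= y /\ y < (Num.truncn y).+1%:R.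
  by split; [rewrite truncn_le|exact: truncnS_gt].
exists (grid_point k (Num.truncn y)).
  apply/mapP; exists (Num.truncn y) => //; rewrite mem_iota add0n ltnS /=.
  rewrite -(ler_nat R) natrX (le_trans t1)// exprS /y e.
  have : a * 2 ^+ k <= 2 ^+ (6 * k) * 2 ^+ k by rewrite ler_pM2r.
  by lra.
have -> : a - grid_point k (Num.truncn y) = (y - (Num.truncn y)%:R) / 2 ^+ k.
  by rewrite /grid_point /y; field; rewrite gt_eqF.
rewrite normrM normfV (ger0_norm (ltW k0)) ler_piMl ?invr_ge0 ?(ltW k0)//.
rewrite ger0_norm ?subr_ge0// lerBlDr addrC.
by move: t2; rewrite -natr1 => /ltW.
Qed.

(* The sign turns an upper bound on all increments into a two-sided one. *)
Definition net g (n : nat) : seq (seq bool -> R) :=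
  [seq (fun u => q.2 * arc_coef g q.1.1 q.1.2 u) | q <-
    allpairs pair (allpairs pair (allpairs pair (grid n.+1) (grid n.+1))
      [:: 0; pi / 2]) [:: 1; -1]].

Lemma net_mem g n a b th s : a \in grid n.+1 -> b \in grid n.+1 ->
  th \in [:: 0; pi / 2] -> s \in [:: 1; -1] ->
  (fun u => s * arc_coef g (a, b) th u) \in net g n.
Proof.
move=> ha hb ht hs; apply/mapP; exists ((a, b), th, s) => //.
by apply: allpairs_f => //; apply: allpairs_f => //; exact: allpairs_f.
Qed.

Lemma net_le1 g n c : nondegenerate_C2_arc g -> c \in net g n -> forall u, `|c u| <= 1.
Proof.
move=> ga /mapP[[[xi th] s] /allpairsP[[q s'] [_ /= hs [_ ->]]] -> u] /=.
rewrite normrM -[leRHS]mulr1 ler_pM ?arc_coef_le1//.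
by move: hs; rewrite !inE => /orP[] /eqP ->; rewrite ?normrN normr1.
Qed.

Lemma size_net g n : (size (net g n) <= 2 ^ (14 * n + 20))%N.
Proof.
rewrite /net size_map !size_allpairs /= /grid size_map size_iota.
have h : ((2 ^ (7 * n.+1).+1).+1 <= 2 ^ (7 * n + 9))%N.
  rewrite (_ : 7 * n + 9 = (7 * n.+1).+2)%N; last by rewrite mulnS; lia.
  by rewrite [leqRHS]expnS mul2n -addnn -addn1 leq_add2l expn_gt0.
apply: (@leq_trans (2 ^ (7 * n + 9) * 2 ^ (7 * n + 9) * 2 * 2)).
  by rewrite !leq_mul2r /= leq_mul.
by rewrite -expnD -!expnSr leq_exp2l//; lia.
Qed.

End frequency_net.

Section deterministic_decay.
Context {R : realType} {d' : measure_display} {T' : measurableType d'}.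
Variables (Q : probability T' R) (W : {RV Q >-> R}).
Hypothesis W1 : (\int[Q]_y (pos (W y))%:E = 1)%E.

Lemma incrementZ K rho x n s (c : seq bool -> R) :
  increment W K rho x n (fun u => s * c u) = s * increment W K rho x n c.
Proof. by rewrite /increment mulr_sumr; apply: eq_bigr => v _; rewrite mulrCA. Qed.

Lemma increment_lipschitz K rho x n (c c' : seq bool -> R) (delta : R) :
  (forall u, `|c u - c' u| <= delta) ->
  `|increment W K rho x n c - increment W K rho x n c'| <=
  (tame_total K rho x n.+1 + tame_total K rho x n) * delta.
Proof.
move=> cc; rewrite /increment -sumrB.
apply: (le_trans (ler_norm_sum _ _ _)).
have -> : tame_total K rho x n.+1 + tame_total K rho x n =
  \sum_(v <- words n.+1) (tame_weight K rho x v + tame_weight K rho x (take n v) / 2).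
  rewrite big_split /=; congr (_ + _); rewrite big_words /tame_total big_seq [RHS]big_seq.
  apply: eq_bigr => u; rewrite mem_words => /eqP un /=.
  by rewrite -!cats1 -un !take_size_cat//; field.
rewrite mulr_suml; apply: ler_sum => v _; rewrite -mulrBr normrM.
rewrite ler_pM//; apply: (le_trans (ler_normB _ _)).
rewrite !ger0_norm ?step_mean_ge0 ?tame_weight_ge0// lerD2l.
by rewrite step_mean_le// tame_weight_ge0.
Qed.

(** [1 - rho ^+ n] is [1 - rho] times a sum of [n] powers, each at least [rho ^+ n]. This lets one
    power [rho ^+ n] absorb a factor linear in [n]. *)
Lemma linear_geometric (rho : R) n : 0 <= rho -> rho <= 1 ->
  n%:R * (1 - rho) * rho ^+ n <= 1 - rho ^+ n.
Proof.
move=> r0 r1; elim: n => [|n IH]; first by rewrite !mul0r expr0 subrr.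
have q0 : 0 <= rho ^+ n by rewrite exprn_ge0.
have h1 := ler_wpM2l r0 IH.
have h2 : 0 <= (1 - rho) * (1 - rho * rho ^+ n).
  rewrite mulr_ge0 ?subr_ge0// -exprS exprn_ile1//.
rewrite -natr1 exprS; nra.
Qed.

(** Taking logarithms, with [A <= expR A] and [2 <= expR 1], bounds [I] by [2 * rho ^+ (2 * k)]
    times a linear function of [k = n.+1], whose growth one power [rho ^+ k] absorbs. The exponent
    [15 * n + 20] accounts for the net, of size at most [2 ^ (14 * n + 20)], and the weight
    [2 ^+ n]. *)
Lemma log_increment (rho A M : R) (I S : R) n : 0 < rho -> rho < 1 -> 0 <= A ->
  S <= M -> 0 <= M ->
  expR (rho ^- (2 * n.+1) / 2 * I - S) <= A * 2 ^+ (15 * n + 20) ->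
  I <= 2 * (M + A + 20 / (1 - rho)) * rho ^+ n.+1.
Proof.
move=> r0 r1 A0 SM M0 h; pose k := n.+1.
have q0 : 0 < rho ^+ k by rewrite exprn_gt0.
have q1 : rho ^+ k <= 1 by rewrite exprn_ile1 ?ltW.
have e1 : rho ^- (2 * k) / 2 * I - S <= A + (15 * n + 20)%:R.
  rewrite -ler_expR (le_trans h)// expRD ler_pM ?exprn_ge0//.
    by rewrite (le_trans _ (expR_ge1Dx _))// lerDr.
  rewrite -[X in expR X]mulr1 expRM_natl lerXn2r ?nnegrE ?expR_ge0//.
  by rewrite (le_trans _ (expR_ge1Dx _)).
have e2 : rho ^- (2 * k) / 2 * I <= M + A + 20 * k%:R.
  have : (15 * n + 20)%:R <= 20 * k%:R :> R.
    by rewrite -natrM ler_nat /k; lia.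
  by lra.
have lg := linear_geometric k (ltW r0) (ltW r1).
have d0 : 0 < 1 - rho by rewrite subr_gt0.
have kq : k%:R * rho ^+ k <= (1 - rho)^-1.
  rewrite -[leRHS]mul1r ler_pdivlMr// mulrAC (le_trans lg)//.
  by rewrite gerBl ltW.
have -> : I = 2 * rho ^+ k * (rho ^+ k * (rho ^- (2 * k) / 2 * I)).
  by rewrite mul2n -addnn exprD; field; rewrite gt_eqF.
rewrite -/k [leRHS]mulrAC; apply: ler_wpM2l; first by rewrite mulr_ge0// ltW.
apply: (@le_trans _ _ (rho ^+ k * (M + A + 20 * k%:R))); first by rewrite ler_wpM2l// ltW.
rewrite mulrDr lerD//.
  by rewrite ler_piMl// addr_ge0.
by rewrite mulrCA ler_wpM2l// mulrC.
Qed.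

Lemma dyadic_scale (r : R) : 1 <= r -> exists m, 2 ^+ (6 * m) <= r /\ r < 2 ^+ (6 * m.+1).
Proof.
move=> r1.
have ex : exists n, r < 2 ^+ (6 * n).
  exists (Num.truncn r).+1; apply: (lt_le_trans (truncnS_gt r)).
  by rewrite -natrX ler_nat (leq_trans (ltnW (ltn_expl _ (ltnSn 1))))// leq_exp2l// leq_pmull.
case: (ex_minnP ex) => -[|m] rm mmin.
  by move: rm; rewrite muln0 expr0 ltNge r1.
exists m; split => //; rewrite leNgt; apply/negP => /mmin.
by rewrite ltnn.
Qed.
(* Generation [m], where [2 ^+ (6 * m)] is comparable to [norm2 xi], is handled by
   stationary phase at scale [4^-1 ^+ m]; the increments control what follows. *)
Lemma decay_of_good_environment (rho M : R) (x : seq bool -> R) (g : R -> R * R) :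
  2^-1 <= rho -> rho < 1 -> nondegenerate_C2_arc g ->
  good_environment W rho (net g) x ->
  (forall n, cascade_mass x n <= M) ->
  forall eps : R, 0 < eps -> exists r0 : R, forall xi th l, r0 < norm2 xi ->
    th \in [:: 0; pi / 2] ->
    \sum_(u <- words n) weight x u * arc_coef g xi th u @[n --> \oo] --> l ->
    `|l| <= eps.
Proof.
move=> rho2 rho1 ga good tM eps eps0.
have rho0 : 0 < rho by rewrite (lt_le_trans _ rho2)// invr_gt0.
have M0 : 0 <= M.
  by apply: le_trans (tM 0%N); apply: sumr_ge0 => u _; exact: weight_ge0.
(* Four errors: the sum at generation [m] with all later increments, the losses, the gap between
   full and tame mass, and the distance to the limit. *)
pose eta := eps / 4; have eta0 : 0 < eta by rewrite divr_gt0.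
have [K [K0 lossK gapK [A A0 incK]]] := good eta eta0.
have ttM n : tame_total K rho x n <= M.
  by rewrite (le_trans _ (tM n))// tame_total_le_mass.
have [G G0 lipG] := arc_coef_lipschitz ga.
have [C C0 oscC] := arc_oscillation ga.
pose B := 2 * (M + A + 20 / (1 - rho)).
have d0 : 0 < 1 - rho by rewrite subr_gt0.
have B0 : 0 <= B by rewrite mulr_ge0// !addr_ge0// divr_ge0// ltW.
have net_inc n c : (K <= n.+1)%N -> c \in net g n ->
    increment W K rho x n c <= B * rho ^+ n.+1.
  move=> Kn cn; apply: (log_increment rho0 rho1 A0 (ttM n) M0).
  apply: (le_trans (incK n c Kn cn)).
  rewrite -mulrA ler_wpM2l// (mulSnr 14) addnAC exprD ler_wpM2r ?exprn_ge0// -natrX ler_nat.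
  exact: size_net.
(* Moving to a net point changes each coefficient by at most [2 * G * 2 ^- n.+1] and the increment
   by [2 * M] times as much; [2^-1 <= rho] turns this into a multiple of [rho ^+ n.+1]. *)
pose B' := B + 4 * M * G.
have B'0 : 0 <= B' by rewrite addr_ge0// !mulr_ge0// ltW.
have inc_bound n xi th : (K <= n.+1)%N -> norm2 xi <= 2 ^+ (6 * n.+1) ->
    th \in [:: 0; pi / 2] ->
    `|increment W K rho x n (arc_coef g xi th)| <= B' * rho ^+ n.+1.
  move=> Kn xin tha.
  have [a ag a1] := grid_approx (le_trans (fst_le_norm2 xi) xin).
  have [b bg b1] := grid_approx (le_trans (snd_le_norm2 xi) xin).
  have near_inc : `|increment W K rho x n (arc_coef g (a, b) th)| <= B * rho ^+ n.+1.
    rewrite ler_norml lerNl -mulN1r -!incrementZ; apply/andP; split.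
      by apply: net_inc => //; apply: net_mem => //; rewrite !inE eqxx orbT.
    have := @net_inc n (fun u => 1 * arc_coef g (a, b) th u) Kn.
    rewrite incrementZ mul1r; apply.
    by apply: net_mem => //; rewrite !inE eqxx.
  pose delta := G * (2 * 2 ^- n.+1).
  have diff : `|increment W K rho x n (arc_coef g xi th) -
      increment W K rho x n (arc_coef g (a, b) th)| <= 2 * M * delta.
    apply: le_trans (increment_lipschitz K rho x n (delta := delta) _) _.
      move=> u; rewrite (le_trans (lipG _ _ _ _))// ler_wpM2l ?(ltW G0)//=.
      by rewrite mulr_natl mulr2n lerD.
    rewrite ler_wpM2r ?mulr_ge0 ?invr_ge0 ?exprn_ge0 ?(ltW G0)//.
    by rewrite mulr_natl mulr2n lerD.
  rewrite -[X in `|X|](subrK (increment W K rho x n (arc_coef g (a, b) th))).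
  rewrite (le_trans (ler_normD _ _))// /B' mulrDl addrC lerD//.
  rewrite (le_trans diff)// /delta (_ : 2 * M * _ = 4 * M * G * 2 ^- n.+1); last by ring.
  rewrite ler_wpM2l ?mulr_ge0 ?(ltW G0)// -exprVn.
  by rewrite lerXn2r ?nnegrE ?invr_ge0// ltW.
pose D := M * C + B' / (1 - rho).
have D0 : 0 <= D by apply: addr_ge0; [apply: mulr_ge0 => //; exact: ltW|apply: divr_ge0 => //; exact: ltW].
(* Starting at [K] or later puts every increment used under the tame bound. *)
have [m0 Km0 hm0] : exists2 m0, (K <= m0)%N & forall m, (m0 <= m)%N -> D * rho ^+ m <= eta.
  have : geometric D rho @ \oo --> 0.
    by apply: cvg_geometric; rewrite ger0_norm ?ltW.
  move=> /cvgr0_norm_le /(_ _ eta0)[N _ hN].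
  exists (maxn K N); first exact: leq_maxl.
  move=> m; rewrite geq_max => /andP[_ Nm].
  by have := hN m Nm; rewrite /geometric /=; apply: le_trans; exact: ler_norm.
exists (2 ^+ (6 * m0)) => xi th l xibig tha cvl.
have r1 : 1 <= norm2 xi.
  by rewrite (le_trans _ (ltW xibig))// exprn_ege1// ler1n.
have [m [mr rm]] := dyadic_scale r1.
have m0m : (m0 <= m)%N.
  have := lt_trans xibig rm; rewrite ltr_eXn2l ?ltr1n// ltn_pmul2l//.
pose c := arc_coef g xi th.
have c1 u : `|c u| <= 1 by exact: arc_coef_le1.
have cm u : c u = (c (rcons u false) + c (rcons u true)) / 2 by exact: arc_coef_split.
have base : `|tame_sum K rho x m c| <= M * C * rho ^+ m.
  apply: (le_trans (ler_norm_sum _ _ _)).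
  apply: (@le_trans _ _ (\sum_(u <- words m) tame_weight K rho x u * (C * rho ^+ m))).
    rewrite big_seq [leRHS]big_seq; apply: ler_sum => u; rewrite mem_words => /eqP um.
    rewrite normrM ger0_norm ?tame_weight_ge0// ler_wpM2l ?tame_weight_ge0//.
    rewrite /c /arc_coef /average um normrM ger0_norm ?exprn_ge0//.
    (* [2 ^+ (6 * m) * p ^+ 3 = 1] meets the condition of [arc_oscillation], and
       [2 ^+ m * p = 2^-1 ^+ m] is at most [rho ^+ m]. *)
    pose p : R := 4^-1 ^+ m.
    have p0 : 0 < p by rewrite exprn_gt0// invr_gt0.
    have p1 : p <= 1 by rewrite exprn_ile1// ?invr_ge0// invf_le1// ler1n.
    have p3 : 2 ^+ (6 * m) * p ^+ 3 = 1.
      rewrite /p -exprM [(m * 3)%N]mulnC !exprM -exprMn (_ : 2 ^+ 6 * 4^-1 ^+ 3 = 1) ?expr1n//.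
      by field.
    have xp : 1 <= norm2 xi * p ^+ 3.
      by rewrite -p3 ler_wpM2r// exprn_ge0// ltW.
    have := oscC xi th p _ _ p0 p1 (word_left_ge0 u) (word_left_le u) (word_right_le1 u) xp.
    rewrite /word_segment um /arc_cos => osc.
    apply: (le_trans (ler_wpM2l (exprn_ge0 _ _) osc)) => //.
    rewrite mulrCA ler_pM2l// /p -exprMn (_ : 2 * 4^-1 = 2^-1); last by field.
    by rewrite lerXn2r ?nnegrE ?invr_ge0// ltW.
  rewrite -mulr_suml -mulrA ler_wpM2r//; last exact: ttM.
  by rewrite mulr_ge0 ?exprn_ge0// ltW.
(* The geometric sum is kept as a difference of powers so that the induction closes; losses are
   counted from generation 0 because [lossK] bounds those sums. *)
have walk k : `|tame_sum K rho x (m + k)%N c| <= M * C * rho ^+ m +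
    B' / (1 - rho) * (rho ^+ m - rho ^+ (m + k)) +
    \sum_(i < m + k) loss W K rho x i.
  elim: k => [|k IH].
    rewrite addn0 subrr mulr0 addr0 (le_trans base)// lerDl sumr_ge0// => i _.
    exact: loss_ge0.
  have st := tame_sum_step W1 K rho x (m + k) c1 cm.
  have Kmk : (K <= (m + k).+1)%N by rewrite (leq_trans Km0)// (leq_trans m0m)// leqW// leq_addr.
  have xin : norm2 xi <= 2 ^+ (6 * (m + k).+1).
    by rewrite (le_trans (ltW rm))// ler_weXn2l ?ler1n// leq_mul2l /= ltnS leq_addr.
  have ib := inc_bound (m + k)%N xi th Kmk xin tha; rewrite -/c in ib.
  have tri : `|tame_sum K rho x (m + k).+1 c| <= `|tame_sum K rho x (m + k) c| +
      (B' * rho ^+ (m + k).+1 + loss W K rho x (m + k)).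
    set a := tame_sum _ _ _ _.+1 _ in st *; set b := tame_sum _ _ _ _ _ in st *.
    set e := increment _ _ _ _ _ _ in st ib *.
    have -> : a = b + (e + (a - b - e)) by ring.
    rewrite (le_trans (ler_normD _ _))// lerD2l.
    by rewrite (le_trans (ler_normD _ _))// lerD.
  rewrite addnS (le_trans tri)// big_ord_recr /=.
  have q0 : 0 <= rho ^+ (m + k) by rewrite exprn_ge0// ltW.
  have -> : B' / (1 - rho) * (rho ^+ m - rho ^+ (m + k).+1) =
     B' / (1 - rho) * (rho ^+ m - rho ^+ (m + k)) + B' * rho ^+ (m + k).
    by rewrite exprS; field; rewrite gt_eqF.
  have : B' * rho ^+ (m + k).+1 <= B' * rho ^+ (m + k).
    by rewrite ler_wpM2l// exprS ler_piMl// ltW.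
  by lra.
have fin n : (m <= n)%N -> cascade_mass x n - tame_total K rho x n <= eta ->
    `|\sum_(u <- words n) weight x u * c u| <= 3 * eta.
  move=> mn gap.
  have := walk (n - m)%N; rewrite subnKC// => wk.
  have lk := lossK n.
  have dm := hm0 m m0m.
  have d1 : `|\sum_(u <- words n) weight x u * c u - tame_sum K rho x n c| <= eta.
    rewrite /tame_sum -sumrB (le_trans _ gap)// /cascade_mass /tame_total -sumrB.
    apply: (le_trans (ler_norm_sum _ _ _)); apply: ler_sum => u _.
    rewrite -mulrBl normrM ger0_norm ?subr_ge0 ?tame_weight_le//.
    by rewrite ler_piMr ?subr_ge0 ?tame_weight_le.
  have d2 : `|tame_sum K rho x n c| <= 2 * eta.
    apply: (le_trans wk).
    have q : B' / (1 - rho) * (rho ^+ m - rho ^+ n) <= B' / (1 - rho) * rho ^+ m.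
      by rewrite ler_wpM2l ?divr_ge0 ?(ltW d0)// gerBl exprn_ge0// ltW.
    have e : D * rho ^+ m = M * C * rho ^+ m + B' / (1 - rho) * rho ^+ m.
      by rewrite /D mulrDl.
    lra.
  rewrite -[X in `|X|](subrK (tame_sum K rho x n c)) (le_trans (ler_normD _ _))//.
  lra.
move/cvgrPdist_le : cvl => /(_ _ eta0)[N _ hN].
(* A single generation beyond [m] and [N] with a small gap is enough, since there the sum is already
   within [eta] of [l]. *)
have [n Nn gap] := gapK (maxn m N).
move: Nn; rewrite geq_max => /andP[mn Nn].
have := hN n Nn; have := fin n mn gap; rewrite /= -/c.
set s := \sum_(u <- words n) _ => h1 h2.
rewrite -[l](subrK s) (le_trans (ler_normD _ _))// (_ : eps = eta + 3 * eta); last by rewrite /eta; field.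
by rewrite lerD.
Qed.

End deterministic_decay.

(** * Passage from the approximations to the limit measure *)

Section cascade_limits.
Context {R : realType}.
Variables (x : seq bool -> R) (mu : {finite_measure set R -> \bar R}).
Hypothesis x0 : forall v, v != [::] -> 0 <= x v.
Hypothesis x_mu : weak_cvg01 (cascade_approx x) mu.

Lemma within_continuous_bounded_integrable (f : R -> R) :
  {within `[0, 1], continuous f} ->
  mu.-integrable (`[0, 1]%classic : set R) (fun t => (f t)%:E).
Proof.
move=> cf; have [M M0 fM] := within_continuous_bounded cf.
apply: measurable_bounded_integrable.
- exact: measurable_itv.
- by rewrite ltey_eq fin_num_measure//; exact: measurable_itv.
- by apply/measurable_EFinP; exact: measurable_int (within_continuous_integrable cf).
- exists M; split; first exact: num_real.
  by move=> r Mr t t01 /=; apply: le_trans (ltW Mr); exact: fM.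
Qed.

Lemma fin_num_integral_within (f : R -> R) : {within `[0, 1], continuous f} ->
  (\int[mu]_(t in `[0%R, 1%R]) (f t)%:E)%E \is a fin_num.
Proof.
move=> cf; apply: integrable_fin_num; first exact: measurable_itv.
exact: within_continuous_bounded_integrable.
Qed.

Lemma cvg_weighted_average_ge0 (f : R -> R) : {within `[0, 1], continuous f} ->
  (forall t, t \in `[0, 1] -> 0 <= f t) ->
  \sum_(u <- words n) weight x u * average f u @[n --> \oo] -->
  fine (\int[mu]_(t in `[0%R, 1%R]) (f t)%:E)%E.
Proof.
move=> cf f0; have := x_mu cf.
rewrite -{1}(fineK (fin_num_integral_within cf)) => /fine_cvgP[_]; apply: cvg_trans.
by apply: near_eq_cvg; near=> n; rewrite /= integral_cascade_approx.
Unshelve. all: by end_near. Qed.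

Lemma cvg_cascade_mass : cascade_mass x n @[n --> \oo] -->
  fine (\int[mu]_(t in `[0%R, 1%R]) (1 : R)%:E)%E.
Proof.
have c1 : {within (`[0, 1]%classic : set R), continuous (fun=> (1 : R))}.
  exact: within_continuous_cst.
have := cvg_weighted_average_ge0 c1 (fun _ _ => ler01).
by apply: cvg_trans; apply: near_eq_cvg; near=> n; apply: eq_bigr => u _; rewrite average1 mulr1.
Unshelve. all: by end_near. Qed.

Lemma cascade_mass_bounded : exists M, forall n, cascade_mass x n <= M.
Proof.
have /cvg_seq_bounded[M [_ hM]] : cvg (cascade_mass x n @[n --> \oo]).
  by apply/cvg_ex; eexists; exact: cvg_cascade_mass.
exists (M + 1) => n; apply: (le_trans (ler_norm _)).
by apply: hM => //; rewrite ltrDl.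
Qed.

(** Apply the nonnegative case to [f + 1] and subtract the total masses; cosines satisfy the lower
    bound. *)
Lemma cvg_weighted_average (f : R -> R) : {within `[0, 1], continuous f} ->
  (forall t, t \in `[0, 1] -> - 1 <= f t) ->
  \sum_(u <- words n) weight x u * average f u @[n --> \oo] -->
  fine (\int[mu]_(t in `[0%R, 1%R]) (f t)%:E)%E.
Proof.
move=> cf f1; have c1 : {within (`[0, 1]%classic : set R), continuous (fun=> (1 : R))}.
  exact: within_continuous_cst.
have := cvg_weighted_average_ge0 (within_continuous_add cf c1).
move=> /(_ _)/wrap[|cD].
  by move=> t t01; rewrite -lerBlDr sub0r f1.
have i1 := within_continuous_bounded_integrable c1.
have if_ := within_continuous_bounded_integrable cf.
have m01 : measurable (`[0, 1]%classic : set R) by exact: measurable_itv.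
have e : fine (\int[mu]_(t in `[0%R, 1%R]) (f t)%:E)%E =
  fine (\int[mu]_(t in `[0%R, 1%R]) (f t + 1)%:E)%E -
  fine (\int[mu]_(t in `[0%R, 1%R]) (1 : R)%:E)%E.
  rewrite (_ : \int[mu]_(t in _) (f t + 1)%:E = \int[mu]_(t in `[0%R, 1%R]) (f t)%:E +
     \int[mu]_(t in `[0%R, 1%R]) (1 : R)%:E)%E; last first.
    by rewrite -integralD.
  have fD := fineD (fin_num_integral_within cf) (fin_num_integral_within c1).
  by rewrite fD addrK.
rewrite e (_ : (fun n => _) = (fun n =>
    \sum_(u <- words n) weight x u * average (fun t => f t + 1) u - cascade_mass x n)).
  exact: cvgB cD cvg_cascade_mass.
apply/funext => n; rewrite /cascade_mass -sumrB; apply: eq_bigr => u _.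
by rewrite averageD// average1 mulrDr mulr1 addrK.
Qed.

End cascade_limits.

Section pushforward_integral.
Context {R : realType} (mu : {finite_measure set R -> \bar R}) (g : R -> R * R).
Hypothesis mg : measurable_fun (`[0, 1]%classic : set R) g.

Lemma integral_pushforward01 (h : R * R -> \bar R) : measurable_fun setT h ->
  (\int[pushforward01 mu g]_y h y = \int[mu]_(t in `[0%R, 1%R]) h (g t))%E.
Proof.
have m01 : measurable (`[0, 1]%classic : set R) by exact: measurable_itv.
(* [g] is measurable only on [0, 1]. Its extension by zero is measurable everywhere, and the
   restricted measure [nu] does not see the difference. *)
pose g0 : R -> R * R := g \_ `[0, 1]%classic.
have g0E (t : R) : `[0, 1]%classic t -> g0 t = g t.
  by move=> t01; rewrite /g0 patchE mem_set.
have mg0 : measurable_fun setT g0 by by apply/(measurable_restrictT g m01).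
pose nu : {measure set R -> \bar R} := mrestr mu m01.
have -> : pushforward01 mu g = pushforward nu g0.
  apply/funext => A; rewrite /pushforward01 /pushforward /nu /= /mrestr.
  by congr (mu _); apply/seteqP; split => t [At t01]; split => //; move: At; rewrite /preimage/= g0E.
move=> mh; transitivity (\int[nu]_t h (g0 t))%E; last first.
  rewrite /nu integral_mrestr//; last exact: measurableT_comp.
  by apply: eq_integral => t; rewrite inE => t01; rewrite g0E.
rewrite [LHS]integralE [RHS]integralE; congr (_ - _)%E.
  rewrite (ge0_integral_pushforward mg0)//; last exact: measurable_funepos.
  by rewrite preimage_setT; apply: eq_integral => t _; rewrite /= !funeposE.
rewrite (ge0_integral_pushforward mg0)//; last exact: measurable_funeneg.
by rewrite preimage_setT; apply: eq_integral => t _; rewrite /= !funenegE.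
Qed.

Lemma fourier_pushforward01 xi : fourier (pushforward01 mu g) xi =
  (fine (\int[mu]_(t in `[0%R, 1%R]) (arc_cos g xi 0 t)%:E)%E +i*
   fine (\int[mu]_(t in `[0%R, 1%R]) (arc_cos g xi (pi / 2) t)%:E)%E)%C.
Proof.
have md : measurable_fun setT (fun y : R * R => 2 * pi * dot2 xi y).
  apply: measurable_funM => //; apply: measurable_funD;
    by apply: measurable_funM.
rewrite /fourier /integralC; congr (fine _ +i* fine _)%C.
  rewrite integral_pushforward01.
    apply: eq_integral => t _ /=.
    by rewrite cosN /arc_cos /arc_phase addr0.
  apply/measurable_EFinP => /=.
  apply: (measurable_comp (F := setT) (f := @cos R)) => //.
    by apply: continuous_measurable_fun; exact: continuous_cos.
  exact: measurable_funN.
rewrite integral_pushforward01.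
  apply: eq_integral => t _ /=.
  by rewrite sinN /arc_cos /arc_phase cosDpihalf.
apply/measurable_EFinP => /=.
apply: (measurable_comp (F := setT) (f := @sin R)) => //.
  by apply: continuous_measurable_fun; exact: continuous_sin.
exact: measurable_funN.
Qed.

End pushforward_integral.

Lemma ae_copies_ge0 (R : realType)
    (d' : measure_display) (T' : measurableType d') (Q : probability T' R)
    (W : {RV Q >-> R}) (d : measure_display) (T : measurableType d)
    (P : probability T R) (X : seq bool -> {RV P >-> R}) :
  {ae Q, forall y, 0 <= W y} -> iid_copies W X ->
  {ae P, forall w, forall u, u != [::] -> 0 <= X u w}.
Proof.
move=> W0 [_ XW].
have one u : u != [::] -> {ae P, forall w, 0 <= X u w}.
  move=> un; pose A : set R := `]-oo, 0[%classic.
  have mA : measurable A by exact: measurable_itv.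
  have mXA : measurable (X u @^-1` A) by rewrite -[_ @^-1` _]setTI; exact: measurable_funP.
  have mWA : measurable (W @^-1` A) by rewrite -[_ @^-1` _]setTI; exact: measurable_funP.
  exists (X u @^-1` A); split => //.
    rewrite -[LHS]/(distribution P (X u) A) XW// -[LHS]/(Q (W @^-1` A)).
    apply: measure_negligible => //.
    by apply: (negligibleS _ W0) => y; rewrite /A/= in_itv/= => Wy /=; apply/negP; rewrite -ltNge.
  by move=> w /negP; rewrite -ltNge /A /= in_itv.
(* Words are enumerated through [unpickle], so that countably many null sets are united. *)
have : {ae P, forall w, forall n, if unpickle n is Some u then u != [::] -> 0 <= X u w else True}.
  apply: (@ae_foralln _ _ _ P (fun n w => if unpickle n is Some u then u != [::] -> 0 <= X u w else True)) => n; case: (unpickle n : option (seq bool)) => [u|]; last exact: filterE.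
  have [->|un] := eqVneq u [::]; first by apply: filterE => w.
  by apply: filterS (one u un) => w.
apply: filterS => w h u un; have e : unpickle (pickle (u : seq bool)) = Some (u : seq bool).
  exact: pickleK.
by move: (h (pickle (u : seq bool))); rewrite e; exact.
Qed.

Lemma cvg_at_infty2 (R : realType) (F : R * R -> R[i]) :
  (forall eps : R, 0 < eps -> exists r0 : R, forall xi, r0 < norm2 xi ->
     `|complex.Re (F xi)| <= eps /\ `|complex.Im (F xi)| <= eps) ->
  (F : R * R -> R[i]^o) @ at_infty2 --> 0.
Proof.
move=> h; have ff : Filter (@at_infty2 R).
  split.
  - by exists 0.
  - move=> A B [M hM] [N hN]; exists (Num.max M N) => y; rewrite gt_max => /andP[My Ny].
    by split; [exact: hM|exact: hN].
  - by move=> A B AB [M hM]; exists M => y /hM /AB.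
apply/cvgrPdist_le => -[a b]; rewrite ltcE /= => /andP[/eqP b0 a0].
have [r0 hr] := h (a / 2) (divr_gt0 a0 (ltr0n _ 2)).
exists r0 => xi /hr[].
rewrite sub0r normrN normc_def.
case: (F xi) => y z /= hy hz.
rewrite lecE /= b0 eqxx /=.
rewrite -[leRHS]ger0_norm ?(ltW a0)// -sqrtr_sqr ler_wsqrtr//.
have := ler_pM (normr_ge0 _) (normr_ge0 _) hy hy.
have := ler_pM (normr_ge0 _) (normr_ge0 _) hz hz.
rewrite -!normrM !ger0_norm -?expr2 ?sqr_ge0//.
nra.
Qed.

Lemma arc_measurable (R : realType) (g : R -> R * R) : nondegenerate_C2_arc g ->
  measurable_fun (`[0, 1]%classic : set R) g.
Proof.
move=> /arc_continuous[c1 c2].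
have m01 : measurable (`[0, 1]%classic : set R) by exact: measurable_itv.
apply/(measurable_restrictT g m01)/measurable_fun_pairP; split.
  rewrite (_ : fst \o _ = (fst \o g) \_ `[0, 1]%classic); last first.
    by apply/funext => t; rewrite /= !patchE; case: ifP.
  apply/(measurable_restrictT _ m01)/measurable_EFinP.
  exact: measurable_int (within_continuous_integrable c1).
rewrite (_ : snd \o _ = (snd \o g) \_ `[0, 1]%classic); last first.
  by apply/funext => t; rewrite /= !patchE; case: ifP.
apply/(measurable_restrictT _ m01)/measurable_EFinP.
exact: measurable_int (within_continuous_integrable c2).
Qed.

Theorem theorem1p4 (R : realType)
    (d' : measure_display) (T' : measurableType d') (Q : probability T' R)
    (W : {RV Q >-> R})
    (W_ge0 : {ae Q, forall x, 0 <= W x})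
    (W_mean : ('E_Q[W] = 1)%E)
    (W_llogl : ('E_Q[(fun x => W x * log2p (W x))%R] < +oo)%E)
    (W_entropy : ('E_Q[(fun x => W x * log2 (W x))%R] < 1)%E)
    (d : measure_display) (T : measurableType d) (P : probability T R)
    (X : seq bool -> {RV P >-> R})
    (X_iid : iid_copies W X)
    (mu : T -> {finite_measure set R -> \bar R})
    (mu_cascade : is_cascade X mu)
    (g : R -> R * R)
    (g_arc : nondegenerate_C2_arc g) :
  {ae P, forall w, (0 < mu w `[0%R, 1%R]%classic)%E ->
    (fourier (pushforward01 (mu w) g) : R * R -> R[i]^o) @ at_infty2 --> 0}.
Proof.
have W1 := integral_pos W_ge0 W_mean.
have [rho [rho2 rho1 good]] := ae_good_environment X_iid W1 W_ge0 W_mean W_llogl W_entropy.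
have mg := arc_measurable g_arc.
(* The net is built from the curve alone, before sampling; the exceptional null set depends on [g]
   through it. *)
have goodw := good (net g) (fun n c cn u => net_le1 g_arc cn u).
apply: (filterS3 _ _ (ae_copies_ge0 W_ge0 X_iid) mu_cascade goodw) => w X0 [_ Xmu] gw _.
have [M hM] := cascade_mass_bounded X0 Xmu.
apply: cvg_at_infty2 => eps eps0.
have [r0 hr0] := decay_of_good_environment W1 rho2 rho1 g_arc gw hM eps0.
exists r0 => xi xi_big; rewrite fourier_pushforward01//=.
have lim th : \sum_(u <- words n) weight (X ^~ w) u * arc_coef g xi th u @[n --> \oo] -->
    fine (\int[mu w]_(t in `[0%R, 1%R]) (arc_cos g xi th t)%:E)%E.
  apply: (cvg_weighted_average X0 Xmu); first exact: arc_cos_continuous.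
  by move=> t _; exact: cos_geN1.
by split; apply: hr0 (lim _); rewrite ?inE ?eqxx ?orbT.
Qed.
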